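(* Let $M\subset\mathbb C^{2p}$ be a third order perturbation of a product quadric. Suppose that $M$ admits the maximum number of deck transformations and is non-resonant. Suppose that $M$ has no elliptic component ($e_*=0$) and that the eigenvalues of $\sigma$ satisfy the Bruno type condition $$-\sum_{k\ge1}\frac{\log\omega_k}{2^k}<\infty$$ on the resonant ideal. Then all attached formal submanifolds of $M$ are convergent.
   Context: Let $e_*,h_*,s_*\ge0$, $e_*+h_*+2s_*=p$; indices range over $1\le e\le e_*$, $e_*<h\le e_*+h_*$, $e_*+h_*<s\le p-s_*$; $z=(z',z'')\in\mathbb C^p\times\mathbb C^p$. A product quadric is $z_{p+e}=(z_e+2\gamma_e\bar z_e)^2$, $z_{p+h}=(z_h+2\gamma_h\bar z_h)^2$, $z_{p+s}=(z_s+2\gamma_s\bar z_{s+s_*})^2$, $z_{p+s+s_*}=(z_{s+s_*}+2(1-\bar\gamma_s)\bar z_s)^2$ with $0<\gamma_e<1/2$ (elliptic), $\gamma_h>1/2$ (hyperbolic), $\operatorname{Re}\gamma_s>1/2$, $\operatorname{Im}\gamma_s>0$ (complex). $M\colon z_{p+j}=E_j(z',\bar z')$ (real analytic germ at $0$) is a third order perturbation of it if $E_j$ equals the corresponding quadratic polynomial plus terms of order $\ge3$. Complexification: $\mathcal M=\{z_{p+j}=E_j(z',w'),\ w_{p+j}=\bar E_j(w',z')\}$ with coordinates $(z',w')$; $\pi_1(z,w)=z$; $\rho_0(z',w')=(\bar w',\bar z')$; deck transformations are germs of biholomorphisms $F$ of $(\mathcal M,0)$ with $\pi_1F=\pi_1$;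 their maximum number is $2^p$. When attained, they form an abelian group of involutions with unique generators $\tau_{11},\dots,\tau_{1p}$ each fixing a hypersurface pointwise; $\tau_1=\tau_{11}\cdots\tau_{1p}$, $\tau_2=\rho_0\tau_1\rho_0$, $\sigma=\tau_1\tau_2$. The linear part of $\sigma$ has eigenvalues $\mu_1,\dots,\mu_p,\mu_1^{-1},\dots,\mu_p^{-1}$; $M$ is non-resonant if $\mu^Q\ne1$ for all $Q\in\mathbb Z^p\setminus\{0\}$. Put $\hat\mu=(\mu_1,\dots,\mu_p,\mu_1^{-1},\dots,\mu_p^{-1})$, $x=(\xi,\eta)\in\mathbb C^{2p}$, and let $\mathcal I$ be the (resonant) monomial ideal generated by $\xi_1\eta_1,\dots,\xi_p\eta_p$. Then $\omega_k=\inf\{|\hat\mu^Q-\hat\mu_j|\neq0\colon 2\le|Q|\le2^k,\ 1\le j\le2p,\ Q\in\mathbb N^{2p},\ x^Q\notin\mathcal I\}$. A formal complex submanifold $K$ of $\mathbb C^{2p}$ (of dimension $p$, through $0$) is attached to $M$ if $K\cap M$ contains at least two germs of totally real and formal submanifolds of dimension $p$ that intersect transversally at the origin. *)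

(* Defs.v *)
From HB Require Import structures.
From mathcomp Require Import all_boot all_order all_algebra.
From mathcomp Require Import complex.
From mathcomp Require Import all_classical all_reals all_analysis.

Set Implicit Arguments.
Unset Strict Implicit.
Unset Printing Implicit Defensive.

Import Order.TTheory GRing.Theory Num.Theory.

Local Open Scope classical_set_scope.
Local Open Scope complex_scope.
Local Open Scope ring_scope.

Definition mindex (n : nat) := {ffun 'I_n -> nat}.

Definition mdeg n (Q : mindex n) : nat := (\sum_(i < n) Q i)%N.

Definition mzero n : mindex n := [ffun=> 0%N].

Definition munit n (i : 'I_n) : mindex n := [ffun j => nat_of_bool (j == i)].

(** A series is its family of coefficients; the equality of series is the
    Leibniz equality of functions. *)
Definition fps (R : realType) (n : nat) := mindex n -> R[i].

(** An [m]-tuple of series in [n] variables: a formal map from C^n to C^m. *)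
Definition fpsmap (R : realType) (n m : nat) := 'I_m -> fps R n.

Section Series.
Variable R : realType.
Implicit Types n m k : nat.

Definition fzero {n} : fps R n := fun=> 0.

Definition fconst {n} (c : R[i]) : fps R n :=
  fun Q => if Q == mzero n then c else 0.

Definition fvar {n} (i : 'I_n) : fps R n :=
  fun Q => if Q == munit i then 1 else 0.

Definition fadd n (a b : fps R n) : fps R n := fun Q => a Q + b Q.

Definition fmul n (a b : fps R n) : fps R n := fun Q =>
  \sum_(P : {ffun 'I_n -> 'I_(mdeg Q).+1} | [forall i, (P i <= Q i)%N])
    a [ffun i => P i : nat] * b [ffun i => (Q i - P i)%N].

Definition fexp n (a : fps R n) (d : nat) : fps R n :=
  iter d (fmul a) (fconst 1).

Definition fmonom n m (g : fpsmap R n m) (P : mindex m) : fps R n :=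
  \big[@fmul n/fconst 1]_(i < m) fexp (g i) (P i).

(** [fcomp f g] is the series f(g_1, ..., g_m). It is only meaningful when the
    [g i] have no constant term: then the power g^P has no monomial of degree
    less than |P|, so that the exponents P with some P_i > |Q|, which are left
    out of the sum, do not contribute to the coefficient of index Q. *)
Definition fcomp n m (f : fps R m) (g : fpsmap R n m) : fps R n := fun Q =>
  \sum_(P : {ffun 'I_m -> 'I_(mdeg Q).+1})
    f [ffun i => P i : nat] * fmonom g [ffun i => P i : nat] Q.

Definition mcomp n m k (f : fpsmap R m k) (g : fpsmap R n m) : fpsmap R n k :=
  fun i => fcomp (f i) g.

Definition midm {n} : fpsmap R n n := fun i => fvar i.

Definition centered n m (g : fpsmap R n m) := forall i, g i (mzero n) = 0.

Definition jac n m (g : fpsmap R n m) : 'M[R[i]]_(m, n) :=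
  \matrix_(i < m, j < n) g i (munit j).

Definition fconj n (a : fps R n) : fps R n := fun Q => (a Q)^*.

(** Absolute convergence on some polydisc; these series are the germs of
    holomorphic functions at 0. *)
Definition fconvergent n (a : fps R n) := exists2 r : R, 0 < r &
  (\esum_(Q in [set: mindex n]) (Normc.normc (a Q) * r ^+ mdeg Q)%:E < +oo)%E.

Definition mconvergent n m (g : fpsmap R n m) := forall i, fconvergent (g i).

Definition biholomorphic n (F : fpsmap R n n) :=
  [/\ mconvergent F, centered F &
   exists G : fpsmap R n n, [/\ mconvergent G, centered G,
     mcomp F G = midm & mcomp G F = midm]].

Definition ideal n m (f : fpsmap R n m) : set (fps R n) :=
  [set a | exists c : fpsmap R n m,
     a = \big[@fadd n/fzero]_(i < m) fmul (c i) (f i)].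

Definition mpair T p q (a : 'I_p -> T) (b : 'I_q -> T) : 'I_(p + q) -> T :=
  fun i => match fintype.split i with inl j => a j | inr j => b j end.

Definition mfst T p q (a : 'I_(p + q) -> T) : 'I_p -> T :=
  fun j => a (lshift q j).

Definition msnd T p q (a : 'I_(p + q) -> T) : 'I_q -> T :=
  fun j => a (rshift p j).

End Series.

Arguments fzero {R n}.
Arguments fconst {R n} c.
Arguments fvar {R n} i.
Arguments midm {R n}.

Definition qdim (e h s : nat) : nat := e + h + (s + s).

Section Quadrics.
Variables (R : realType) (e h s : nat).
Variables (ge : 'I_e -> R) (gh : 'I_h -> R) (gs : 'I_s -> R[i]).
Local Notation p := (qdim e h s).

Definition quadric_parameters :=
  [/\ forall i, 0 < ge i < 2^-1,
      forall i, 2^-1 < gh i &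
      forall i, 2^-1 < complex.Re (gs i) /\ 0 < complex.Im (gs i)].

Definition quadric_coef : 'I_p -> R[i] :=
  mpair (mpair (fun a => (ge a)%:C) (fun a => (gh a)%:C))
        (mpair gs (fun a => 1 - (gs a)^*)).

(** The index of the conjugate variable occurring in the [j]-th equation:
    [j] itself in the elliptic and hyperbolic blocks, and the index shifted
    by [s] or [- s] in the complex block. *)
Definition quadric_partner : 'I_p -> 'I_p :=
  mpair (fun a : 'I_(e + h) => lshift (s + s) a)
        (mpair (fun a : 'I_s => rshift (e + h) (rshift s a))
               (fun a : 'I_s => rshift (e + h) (lshift s a))).

(** In a series in [p + p] variables the first [p] variables stand for z' and
    the last [p] for the conjugate of z' (for w' after complexification). *)
Definition quadric (j : 'I_p) : fps R (p + p) :=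
  fexp (fadd (fvar (lshift p j))
             (fmul (fconst (2 * quadric_coef j))
                   (fvar (rshift p (quadric_partner j))))) 2.

(** The germ M : z_{p+j} = E_j(z', conj z') is given by the right-hand sides
    [E]. *)
Definition third_order_perturbation (E : fpsmap R (p + p) p) :=
  mconvergent E /\
  forall j Q, (mdeg Q <= 2)%N -> E j Q = quadric j Q.

End Quadrics.

Section Deck.
Variables (R : realType) (p : nat).
Implicit Types (E : fpsmap R (p + p) p) (F : fpsmap R (p + p) (p + p)).

(** The projection (z, w) |-> z in the coordinates (z', w') of the
    complexification of M. *)
Definition pi1 E : fpsmap R (p + p) (p + p) :=
  mpair (fun j => fvar (lshift p j)) E.

Definition deck E F := biholomorphic F /\ mcomp (pi1 E) F = pi1 E.

Definition max_deck E := ([set F | deck E F] #= `I_(2 ^ p))%card.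

(** The hypersurface is given as the image of an immersion of C^(2p-1). *)
Definition fixes_hypersurface F :=
  exists phi : fpsmap R (p + p).-1 (p + p),
    [/\ mconvergent phi, centered phi, \rank (jac phi) = (p + p).-1 &
        mcomp F phi = phi].

Definition mprod (tau : 'I_p -> fpsmap R (p + p) (p + p)) (w : seq 'I_p) :=
  foldr (fun i G => mcomp (tau i) G) (midm) w.

Definition deck_generators E (tau : 'I_p -> fpsmap R (p + p) (p + p)) :=
  (forall i, deck E (tau i) /\ fixes_hypersurface (tau i)) /\
  (forall F, deck E F -> exists w : seq 'I_p, F = mprod tau w).

Definition tau1 tau := mprod tau (enum 'I_p).

Definition mswap (Q : mindex (p + p)) : mindex (p + p) :=
  [ffun i => mpair (msnd Q) (mfst Q) i].

(** [rho0 F rho0], where [rho0 (z', w') = (conj w', conj z')]: its components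
    are those of [F] in exchanged order, with conjugated coefficients and the
    variables z' and w' exchanged. *)
Definition rho0_conj F : fpsmap R (p + p) (p + p) :=
  let G i : fps R (p + p) := fun Q => (F i (mswap Q))^* in
  mpair (msnd G) (mfst G).

Definition tau2 tau := rho0_conj (tau1 tau).

Definition sigma tau := mcomp (tau1 tau) (tau2 tau).

End Deck.

Section Eigenvalues.
Variables (R : realType) (p : nat).
Implicit Types mu : 'I_p -> R[i].

Definition mu_hat mu : 'I_(p + p) -> R[i] := mpair mu (fun j => (mu j)^-1).

Definition eigenvalues (F : fpsmap R (p + p) (p + p)) mu :=
  (forall j, mu j != 0) /\
  char_poly (jac F) = \prod_(i < p + p) ('X - (mu_hat mu i)%:P).

Definition nonresonant mu :=
  forall Q : {ffun 'I_p -> int}, Q != 0 -> \prod_(j < p) mu j ^ Q j != 1.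

Definition resonant_ideal : set (fps R (p + p)) :=
  ideal (fun j : 'I_p => fmul (fvar (lshift p j)) (fvar (rshift p j))).

Definition omega mu (k : nat) : R :=
  inf [set x | exists (Q : mindex (p + p)) (j : 'I_(p + p)),
    [/\ (2 <= mdeg Q <= 2 ^ k)%N,
        ~ resonant_ideal (fmonom (midm) Q),
        x = Normc.normc (\prod_(i < p + p) mu_hat mu i ^+ Q i - mu_hat mu j) &
        x != 0]].

Definition bruno mu :=
  (- (\sum_(1 <= k <oo) (ln (omega mu k) / 2 ^+ k)%:E) < +oo)%E.

End Eigenvalues.

Section Attached.
Variables (R : realType) (p : nat).

(** A formal complex submanifold of codimension [m] of C^n through 0 is
    represented by its ideal of formal power series. *)
Definition defining_equations n m (f : fpsmap R n m) :=
  centered f /\ \rank (jac f) = m.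

Definition formal_submanifold n m (K : set (fps R n)) :=
  exists2 f : fpsmap R n m, defining_equations f & K = ideal f.

Definition convergent_submanifold n m (K : set (fps R n)) :=
  exists f : fpsmap R n m,
    [/\ mconvergent f, defining_equations f & K = ideal f].

Definition tangent n (K : set (fps R n)) : set 'cV[R[i]]_n :=
  [set w | forall a, K a -> \sum_(i < n) a (munit i) * w i ord0 = 0].

(** Formal real submanifolds of dimension [p] of C^n are given by formal
    parametrizations [psi] in [p] real variables, with complex coefficients. *)
Definition tangent_map n (psi : fpsmap R p n) (v : 'cV[R]_p) : 'cV[R[i]]_n :=
  jac psi *m map_mx (real_complex R) v.

Definition totally_real n (psi : fpsmap R p n) :=
  [/\ centered psi,
      forall v, tangent_map psi v = 0 -> v = 0 &
      forall u v, tangent_map psi u = 'i%C *: tangent_map psi v ->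
        tangent_map psi u = 0].

Definition contained_in_complex n (psi : fpsmap R p n) (K : set (fps R n)) :=
  forall a, K a -> fcomp a psi = fzero.

(** As the parameters are real, the conjugate of psi'(t) is the series with
    conjugated coefficients. *)
Definition contained_in_real (psi : fpsmap R p (p + p)) (E : fpsmap R (p + p) p) :=
  msnd psi =
    mcomp E (mpair (mfst psi) (fun j => fconj (mfst psi j))).

(** T_0 N1 + T_0 N2 = T_0 K, transversality inside [K]; the other inclusion
    holds because both real submanifolds are contained in [K]. *)
Definition transversal n (K : set (fps R n)) (psi1 psi2 : fpsmap R p n) :=
  forall w, tangent K w ->
    exists u v, w = tangent_map psi1 u + tangent_map psi2 v.

Definition attached (E : fpsmap R (p + p) p) (K : set (fps R (p + p))) :=
  formal_submanifold p K /\
  exists psi1 psi2 : fpsmap R p (p + p),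
    [/\ totally_real psi1 /\ totally_real psi2,
        contained_in_complex psi1 K /\ contained_in_complex psi2 K,
        contained_in_real psi1 E /\ contained_in_real psi2 E &
        transversal K psi1 psi2].

End Attached.

(* Main.v *)
(** Write the two real submanifolds contained in K and M as t |-> (a_i(t), E(a_i(t), conj a_i(t))).
    In the complexification they become N_i, parametrized by n_i = (a_i, conj a_i). As K is the graph
    of k with k(a_i) = E(n_i), the projection pi_1 sends N_1 and N_2 onto the same K. A deck
    transformation multiplies the linear forms z_j + 2 c_j w_(j') by signs which determine it; the
    maximality assumption provides all sign vectors, and tau_1 is the one with all signs -1. By
    transversality this forces tau_1, hence also tau_2 by conjugation, to exchange N_1 and N_2, so
    that sigma leaves N_1 invariant. The tangent spaces of N_1 and N_2 are complementary and the
    eigenvalues of sigma on N_2 are the inverses of those on N_1; all being simple, sigma restricted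
    to N_1 has exactly one eigenvalue lambda_j out of each pair mu_j, mu_j^-1. Non-resonance allows to
    linearize this restriction formally, which gives a formal phi with
    sigma(phi(x)) = phi(lambda x). The divisors lambda^Q - mu_hat_j in the recursion for phi only
    involve monomials outside the resonant ideal, and the Brjuno condition makes phi convergent
    (Siegel-Brjuno majorants, as in Poeschel's theorem on invariant manifolds). Finally
    k(a_1(theta)) = E(phi) with theta the linearizing coordinates, and k converges by the inverse
    function theorem.

    The counting argument for small divisors is made explicit: instead of estimating products along
    the recursion, one exhibits a weight w on multi-indices, of exponential growth, with
    w_P w_S <= |lambda^(P+S) - mu_hat_j| w_(P+S). *)

From HB Require Import structures.
Require Import Defs.
From mathcomp Require Import all_boot all_order all_algebra.
From mathcomp Require Import complex.
From mathcomp Require Import zify ring lra.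
From mathcomp Require Import separable.
From mathcomp Require Import all_classical all_reals all_analysis.

Set Implicit Arguments.
Unset Strict Implicit.
Unset Printing Implicit Defensive.

Import Order.TTheory GRing.Theory Num.Theory.
Local Open Scope ring_scope.

(** * Formal power series *)

(** The submanifolds N_1 and N_2, hence also sigma restricted to N_1, are only formal, so nothing
    can be estimated on N_1 itself. The linearization theta is built formally there, with divisors
    lambda^Q - lambda_j; convergence is proved for phi = n_1(theta), which solves an equation for
    the convergent map sigma of C^(2p). This is why the estimates involve lambda^Q - mu_hat_j for
    all 2p values of j.

    The sign rule comes from E_j(F) = E_j: as E_j starts with the square of a linear form q_j, the
    product (q_j(F) + q_j)(q_j(F) - q_j) has order at least 3, so one factor has no linear part.
    Repeating this degree by degree shows that the signs determine F. The exchange of N_1 and N_2 is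
    the same argument for (a_1, conj a_1) and (a_1, conj a_2(eta)), eta = a_2^-1 a_1, two lifts of
    the same parametrization of K.

    The weight is the exponential of a superadditive function: for each j, scale k contributes
    log(omega_k / omega_(k+1)) times a count of at most 2|Q| / 2^k, and Abel summation turns the
    Brjuno condition into a bound linear in |Q|. *)

Section Indices.
Variable n : nat.
Implicit Types (P Q S : mindex n) (i : 'I_n) (d : nat).

Lemma mindexDE P Q i : (P + Q) i = (P i + Q i)%N.
Proof. by rewrite ffunE. Qed.

Lemma mdegD P Q : mdeg (P + Q) = (mdeg P + mdeg Q)%N.
Proof. by rewrite /mdeg -big_split; apply: eq_bigr => i _; rewrite mindexDE. Qed.

Lemma mdeg0 : mdeg (0 : mindex n) = 0%N.
Proof. by rewrite /mdeg big1 // => i _; rewrite ffunE. Qed.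

Lemma mdeg_unit i : mdeg (munit i) = 1%N.
Proof.
rewrite /mdeg (bigD1 i) //= ffunE eqxx big1 // => j /negbTE ji.
by rewrite ffunE ji.
Qed.

Lemma leq_mdeg P i : (P i <= mdeg P)%N.
Proof. by rewrite /mdeg (bigD1 i) //= leq_addr. Qed.

Lemma mdeg_eq0 P : (mdeg P == 0%N) = (P == 0).
Proof.
apply/idP/eqP => [/eqP h|->]; last by rewrite mdeg0.
by apply/ffunP => i; rewrite ffunE; apply/eqP; rewrite -leqn0 -h leq_mdeg.
Qed.

Lemma mdeg_gt0 P : (0 < mdeg P)%N = (P != 0).
Proof. by rewrite lt0n mdeg_eq0. Qed.

Lemma munit_neq0 i : munit i != 0.
Proof. by rewrite -mdeg_eq0 mdeg_unit. Qed.

Lemma mindex_addI P : injective (+%R P).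
Proof.
move=> Q S /ffunP h; apply/ffunP => i.
by have := h i; rewrite !mindexDE => /addnI.
Qed.

Lemma munit_inj : injective (@munit n).
Proof.
by move=> i j /ffunP/(_ i); rewrite !ffunE eqxx; case: eqP.
Qed.

Lemma munitP i P : (0 < P i)%N -> exists2 Q, P = Q + munit i & (mdeg P = (mdeg Q).+1)%N.
Proof.
move=> Pi; set Q : mindex n := [ffun j => P j - munit i j]%N.
have e : P = Q + munit i.
  apply/ffunP => j; rewrite mindexDE ffunE subnK // ffunE.
  by case: eqP => // ->.
by exists Q; rewrite // e mdegD mdeg_unit addn1.
Qed.

Lemma mindex_neq0 P : P != 0 -> exists i, (0 < P i)%N.
Proof.
move=> P0; apply/existsP; apply: contraNT P0; rewrite negb_exists => /forallP h.
by apply/eqP/ffunP => i; rewrite ffunE; apply/eqP; rewrite -leqn0 leqNgt.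
Qed.

Lemma mdeg1P P : mdeg P = 1%N -> exists i, P = munit i.
Proof.
move=> P1; have [|i Pi] := @mindex_neq0 P; first by rewrite -mdeg_eq0 P1.
have [Q eP] := munitP Pi; rewrite P1 eP => -[/esym/eqP].
by rewrite mdeg_eq0 => /eqP ->; exists i; rewrite add0r.
Qed.

Definition mbox d (P : {ffun 'I_n -> 'I_d.+1}) : mindex n :=
  [ffun i => P i : nat].

Lemma mbox_inj d : injective (@mbox d).
Proof.
move=> P Q /ffunP h; apply/ffunP => i; apply/val_inj.
by have := h i; rewrite !ffunE.
Qed.

(** The boxes summed over in [fmul] and [fcomp] depend on the coefficient that is computed. A list
    whose bound [d] can be enlarged at will serves several coefficients at once, so that sums can be
    exchanged. *)
Definition mlist d : seq (mindex n) :=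
  [seq P <- [seq mbox P | P : {ffun 'I_n -> 'I_d.+1}] | (mdeg P <= d)%N].

Lemma mlist_uniq d : uniq (mlist d).
Proof. by rewrite filter_uniq // (map_inj_uniq (@mbox_inj d)) enum_uniq. Qed.

Lemma mem_mbox d P :
  (P \in [seq mbox P | P : {ffun 'I_n -> 'I_d.+1}]) = [forall i, (P i <= d)%N].
Proof.
apply/mapP/forallP => [[S _ ->] i|h]; first by rewrite ffunE -ltnS.
exists [ffun i => inord (P i)]; first by rewrite mem_enum.
by apply/ffunP => i; rewrite !ffunE inordK // ltnS.
Qed.

Lemma mem_mlist d P : (P \in mlist d) = (mdeg P <= d)%N.
Proof.
rewrite mem_filter mem_mbox andb_idr // => h.
by apply/forallP => i; rewrite (leq_trans (leq_mdeg P i)).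
Qed.

Section Sums.
Variable V : nmodType.
Implicit Types F : mindex n -> V.

Lemma big_mlist_pred1 d Q F : (mdeg Q <= d)%N ->
  \sum_(P <- mlist d) (if P == Q then F P else 0) = F Q.
Proof.
move=> Qd; rewrite (bigD1_seq Q) ?mem_mlist ?mlist_uniq //= eqxx.
by rewrite big1 ?addr0 // => P /negbTE ->.
Qed.

Lemma big_mlist_addl d P Q F : (mdeg Q <= d)%N ->
  \sum_(S <- mlist d) (if P + S == Q then F S else 0) =
  if [forall i, (P i <= Q i)%N] then F [ffun i => (Q i - P i)%N] else 0.
Proof.
move=> Qd; case: ifPn => [/forallP PQ|/forallPn[i PQ]]; last first.
  rewrite big1 // => S _; case: eqP => // e.
  by move: PQ; rewrite -e mindexDE leq_addr.
have e : Q = P + [ffun i => (Q i - P i)%N].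
  by apply/ffunP => i; rewrite mindexDE ffunE subnKC.
rewrite -[RHS](@big_mlist_pred1 d) ?(leq_trans _ Qd) //; last first.
  by rewrite [X in (_ <= mdeg X)%N]e mdegD leq_addl.
by apply: eq_bigr => S _; rewrite {1}e (inj_eq (@mindex_addI P)).
Qed.

Lemma big_mlist_cond d d' F : (d <= d')%N ->
  \sum_(P <- mlist d') (if (mdeg P <= d)%N then F P else 0) = \sum_(P <- mlist d) F P.
Proof.
move=> dd'; rewrite -big_mkcond -big_filter; apply: perm_big.
apply: uniq_perm; [exact/filter_uniq/mlist_uniq|exact: mlist_uniq|move=> P].
by rewrite mem_filter !mem_mlist; case: leqP => //= /leq_trans ->.
Qed.

Lemma big_mbox d (C : pred (mindex n)) F : (forall P, C P -> (mdeg P <= d)%N) ->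
  \sum_(P : {ffun 'I_n -> 'I_d.+1} | C (mbox P)) F (mbox P) =
  \sum_(P <- mlist d | C P) F P.
Proof.
move=> Cd; rewrite [RHS]big_filter_cond big_image_cond /=; apply: eq_bigl => P.
by rewrite andb_idl // => /Cd.
Qed.

Lemma big_mlist0 F : \sum_(P <- mlist 0) F P = F 0.
Proof.
rewrite -[RHS](@big_mlist_pred1 0 0 F) ?mdeg0 // big_seq [RHS]big_seq.
apply: eq_bigr => P; rewrite mem_mlist leqn0 mdeg_eq0 => /eqP ->.
by rewrite eqxx.
Qed.

End Sums.
End Indices.

Section Ring.
Variable R : realType.
Variable n : nat.
Implicit Types (a b c : fps R n) (P Q S : mindex n) (d : nat).

HB.instance Definition _ := GRing.Zmodule.copy (fps R n) (mindex n -> R[i]).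

Lemma fps_ext a b : (forall Q, a Q = b Q) -> a = b.
Proof. exact: funext. Qed.

Lemma fcoefD a b Q : (a + b) Q = a Q + b Q. Proof. by []. Qed.
Lemma fcoefN a Q : (- a) Q = - a Q. Proof. by []. Qed.
Lemma fcoefB a b Q : (a - b) Q = a Q - b Q. Proof. by []. Qed.

Lemma fcoef_sum (I : Type) (r : seq I) (C : pred I) (F : I -> fps R n) Q :
  (\sum_(i <- r | C i) F i) Q = \sum_(i <- r | C i) F i Q.
Proof. by elim/big_ind2: _ => // ? ? ? ? <- <-. Qed.

(** In this symmetric form of the convolution, commutativity and associativity become exchanges of
    finite sums. *)
Lemma fmul_mlist d a b Q : (mdeg Q <= d)%N ->
  fmul a b Q = \sum_(P <- mlist n d) \sum_(S <- mlist n d)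
    if P + S == Q then a P * b S else 0.
Proof.
move=> Qd; under [RHS]eq_bigr => P _ do
  rewrite (big_mlist_addl P (fun S => a P * b S) Qd).
rewrite -big_mkcond /=.
pose C P := [forall i, (P i <= Q i)%N].
have CP P : C P -> (mdeg P <= mdeg Q)%N by move=> /forallP h; apply: leq_sum.
transitivity (\sum_(P <- mlist n (mdeg Q) | C P) a P * b [ffun i => (Q i - P i)%N]).
  rewrite -(big_mbox (fun P => a P * b [ffun i => (Q i - P i)%N]) CP).
  rewrite /fmul; apply: eq_big => [P|P _].
    by apply: eq_forallb => i; rewrite ffunE.
  by congr (_ * b _); apply/ffunP => i; rewrite !ffunE.
rewrite big_mkcond -(big_mlist_cond _ Qd) [RHS]big_mkcond; apply: eq_bigr => P _.
by case: ifPn => //; case: ifP => // /CP ->.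
Qed.

Lemma fmulC : commutative (@fmul R n).
Proof.
move=> a b; apply: fps_ext => Q; rewrite !(fmul_mlist _ _ (leqnn _)) exchange_big.
by apply: eq_bigr => P _; apply: eq_bigr => S _; rewrite addrC mulrC.
Qed.

Lemma fmul_triple d a b c Q : (mdeg Q <= d)%N ->
  fmul a (fmul b c) Q = \sum_(P <- mlist n d) \sum_(S <- mlist n d)
    \sum_(T <- mlist n d) if P + (S + T) == Q then a P * (b S * c T) else 0.
Proof.
move=> Qd; rewrite (fmul_mlist _ _ Qd); apply: eq_bigr => P _.
transitivity (\sum_(V <- mlist n d) \sum_(S <- mlist n d) \sum_(T <- mlist n d)
    if S + T == V then if P + V == Q then a P * (b S * c T) else 0 else 0).
  rewrite big_seq [RHS]big_seq; apply: eq_bigr => V; rewrite mem_mlist => Vd.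
  case: eqP => [PV|_]; last first.
    by rewrite big1 // => S _; rewrite big1 // => T _; rewrite if_same.
  rewrite (fmul_mlist _ _ Vd) big_distrr; apply: eq_bigr => S _ /=.
  by rewrite big_distrr; apply: eq_bigr => T _ /=; case: ifP; rewrite ?mulr0.
rewrite exchange_big; apply: eq_bigr => S _; rewrite exchange_big.
apply: eq_bigr => T _; have [STd|STd] := leqP (mdeg (S + T)) d.
  under eq_bigr => V _ do rewrite eq_sym.
  exact: (big_mlist_pred1 (fun V => if P + V == Q then a P * (b S * c T) else 0)).
have [PQ|_] := eqVneq (P + (S + T)) Q.
  by move: STd; rewrite ltnNge (leq_trans _ Qd) // -PQ [X in (_ <= X)%N]mdegD leq_addl.
rewrite big_seq big1 // => V; rewrite mem_mlist => Vd.
by case: eqP => // e; move: STd; rewrite e ltnNge Vd.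
Qed.

Lemma fmulA : associative (@fmul R n).
Proof.
move=> a b c; rewrite [fmul (fmul a b) c]fmulC; apply: fps_ext => Q.
rewrite !(fmul_triple _ _ _ (leqnn _)).
under [RHS]eq_bigr => P _ do under eq_bigr => S _ do under eq_bigr => T _ do
  rewrite addrC [c P * _]mulrC -addrA -mulrA.
rewrite [RHS]exchange_big; apply: eq_bigr => S _.
rewrite [RHS]exchange_big; apply: eq_bigr => T _; exact: eq_bigr.
Qed.

Lemma fmul_const (k : R[i]) a Q : fmul (fconst k) a Q = k * a Q.
Proof.
rewrite (fmul_mlist _ _ (leqnn _)).
rewrite (bigD1_seq 0) ?mem_mlist ?mdeg0 ?mlist_uniq //= [X in _ + X]big1.
  rewrite addr0; under eq_bigr => S _ do rewrite add0r.
  by rewrite (big_mlist_pred1 (fun S => fconst k 0 * a S)) //= /fconst eqxx.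
move=> P /negbTE P0; rewrite big1 // => S _.
by rewrite /fconst P0 mul0r if_same.
Qed.

Lemma fmul1 : left_id (fconst 1) (@fmul R n).
Proof. by move=> a; apply: fps_ext => Q; rewrite fmul_const mul1r. Qed.

Lemma fmulDl : left_distributive (@fmul R n) +%R.
Proof.
move=> a b c; apply: fps_ext => Q; rewrite fcoefD !(fmul_mlist _ _ (leqnn _)).
rewrite -big_split; apply: eq_bigr => P _; rewrite -big_split; apply: eq_bigr => S _ /=.
by case: ifP; rewrite ?addr0 // mulrDl.
Qed.

Lemma fconst1_neq0 : fconst 1 != 0 :> fps R n.
Proof.
apply/eqP => /(congr1 (fun a : fps R n => a 0)) /eqP.
by rewrite /fconst eqxx oner_eq0.
Qed.

HB.instance Definition _ := GRing.Zmodule_isComNzRing.Build (fps R n)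
  fmulA fmulC fmul1 fmulDl fconst1_neq0.

Lemma fps1E : fconst 1 = 1 :> fps R n. Proof. by []. Qed.
Lemma fcoef1 Q : (1 : fps R n) Q = if Q == 0 then 1 else 0. Proof. by []. Qed.
Lemma fpsexpE a d : fexp a d = a ^+ d.
Proof. by elim: d => // d IH; rewrite exprS -IH. Qed.

Lemma fcoefM d a b Q : (mdeg Q <= d)%N ->
  (a * b) Q = \sum_(P <- mlist n d) \sum_(S <- mlist n d)
    if P + S == Q then a P * b S else 0.
Proof. exact: fmul_mlist. Qed.

Lemma fcoefCM (k : R[i]) a Q : (fconst k * a) Q = k * a Q.
Proof. exact: fmul_const. Qed.

Lemma fcoefVM i a Q : (fvar i * a) (Q + munit i) = a Q.
Proof.
rewrite (fcoefM _ _ (leqnn _)) (bigD1_seq (munit i)) ?mlist_uniq ?mem_mlist //=; last first.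
  by rewrite mdegD leq_addl.
rewrite [X in _ + X]big1 ?addr0 => [|P /negbTE Pi]; last first.
  by rewrite big1 // => S _; rewrite /fvar Pi mul0r if_same.
under eq_bigr => S _ do
  rewrite [Q + _]addrC (inj_eq (@mindex_addI _ (munit i))) /fvar eqxx mul1r.
by apply: big_mlist_pred1; rewrite mdegD leq_addr.
Qed.

Lemma fcoefVM0 i a Q : Q i = 0%N -> (fvar i * a) Q = 0.
Proof.
move=> Qi; rewrite (fcoefM _ _ (leqnn _)) big1 // => P _; rewrite big1 // => S _.
case: eqP => // PQ; rewrite /fvar; case: eqP => [Pi|_]; last by rewrite mul0r.
by move: Qi; rewrite -PQ Pi mindexDE ffunE eqxx.
Qed.
End Ring.

(** * Order of vanishing and division by variables *)

Section Order.
Variables (R : realType) (n : nat).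
Implicit Types (a b c : fps R n) (P Q S : mindex n) (d k : nat) (i : 'I_n).

Definition ford k a := forall Q, (mdeg Q < k)%N -> a Q = 0.

Lemma ford1P a : ford 1 a <-> a 0 = 0.
Proof.
split=> [h|a0 Q]; first by rewrite h ?mdeg0.
by rewrite ltnS leqn0 mdeg_eq0 => /eqP ->.
Qed.

Lemma fordW k d a : (d <= k)%N -> ford k a -> ford d a.
Proof. by move=> dk h Q Qd; rewrite h // (leq_trans Qd). Qed.

Lemma fordD k a b : ford k a -> ford k b -> ford k (a + b).
Proof. by move=> ha hb Q Qk; rewrite fcoefD ha // hb // addr0. Qed.

Lemma fordN k a : ford k a -> ford k (- a).
Proof. by move=> ha Q Qk; rewrite fcoefN ha // oppr0. Qed.

Lemma fordB k a b : ford k a -> ford k b -> ford k (a - b).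
Proof. by move=> ha hb; apply: fordD => //; apply: fordN. Qed.

Lemma ford_sum (I : Type) (r : seq I) (C : pred I) (F : I -> fps R n) k :
  (forall x, C x -> ford k (F x)) -> ford k (\sum_(x <- r | C x) F x).
Proof. by move=> h; elim/big_ind: _ => //; exact: fordD. Qed.

Lemma fordM k d a b : ford k a -> ford d b -> ford (k + d) (a * b).
Proof.
move=> ha hb Q Qkd; rewrite (fcoefM _ _ (leqnn _)) big1 // => P _; rewrite big1 // => S _.
case: eqP => // PS; have [Pk|kP] := ltnP (mdeg P) k; first by rewrite ha ?mul0r.
rewrite [b S]hb ?mulr0 // -(ltn_add2l k) (leq_ltn_trans _ Qkd) //.
by rewrite -PS mdegD leq_add2r.
Qed.

Lemma fordMl k a b : ford k a -> ford k (a * b).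
Proof. by move=> ha; rewrite -[k]addn0; apply: fordM. Qed.

Lemma fordMr k a b : ford k b -> ford k (a * b).
Proof. by move=> ha; rewrite mulrC; apply: fordMl. Qed.

Lemma fordX k d a : ford k a -> ford (k * d) (a ^+ d).
Proof.
move=> ha; elim: d => [|d IH]; first by rewrite muln0.
by rewrite exprS mulnS; apply: fordM.
Qed.

Lemma ford_ext a b : (forall k, ford k (a - b)) -> a = b.
Proof.
move=> h; apply: fps_ext => Q; apply/eqP; rewrite -subr_eq0; apply/eqP.
exact: (h (mdeg Q).+1 Q).
Qed.

Lemma ford_var i : ford 1 (fvar i : fps R n).
Proof.
by apply/ford1P; rewrite /fvar; case: eqP => // /esym/eqP; rewrite (negbTE (munit_neq0 i)).
Qed.

Lemma fcoefM_unit i a b :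
  (a * b) (munit i) = a 0 * b (munit i) + a (munit i) * b 0.
Proof.
have split_const c : exists2 c' : fps R n, c = fconst (c 0) + c' & ford 1 c'.
  exists (c - fconst (c 0)); first by rewrite addrC subrK.
  by apply/ford1P; rewrite fcoefB /fconst eqxx subrr.
have [a' ea a1] := split_const a; have [b' eb b1] := split_const b.
have ab : (a' * b') (munit i) = 0 by apply: (fordM a1 b1); rewrite mdeg_unit.
have Cu (k : R[i]) : (fconst k : fps R n) (munit i) = 0.
  by rewrite /fconst (negbTE (munit_neq0 i)).
have au : a (munit i) = a' (munit i) by rewrite ea fcoefD Cu add0r.
have bu : b (munit i) = b' (munit i) by rewrite eb fcoefD Cu add0r.
rewrite [in LHS]ea [in LHS]eb mulrDl fcoefD fcoefCM [a' * _]mulrDr !fcoefD ab addr0.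
by rewrite (mulrC a') fcoefCM Cu add0r au bu [_ * b 0]mulrC.
Qed.

(* Each monomial is divided by its last variable only, so that the quotients by
   the first variables do not involve the later ones. *)
Definition fdiv i a : fps R n := fun Q =>
  if [forall j : 'I_n, (i < j)%N ==> (Q j == 0%N)] then a (Q + munit i) else 0.

Lemma fdiv_sum a : a = fconst (a 0) + \sum_i fvar i * fdiv i a.
Proof.
apply: fps_ext => Q; rewrite fcoefD fcoef_sum.
have [->|Q0] := eqVneq Q 0.
  rewrite big1 ?addr0 ?/fconst ?eqxx // => i _.
  by rewrite fcoefVM0 // ffunE.
rewrite /fconst [Q == _](negbTE Q0) add0r; have [i1 Qi1] := mindex_neq0 Q0.
(* [i0] is the last variable occurring in the monomial Q; by the choice made in [fdiv], its summand
   alone contributes. *)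
have [i0 Qi0 hi0'] := @arg_maxnP _ i1 (fun i => 0 < Q i)%N (fun i => i : nat) Qi1.
have hi0 j : (0 < Q j)%N -> (j <= i0)%N by exact: hi0'.
have [Q' eQ _] := munitP Qi0.
rewrite (bigD1 i0) //= {2}eQ fcoefVM [X in _ + X]big1 ?addr0.
  rewrite /fdiv -eQ; case: ifPn => // /forallPn[j].
  rewrite negb_imply => /andP[ij Qj]; have : (0 < Q j)%N.
    by rewrite eQ mindexDE; case: (Q' j) Qj.
  by move/hi0; rewrite leqNgt ij.
move=> i ii0; have [Qi|Qi] := posnP (Q i); first by rewrite fcoefVM0.
have [S eS _] := munitP Qi; rewrite eS fcoefVM /fdiv ifN //; apply/forallPn; exists i0.
have := hi0 _ Qi; rewrite leq_eqVlt (inj_eq val_inj) (negbTE ii0) /= => lt.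
rewrite negb_imply lt /=; move: Qi0; rewrite eS mindexDE ffunE.
by rewrite eq_sym (negbTE ii0) addn0 -lt0n.
Qed.

Lemma ford_fdiv k i a : ford k.+1 a -> ford k (fdiv i a).
Proof.
move=> ha Q Qk; rewrite /fdiv; case: ifP => // _; rewrite ha // mdegD mdeg_unit.
by rewrite addn1 ltnS.
Qed.

Lemma fcoef0_fdiv i a : fdiv i a 0 = a (munit i).
Proof.
by rewrite /fdiv add0r ifT //; apply/forallP => j; rewrite ffunE eqxx implybT.
Qed.

End Order.

(** * Composition of formal series *)

Section Comp.
Variables (R : realType) (n m : nat).
Implicit Types (a b c : fps R m) (g : fpsmap R n m) (Q : mindex n) (d k : nat).

Lemma centeredP g : centered g <-> forall i, ford 1 (g i).
Proof. by split=> h i; have /ford1P := h i. Qed.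

Lemma fmonomE g (P : mindex m) : fmonom g P = \prod_(i < m) g i ^+ P i.
Proof. by rewrite /fmonom; apply: eq_bigr => i _; apply: fpsexpE. Qed.

Lemma fmonomD g (P P' : mindex m) : fmonom g (P + P') = fmonom g P * fmonom g P'.
Proof.
by rewrite !fmonomE -big_split; apply: eq_bigr => i _; rewrite mindexDE exprD.
Qed.

Lemma fmonom0 g : fmonom g 0 = 1.
Proof. by rewrite fmonomE big1 // => i _; rewrite ffunE expr0. Qed.

Lemma fmonom_unit g i : fmonom g (munit i) = g i.
Proof.
rewrite fmonomE (bigD1 i) //= ffunE eqxx expr1 big1 ?mulr1 // => j /negbTE ji.
by rewrite ffunE ji.
Qed.

Lemma ford_fmonom g (P : mindex m) : centered g -> ford (mdeg P) (fmonom g P).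
Proof.
move=> /centeredP gc; rewrite fmonomE /mdeg.
elim/big_ind2: _ => // [? ? ? ?|i _]; first exact: fordM.
by have := @fordX _ _ 1 (P i) _ (gc i); rewrite mul1n.
Qed.

(** The terms with |P| > |Q| vanish because [g] is centered, so the box of [fcomp] may be replaced
    by any sufficiently long list. *)
Lemma fcompE d a g Q : centered g -> (mdeg Q <= d)%N ->
  fcomp a g Q = \sum_(P <- mlist m d) a P * fmonom g P Q.
Proof.
move=> gc Qd; pose F P := a P * fmonom g P Q.
have F0 P : (mdeg Q < mdeg P)%N -> F P = 0.
  by move=> QP; rewrite /F (ford_fmonom gc) ?mulr0.
rewrite /fcomp -/(mbox _).
transitivity (\sum_(P : {ffun 'I_m -> 'I_(mdeg Q).+1} | (mdeg (mbox P) <= mdeg Q)%N)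
    F (mbox P)).
  rewrite [RHS]big_mkcond; apply: eq_bigr => P _.
  by case: leqP => // /F0.
rewrite (@big_mbox _ _ _ (fun P => mdeg P <= mdeg Q)%N) // big_mkcond.
rewrite big_mlist_cond // -(big_mlist_cond F Qd); apply: eq_bigr => P _.
by case: leqP => // /F0.
Qed.

Section Centered.
Variables (g : fpsmap R n m) (gc : centered g).

Lemma fcomp_coef0 a : fcomp a g 0 = a 0.
Proof.
by rewrite (@fcompE 0) ?mdeg0 // big_mlist0 fmonom0 fcoef1 eqxx mulr1.
Qed.

Lemma fcompD a b : fcomp (a + b) g = fcomp a g + fcomp b g.
Proof.
apply: fps_ext => Q; rewrite fcoefD !(fcompE _ gc (leqnn _)) -big_split.
by apply: eq_bigr => P _; rewrite fcoefD mulrDl.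
Qed.

Lemma fcomp0 : fcomp 0 g = 0.
Proof. by apply: (addrI (fcomp 0 g)); rewrite -fcompD !addr0. Qed.

Lemma fcompN a : fcomp (- a) g = - fcomp a g.
Proof. by apply: (addrI (fcomp a g)); rewrite -fcompD !subrr fcomp0. Qed.

Lemma fcompB a b : fcomp (a - b) g = fcomp a g - fcomp b g.
Proof. by rewrite fcompD fcompN. Qed.

Lemma fcomp_sum (I : Type) (r : seq I) (C : pred I) (F : I -> fps R m) :
  fcomp (\sum_(x <- r | C x) F x) g = \sum_(x <- r | C x) fcomp (F x) g.
Proof. by elim/big_ind2: _ => [|? ? ? ? <- <-|]; rewrite ?fcomp0 ?fcompD. Qed.

Lemma fcompM a b : fcomp (a * b) g = fcomp a g * fcomp b g.
Proof.
apply: fps_ext => Q; set d := mdeg Q.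
rewrite (fcompE _ gc (leqnn _)) (fcoefM _ _ (leqnn _)) -/d.
pose M P P' := a P * b P' * (fmonom g P * fmonom g P') Q.
transitivity (\sum_(P <- mlist m d) \sum_(P' <- mlist m d) M P P').
  transitivity (\sum_(S <- mlist m d) \sum_(P <- mlist m d) \sum_(P' <- mlist m d)
     if P + P' == S then M P P' else 0).
    rewrite big_seq [RHS]big_seq; apply: eq_bigr => S; rewrite mem_mlist => Sd.
    rewrite (fcoefM _ _ Sd) big_distrl; apply: eq_bigr => P _ /=.
    rewrite big_distrl; apply: eq_bigr => P' _ /=.
    by case: eqP => [<-|_]; rewrite ?mul0r // fmonomD.
  rewrite exchange_big; apply: eq_bigr => P _; rewrite exchange_big; apply: eq_bigr => P' _.
  under eq_bigr => S _ do rewrite eq_sym.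
  have [PP'|PP'] := leqP (mdeg (P + P')) d; first exact: (big_mlist_pred1 (fun=> M P P')).
  rewrite {2}/M -fmonomD (ford_fmonom gc) // mulr0 big_seq big1 // => S.
  by rewrite mem_mlist; case: eqP => // -> /leq_gtF; rewrite PP'.
transitivity (\sum_(T <- mlist n d) \sum_(V <- mlist n d) \sum_(P <- mlist m d) \sum_(P' <- mlist m d)
   if T + V == Q then (a P * fmonom g P T) * (b P' * fmonom g P' V) else 0).
  have -> (F : mindex n -> mindex n -> mindex m -> mindex m -> R[i]) :
     \sum_(T <- mlist n d) \sum_(V <- mlist n d) \sum_(P <- mlist m d) \sum_(P' <- mlist m d) F T V P P' =
     \sum_(P <- mlist m d) \sum_(P' <- mlist m d) \sum_(T <- mlist n d) \sum_(V <- mlist n d) F T V P P'.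
    under eq_bigr => T _ do rewrite exchange_big.
    rewrite exchange_big; apply: eq_bigr => P _.
    under eq_bigr => T _ do rewrite exchange_big.
    by rewrite exchange_big.
  apply: eq_bigr => P _; apply: eq_bigr => P' _.
  rewrite /M (fcoefM _ _ (leqnn _)) big_distrr; apply: eq_bigr => T _ /=.
  rewrite big_distrr; apply: eq_bigr => V _ /=.
  by case: ifP; rewrite ?mulr0 // mulrACA.
rewrite big_seq [RHS]big_seq; apply: eq_bigr => T; rewrite mem_mlist => Td.
rewrite big_seq [RHS]big_seq; apply: eq_bigr => V; rewrite mem_mlist => Vd.
rewrite !(@fcompE d _ _ _ gc) //; case: ifP => _; last by rewrite big1 // => P _; rewrite big1.
by rewrite big_distrl; apply: eq_bigr => P _ /=; rewrite big_distrr.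
Qed.

Lemma fcomp_const (x : R[i]) : fcomp (fconst x) g = fconst x.
Proof.
apply: fps_ext => Q; rewrite (fcompE _ gc (leqnn _)).
transitivity (\sum_(P <- mlist m (mdeg Q)) if P == 0 then x * fmonom g P Q else 0).
  by apply: eq_bigr => P _; rewrite /fconst; case: eqP; rewrite ?mul0r.
rewrite (big_mlist_pred1 (fun P => x * fmonom g P Q)) ?mdeg0 //.
by rewrite fmonom0 fcoef1 /fconst; case: eqP => _; rewrite ?mulr1 ?mulr0.
Qed.

Lemma fcomp1 : fcomp 1 g = 1.
Proof. exact: fcomp_const. Qed.

Lemma fcompX a k : fcomp (a ^+ k) g = fcomp a g ^+ k.
Proof.
by elim: k => [|k IH]; rewrite ?expr0 ?fcomp1 // !exprS fcompM IH.
Qed.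

Lemma fcomp_prod (I : Type) (r : seq I) (C : pred I) (F : I -> fps R m) :
  fcomp (\prod_(x <- r | C x) F x) g = \prod_(x <- r | C x) fcomp (F x) g.
Proof. by elim/big_ind2: _ => [|? ? ? ? <- <-|]; rewrite ?fcomp1 ?fcompM. Qed.

Lemma fcomp_monom_coef d (P : mindex m) Q : (mdeg Q <= d)%N ->
  fmonom g P Q = \sum_(S <- mlist m d) (if S == P then fmonom g S Q else 0).
Proof.
move=> Qd; have [Pd|dP] := leqP (mdeg P) d.
  by rewrite (big_mlist_pred1 (fun S => fmonom g S Q)).
rewrite (ford_fmonom gc) ?(leq_ltn_trans Qd) // big_seq big1 // => S.
by rewrite mem_mlist; case: eqP => // -> /leq_gtF; rewrite dP.
Qed.

Lemma fcomp_var i : fcomp (fvar i) g = g i.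
Proof.
apply: fps_ext => Q; rewrite (fcompE _ gc (leqnn _)) -(fmonom_unit g i).
rewrite (fcomp_monom_coef (munit i) (leqnn _)); apply: eq_bigr => P _.
by rewrite /fvar; case: eqP; rewrite ?mul1r ?mul0r.
Qed.

Lemma ford_fcomp k a : ford k a -> ford k (fcomp a g).
Proof.
move=> ha Q Qk; rewrite (fcompE _ gc (leqnn _)) big_seq big1 // => P.
by rewrite mem_mlist => PQ; rewrite ha ?mul0r // (leq_ltn_trans PQ).
Qed.

(** A Hadamard decomposition. It serves to gain orders of vanishing in [fcomp_gain] and to obtain a
    quadratic recursion for the majorants. *)
Lemma fcomp_fdiv a : fcomp a g = fconst (a 0) + \sum_i g i * fcomp (fdiv i a) g.
Proof.
rewrite [in LHS](fdiv_sum a) fcompD fcomp_const fcomp_sum; congr (_ + _).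
by apply: eq_bigr => i _; rewrite fcompM fcomp_var.
Qed.

Lemma fcomp_unit a j :
  fcomp a g (munit j) = \sum_i a (munit i) * g i (munit j).
Proof.
rewrite fcomp_fdiv fcoefD /fconst (negbTE (munit_neq0 j)) add0r fcoef_sum.
apply: eq_bigr => i _; rewrite fcoefM_unit fcomp_coef0 fcoef0_fdiv.
by have /centeredP/(_ i)/ford1P -> := gc; rewrite mul0r add0r mulrC.
Qed.

End Centered.

Lemma mcomp_centered k (f : fpsmap R m k) (g : fpsmap R n m) :
  centered f -> centered g -> centered (mcomp f g).
Proof. by move=> fc gc i; rewrite /mcomp [LHS]fcomp_coef0. Qed.

Lemma jac_mcomp k (f : fpsmap R m k) (g : fpsmap R n m) :
  centered g -> jac (mcomp f g) = jac f *m jac g.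
Proof.
move=> gc; apply/matrixP => i j; rewrite !mxE [LHS]fcomp_unit //.
by apply: eq_bigr => l _; rewrite !mxE.
Qed.

End Comp.

Lemma fcompA (R : realType) n m k (a : fps R k) (g : fpsmap R m k) (h : fpsmap R n m) :
  centered g -> centered h -> fcomp (fcomp a g) h = fcomp a (mcomp g h).
Proof.
move=> gc hc; apply: fps_ext => Q; set d := mdeg Q.
rewrite (fcompE _ hc (leqnn _)) (fcompE _ (mcomp_centered gc hc) (leqnn _)) -/d.
transitivity (\sum_(S <- mlist m d) \sum_(P <- mlist k d)
    a P * (fmonom g P S * fmonom h S Q)).
  rewrite big_seq [RHS]big_seq; apply: eq_bigr => S; rewrite mem_mlist => Sd.
  rewrite (fcompE _ gc Sd) big_distrl; apply: eq_bigr => P _ /=.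
  by rewrite mulrA.
rewrite exchange_big; apply: eq_bigr => P _; rewrite -big_distrr /=; congr (_ * _).
rewrite -(fcompE _ hc (leqnn _)) !fmonomE fcomp_prod //.
by congr (_ Q); apply: eq_bigr => i _; rewrite fcompX.
Qed.

Lemma midm_centered (R : realType) n : centered (@midm R n).
Proof. by apply/centeredP => i; apply: ford_var. Qed.

Lemma fmonom_midm (R : realType) n (P Q : mindex n) :
  fmonom (@midm R n) P Q = (Q == P)%:R.
Proof.
elim: {P}(mdeg P) {-2}P (erefl (mdeg P)) Q => [|d IH] P Pd Q.
  move/eqP: Pd; rewrite mdeg_eq0 => /eqP ->; rewrite fmonom0 fcoef1.
  by case: eqP.
have [|i Pi] := @mindex_neq0 _ P; first by rewrite -mdeg_gt0 Pd.
have [P' eP] := munitP Pi; rewrite Pd => -[dP'].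
rewrite eP addrC fmonomD fmonom_unit /midm; have [Qi|Qi] := posnP (Q i).
  rewrite fcoefVM0 //; case: eqP => // eQ.
  by move: Qi; rewrite eQ mindexDE ffunE eqxx.
have [Q' eQ _] := munitP Qi; rewrite eQ fcoefVM IH // [Q' + _]addrC.
by rewrite (inj_eq (@mindex_addI _ _)).
Qed.

Lemma fcomp_midm (R : realType) n (a : fps R n) : fcomp a midm = a.
Proof.
apply: fps_ext => Q; rewrite (fcompE _ (@midm_centered R n) (leqnn _)).
rewrite -[RHS](big_mlist_pred1 a (leqnn (mdeg Q))); apply: eq_bigr => P _.
by rewrite fmonom_midm eq_sym; case: eqP; rewrite ?mulr1 ?mulr0.
Qed.

Lemma mcompA (R : realType) n m k l (f : fpsmap R k l) (g : fpsmap R m k) (h : fpsmap R n m) :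
  centered g -> centered h -> mcomp (mcomp f g) h = mcomp f (mcomp g h).
Proof. by move=> gc hc; apply: funext => i; apply: fcompA. Qed.

Lemma mcomp_idr (R : realType) n m (f : fpsmap R n m) : mcomp f midm = f.
Proof. by apply: funext => i; apply: fcomp_midm. Qed.

Lemma mcomp_idl (R : realType) n m (f : fpsmap R n m) : centered f -> mcomp midm f = f.
Proof. by move=> fc; apply: funext => i; apply: fcomp_var. Qed.

Lemma jac_midm (R : realType) n : jac (@midm R n) = 1%:M.
Proof.
by apply/matrixP => i j; rewrite !mxE /midm /fvar (inj_eq (@munit_inj n)) eq_sym; case: eqP.
Qed.

(** * Formal fixed points, inverses and linearization *)

Section Congruence.
Variables (R : realType) (n m : nat).
Implicit Types (a : fps R m) (g h : fpsmap R n m) (d k : nat).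

Lemma ford_mulB d (x x' y y' : fps R n) :
  ford d (x - x') -> ford d (y - y') -> ford d (x * y - x' * y').
Proof.
move=> hx hy; have -> : x * y - x' * y' = x * (y - y') + (x - x') * y' by ring.
by apply: fordD; [apply: fordMr|apply: fordMl].
Qed.

Lemma fcomp_cong d g h a : centered g -> centered h ->
  (forall i, ford d (g i - h i)) -> ford d (fcomp a g - fcomp a h).
Proof.
move=> gc hc gh Q Qd; rewrite fcoefB (fcompE _ gc (leqnn _)) (fcompE _ hc (leqnn _)).
rewrite -sumrB big1 // => P _; rewrite -mulrBr -fcoefB.
suff -> : (fmonom g P - fmonom h P) Q = 0 by rewrite mulr0.
suff : ford d (fmonom g P - fmonom h P) by apply.
rewrite !fmonomE; elim/big_ind2: _ => [|? ? ? ? ? ?|i _]; first by rewrite subrr.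
  exact: ford_mulB.
by elim: (P i) => [|e IH]; [rewrite subrr|rewrite !exprS; apply: ford_mulB].
Qed.

(** The derivatives of a series of order k + 1 have order k; [fdiv] replaces derivatives in the
    induction. With k = 1 this makes the fixed point maps contracting; with k = 2 it controls the
    terms of order 3 of [E]. *)
Lemma fcomp_gain d k g h a : centered g -> centered h ->
  (forall i, ford d (g i - h i)) -> ford k.+1 a ->
  ford (d + k) (fcomp a g - fcomp a h).
Proof.
move=> gc hc gh; elim: k a => [|k IH] a ha; first by rewrite addn0; apply: fcomp_cong.
rewrite (fcomp_fdiv gc) (fcomp_fdiv hc) opprD addrACA subrr add0r -sumrB; apply: ford_sum => i _.
set u := fcomp _ g; set v := fcomp _ h.
have -> : g i * u - h i * v = (g i - h i) * u + h i * (u - v) by ring.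
have ai := ford_fdiv i ha; apply: fordD.
  by apply: fordM => //; apply/ford_fcomp.
rewrite addnS -addn1 addnC; apply: fordM; last exact: IH.
by have /centeredP := hc; apply.
Qed.

Lemma contraction_fixpoint (Phi : fpsmap R n m -> fpsmap R n m) :
  (forall g, centered g -> centered (Phi g)) ->
  (forall d g h, centered g -> centered h -> (forall i, ford d (g i - h i)) ->
     forall i, ford d.+1 (Phi g i - Phi h i)) ->
  exists2 g, centered g & Phi g = g.
Proof.
move=> Phic Phi1; pose u k := iter k Phi (fun=> 0).
have uc k : centered (u k).
  by elim: k => [|k IH]; [by move=> i|apply: (Phic (u k))].
have uS k i : ford k (u k.+1 i - u k i).
  by elim: k i => [|k IH] i; [|apply: (Phi1 k (u k.+1) (u k))].
have uD k l i : ford k (u (k + l)%N i - u k i).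
  elim: l => [|l IH]; first by rewrite addn0 subrr.
  rewrite -(subrK (u (k + l)%N i) (u _ i)) -addrA; apply: fordD => //.
  by rewrite addnS; apply: fordW (uS _ _); rewrite leq_addr.
(* By [uD], coefficients of degree less than k are stationary from the k-th iterate on, and k = |Q|
   + 1 is the first value that covers Q. *)
pose g : fpsmap R n m := fun i Q => u (mdeg Q).+1 i Q.
have gu k i : ford k (g i - u k i).
  move=> Q Qk; rewrite fcoefB /g -(subnKC Qk); apply/eqP.
  by rewrite -opprB oppr_eq0; apply/eqP/uD.
have gc : centered g by move=> i; rewrite /g (uc _ i).
exists g => //; apply: funext => i; apply: ford_ext => -[//|k].
rewrite -(subrK (u k.+1 i) (Phi g i)) -addrA; apply: fordD.
  exact: Phi1.
by rewrite -opprB; apply: fordN.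
Qed.

End Congruence.

Section Linear.
Variable R : realType.
Implicit Types n m k l : nat.

Definition lin n m k (M : 'M[R[i]]_(m, k)) (g : fpsmap R n k) : fpsmap R n m :=
  fun i => \sum_j fconst (M i j) * g j.

Definition cvec n m (g : fpsmap R n m) (Q : mindex n) : 'cV[R[i]]_m := \col_i g i Q.

Lemma cvec_lin n m k (M : 'M[R[i]]_(m, k)) (g : fpsmap R n k) Q :
  cvec (lin M g) Q = M *m cvec g Q.
Proof.
apply/matrixP => i j; rewrite !mxE /lin fcoef_sum.
by apply: eq_bigr => l _; rewrite fcoefCM !mxE.
Qed.

Lemma cvecP n m (g h : fpsmap R n m) : (forall Q, cvec g Q = cvec h Q) -> g = h.
Proof.
move=> gh; apply: funext => i; apply: fps_ext => Q.
by have /matrixP/(_ i ord0) := gh Q; rewrite !mxE.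
Qed.

Lemma cvec_unit n m (g : fpsmap R n m) j : cvec g (munit j) = col j (jac g).
Proof. by apply/matrixP => i k; rewrite !mxE. Qed.

Lemma lin_centered n m k (M : 'M[R[i]]_(m, k)) (g : fpsmap R n k) :
  centered g -> centered (lin M g).
Proof.
move=> /centeredP gc; apply/centeredP => i; apply: ford_sum => j _.
exact: fordMr.
Qed.

Lemma lin_mul n m k l (M : 'M[R[i]]_(m, k)) (N : 'M[R[i]]_(k, l)) (g : fpsmap R n l) :
  lin M (lin N g) = lin (M *m N) g.
Proof. by apply: cvecP => Q; rewrite !cvec_lin mulmxA. Qed.

Lemma lin1 n m (g : fpsmap R n m) : lin 1%:M g = g.
Proof. by apply: cvecP => Q; rewrite !cvec_lin mul1mx. Qed.

Lemma mcomp_lin n m k l (M : 'M[R[i]]_(m, k)) (g : fpsmap R n k) (h : fpsmap R l n) :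
  centered h -> mcomp (lin M g) h = lin M (mcomp g h).
Proof.
move=> hc; apply: funext => i; rewrite /mcomp /lin fcomp_sum //.
by apply: eq_bigr => j _; rewrite fcompM // fcomp_const.
Qed.

Lemma jac_lin n m k (M : 'M[R[i]]_(m, k)) (g : fpsmap R n k) :
  jac (lin M g) = M *m jac g.
Proof.
apply/matrixP => i j; rewrite !mxE /lin fcoef_sum.
by apply: eq_bigr => l _; rewrite fcoefCM !mxE.
Qed.

Definition nonlin n m (g : fpsmap R n m) : fpsmap R n m :=
  fun i => g i - lin (jac g) midm i.

Lemma ford_nonlin n m (g : fpsmap R n m) i : centered g -> ford 2 (nonlin g i).
Proof.
move=> gc Q; rewrite ltnS leq_eqVlt => /orP[/eqP/mdeg1P[j ->]|].
  have := cvec_unit (lin (jac g) midm) j; rewrite jac_lin jac_midm mulmx1.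
  by move=> /matrixP/(_ i ord0); rewrite !mxE /nonlin fcoefB => ->; rewrite subrr.
rewrite ltnS leqn0 mdeg_eq0 => /eqP ->; rewrite /nonlin fcoefB [g i 0]gc.
by have := lin_centered (jac g) (@midm_centered R n) i => ->; rewrite subrr.
Qed.

Lemma mcomp_nonlin n m k (g : fpsmap R n m) (h : fpsmap R k n) : centered h ->
  forall i, mcomp g h i = lin (jac g) h i + mcomp (nonlin g) h i.
Proof.
move=> hc i; rewrite [in RHS]/mcomp /nonlin fcompB //.
have -> : fcomp (lin (jac g) midm i) h = mcomp (lin (jac g) midm) h i by [].
by rewrite mcomp_lin // mcomp_idl // addrC subrK.
Qed.

Lemma cvec_mcomp_nonlin n m k (g : fpsmap R n m) (h : fpsmap R k n) Q : centered h ->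
  cvec (mcomp g h) Q = jac g *m cvec h Q + cvec (mcomp (nonlin g) h) Q.
Proof.
move=> hc; rewrite -cvec_lin; apply/matrixP => i j.
by rewrite !mxE mcomp_nonlin.
Qed.

(** The inverse is the fixed point of G = J^-1 (id - N(G)), with J and N the linear and nonlinear
    parts of [A]. *)
Lemma formal_right_inverse n (A : fpsmap R n n) : centered A -> jac A \in unitmx ->
  exists G : fpsmap R n n, [/\ centered G, mcomp A G = midm & jac G = invmx (jac A)].
Proof.
move=> Ac Au; pose J' := invmx (jac A).
pose Phi (G : fpsmap R n n) := lin J' (fun j => fvar j - mcomp (nonlin A) G j).
have [|d g h gc hc gh i|G Gc GE] := @contraction_fixpoint R n n Phi.
- move=> g gc; apply: lin_centered; apply/centeredP => i.
  apply: fordB; first exact: ford_var.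
  by apply: ford_fcomp => //; apply: fordW (ford_nonlin i Ac).
- rewrite /Phi /lin -sumrB; apply: ford_sum => j _; rewrite -mulrBr; apply: fordMr.
  rewrite opprB [_ + (_ - _)]addrC addrA subrK -opprB; apply: fordN.
  by rewrite -addn1; apply: fcomp_gain => //; apply: ford_nonlin.
have AG : mcomp A G = midm.
  apply: funext => i; rewrite mcomp_nonlin // -{1}GE /Phi lin_mul mulmxV // lin1.
  by rewrite subrK.
exists G; split=> //.
by rewrite -[RHS]mulmx1 -(@jac_midm R n) -AG jac_mcomp // mulKmx.
Qed.

Lemma formal_inverse n (A : fpsmap R n n) : centered A -> jac A \in unitmx ->
  exists G : fpsmap R n n, [/\ centered G, mcomp A G = midm, mcomp G A = midm &
    jac G = invmx (jac A)].
Proof.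
move=> Ac Au; have [G [Gc AG JG]] := formal_right_inverse Ac Au.
have Gu : jac G \in unitmx by rewrite JG unitmx_inv.
have [H [Hc GH _]] := formal_right_inverse Gc Gu.
exists G; split=> //.
(* A right inverse of the right inverse is [A] itself: A = A(G(H)) = (A(G))(H) = H. *)
suff -> : A = H by [].
by rewrite -[LHS]mcomp_idr -GH -mcompA // AG mcomp_idl.
Qed.

Definition diag_map n (lam : 'I_n -> R[i]) : fpsmap R n n :=
  fun i => fconst (lam i) * fvar i.

Lemma diag_map_centered n (lam : 'I_n -> R[i]) : centered (diag_map lam).
Proof. by apply/centeredP => i; apply/fordMr/ford_var. Qed.

Definition mpow n (lam : 'I_n -> R[i]) (Q : mindex n) : R[i] :=
  \prod_i lam i ^+ Q i.

Lemma fconstM n (x y : R[i]) : fconst (x * y) = fconst x * fconst y :> fps R n.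
Proof.
apply: fps_ext => Q; rewrite fcoefCM /fconst; case: eqP => //; by rewrite mulr0.
Qed.

Lemma fmonom_diag n (lam : 'I_n -> R[i]) P :
  fmonom (diag_map lam) P = fconst (mpow lam P) * fmonom midm P.
Proof.
rewrite !fmonomE /mpow.
have -> : fconst (\prod_i lam i ^+ P i) = \prod_i (fconst (lam i ^+ P i) : fps R n).
  by elim/big_ind2: _ => // ? ? ? ? <- <-; rewrite fconstM.
rewrite -big_split; apply: eq_bigr => i _; rewrite exprMn; congr (_ * _).
elim: (P i) => [//|k IH]; by rewrite !exprS fconstM IH.
Qed.

Lemma fcomp_diag n (lam : 'I_n -> R[i]) (a : fps R n) Q :
  fcomp a (diag_map lam) Q = mpow lam Q * a Q.
Proof.
rewrite (fcompE _ (diag_map_centered lam) (leqnn _)).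
rewrite -(big_mlist_pred1 (fun P => mpow lam P * a P) (leqnn (mdeg Q))).
apply: eq_bigr => P _; rewrite fmonom_diag fcoefCM fmonom_midm eq_sym.
by case: eqP; rewrite ?mulr1 ?mulr0 // mulrC.
Qed.

Lemma cvec_diag n m (lam : 'I_n -> R[i]) (g : fpsmap R n m) Q :
  cvec (mcomp g (diag_map lam)) Q = mpow lam Q *: cvec g Q.
Proof. by apply/matrixP => i j; rewrite !mxE [LHS]fcomp_diag. Qed.

(** Comparing coefficients gives lam^Q th_Q = J th_Q + N(th)_Q, where the last term involves th only
    in degrees below |Q|; in degree 1 the columns of [P] are prescribed. *)
Lemma formal_linearization n (s : fpsmap R n n) (lam : 'I_n -> R[i]) (P : 'M[R[i]]_n) :
  centered s -> P \in unitmx ->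
  jac s *m P = P *m diag_mx (\row_j lam j) ->
  (forall Q j, (2 <= mdeg Q)%N -> mpow lam Q != lam j) ->
  exists2 th : fpsmap R n n, centered th /\ jac th = P &
    mcomp s th = mcomp th (diag_map lam).
Proof.
move=> sc Pu sP nonres.
(* The inverse of lam^Q - jac s for |Q| >= 2, computed in the eigenbasis [P]. At Q = 0 it only ever
   multiplies a zero vector. *)
pose inv Q := P *m diag_mx (\row_j (mpow lam Q - lam j)^-1) *m invmx P.
pose Phi (g : fpsmap R n n) : fpsmap R n n := fun i Q =>
  if mdeg Q == 1%N then lin P midm i Q else
  (inv Q *m cvec (mcomp (nonlin s) g) Q) i ord0.
have Nc g : centered g -> centered (mcomp (nonlin s) g).
  move=> gc; apply/centeredP => i; apply: ford_fcomp => //.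
  exact: fordW (ford_nonlin i sc).
have [g gc i|d g h gc hc gh i Q Qd|th thc thE] := @contraction_fixpoint R n n Phi.
- rewrite /Phi ifN ?[mdeg _]mdeg0 // (_ : cvec _ _ = 0) ?mulmx0 ?mxE //.
  by apply/matrixP => k l; rewrite !mxE Nc.
- rewrite fcoefB /Phi; case: eqP => _; first by rewrite subrr.
  have -> : cvec (mcomp (nonlin s) g) Q = cvec (mcomp (nonlin s) h) Q.
    apply/matrixP => k l; rewrite !mxE; apply/eqP; rewrite -subr_eq0; apply/eqP.
    by have /(_ Q) := fcomp_gain gc hc gh (ford_nonlin k sc); rewrite addn1; apply.
  by rewrite subrr.
have thU j : cvec th (munit j) = col j P.
  apply/matrixP => i k; rewrite !mxE -thE /Phi mdeg_unit eqxx.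
  have := cvec_unit (lin P (@midm R n)) j; rewrite jac_lin jac_midm mulmx1.
  by move=> /matrixP/(_ i k); rewrite !mxE.
exists th; first split => //.
  by apply/matrixP => i j; have /matrixP/(_ i ord0) := thU j; rewrite !mxE.
apply: cvecP => Q; rewrite cvec_mcomp_nonlin // cvec_diag.
have [Q2|] := ltnP 1 (mdeg Q); last first.
  rewrite leq_eqVlt => /orP[/eqP/mdeg1P[j ->]|].
    have -> : cvec (mcomp (nonlin s) th) (munit j) = 0.
      apply/matrixP => k l; rewrite !mxE.
      by apply: (ford_fcomp thc (ford_nonlin k sc)); rewrite mdeg_unit.
    rewrite addr0 thU colE mulmxA sP -!colE; apply/matrixP => i k; rewrite !mxE.
    rewrite (bigD1 j) //= !mxE eqxx mulr1n big1 ?addr0 => [|l /negbTE lj]; last first.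
      by rewrite !mxE lj mulr0n mulr0.
    rewrite mulrC /mpow (bigD1 j) //= ffunE eqxx expr1 big1 ?mulr1 // => l /negbTE lj.
    by rewrite ffunE lj.
  rewrite ltnS leqn0 mdeg_eq0 => /eqP ->.
  have z (g : fpsmap R n n) : centered g -> cvec g 0 = 0.
    by move=> gc; apply/matrixP => k l; rewrite !mxE gc.
  by rewrite !z ?mulmx0 ?addr0 ?scaler0 //; apply: Nc.
have thQ : cvec th Q = inv Q *m cvec (mcomp (nonlin s) th) Q.
  apply/matrixP => i k; rewrite [LHS]mxE -[in LHS]thE /Phi ifN; last by case: (mdeg Q) Q2 => [|[]].
  by rewrite [k]ord1.
set v := cvec (mcomp _ _) _ in thQ *.
have key : (mpow lam Q)%:M *m inv Q = jac s *m inv Q + 1%:M.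
  rewrite /inv !mulmxA sP -scalar_mxC -[in RHS](mulmxV Pu) -mulmxDl; congr (_ *m _).
  rewrite -!mulmxA -[X in _ + X]mulmx1 -mulmxDr; congr (_ *m _).
  apply/matrixP => i j; rewrite mul_scalar_mx mul_diag_mx !mxE.
  case: eqP => [->|_]; rewrite ?mulr0n ?mulr1n ?mulr0 ?addr0 //.
  have ne : mpow lam Q - lam j != 0 by rewrite subr_eq0 nonres.
  by rewrite -[X in _ = _ + X](divff ne) -mulrDl [lam j + _]addrC subrK.
move: thQ key; rewrite -mul_scalar_mx; move: (inv Q) => W -> key.
by rewrite !mulmxA key mulmxDl mul1mx.
Qed.

End Linear.

(** * The quadratic part *)

Section Cancellation.
Variables (R : realType) (n : nat).
Implicit Types (a l : fps R n).

(* Downward induction on the exponent of x_i: a monomial Q of degree m with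
   a Q != 0 and Q i maximal would yield the monomial Q + munit i of l * a. *)
Lemma ford_cancel m i l a : ford 1 l -> l (munit i) != 0 ->
  ford m a -> ford m.+2 (l * a) -> ford m.+1 a.
Proof.
move=> l1 li am la.
have step Q : mdeg Q = m -> (forall S, mdeg S = m -> (Q i < S i)%N -> a S = 0) -> a Q = 0.
  move=> Qm hQ; have := la (Q + munit i).
  rewrite mdegD mdeg_unit Qm addn1 => /(_ (leqnn _)); rewrite (fcoefM _ _ (leqnn _)).
  rewrite (bigD1_seq (munit i)) ?mlist_uniq ?mem_mlist ?mdegD ?leq_addl //=.
  rewrite [X in _ + X]big1 ?addr0 => [|P Pi]; last first.
    rewrite big1 // => S _; case: eqP => // PS.
    have mS : (mdeg P + mdeg S = m.+1)%N by rewrite -mdegD PS mdegD mdeg_unit Qm addn1.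
    have [Sm|mSm] := ltnP (mdeg S) m; first by rewrite am ?mulr0.
    have [P0|P0] := posnP (mdeg P); first by rewrite l1 ?mul0r // P0.
    have P1 : mdeg P = 1%N by lia.
    have Sm : mdeg S = m by lia.
    rewrite hQ ?mulr0 //; have [j Pj] := mdeg1P P1.
    have ij : (munit j : mindex n) i = 0%N.
      by rewrite ffunE; case: eqP => // ij; rewrite Pj ij eqxx in Pi.
    by move/ffunP/(_ i): PS; rewrite !mindexDE Pj ij ffunE eqxx; lia.
  under eq_bigr => S _ do
    rewrite [Q + _]addrC (inj_eq (@mindex_addI _ (munit i))).
  rewrite (big_mlist_pred1 (fun S => l (munit i) * a S)) ?leq_addr //.
  by move/eqP; rewrite mulf_eq0 (negbTE li) => /eqP.
move=> Q; rewrite ltnS leq_eqVlt => /orP[/eqP Qm|]; last exact: am.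
have [k] : exists k, (m <= Q i + k)%N by exists m; rewrite leq_addl.
elim: k Q Qm => [|k IH] Q Qm Qk; apply: step => // S Sm QS.
  by have := leq_mdeg S i; lia.
by apply: IH => //; lia.
Qed.

End Cancellation.

Section Quadric.
Variables (R : realType) (p : nat) (c : 'I_p -> R[i]) (pr : 'I_p -> 'I_p).
Hypothesis c0 : forall j, c j != 0.
Hypothesis pr_inj : injective pr.

Definition quad (j : 'I_p) : fps R (p + p) :=
  (fvar (lshift p j) + fconst (2 * c j) * fvar (rshift p (pr j))) ^+ 2.

Variable E : fpsmap R (p + p) p.
Hypothesis EQ : forall j Q, (mdeg Q <= 2)%N -> E j Q = quad j Q.

Lemma mpair_lshift T (a b : 'I_p -> T) j : mpair a b (lshift p j) = a j.
Proof. by rewrite /mpair (unsplitK (inl j)). Qed.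

Lemma mpair_rshift T (a b : 'I_p -> T) j : mpair a b (rshift p j) = b j.
Proof. by rewrite /mpair (unsplitK (inr j)). Qed.

Lemma mpair_centered n (u f : fpsmap R n p) :
  centered u -> centered f -> centered (mpair u f).
Proof. by move=> uc fc i; rewrite /mpair; case: fintype.split. Qed.

Section Comp.
Variable n : nat.
Implicit Types u f g : fpsmap R n p.

Definition qform u f (j : 'I_p) : fps R n := u j + fconst (2 * c j) * f (pr j).

Lemma qform_centered u f j : centered u -> centered f -> ford 1 (qform u f j).
Proof.
by move=> /centeredP uc /centeredP fc; apply: fordD => //; apply: fordMr.
Qed.

(** The values of E_j being equal, the difference of the two squares is, up to sign, the difference
    of the remainders. The remainder of E_j has order 3, so [fcomp_gain] yields two orders more than
    f - g. *)
Lemma fcomp_E_quad u f g j d : centered u -> centered f -> centered g ->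
  (forall j, ford d (f j - g j)) ->
  fcomp (E j) (mpair u f) = fcomp (E j) (mpair u g) ->
  ford d.+2 ((qform u f j + qform u g j) * (qform u f j - qform u g j)).
Proof.
move=> uc fc gc fg Efg; set A := mpair u f in Efg; set B := mpair u g in Efg.
have Ac : centered A by apply: mpair_centered.
have Bc : centered B by apply: mpair_centered.
have AB i : ford d (A i - B i).
  by rewrite /A /B /mpair; case: fintype.split => // k; rewrite subrr.
pose r := E j - quad j.
have r3 : ford 3 r by move=> Q Q3; rewrite /r fcoefB EQ // subrr.
have quadE h : centered (mpair u h) -> fcomp (quad j) (mpair u h) = qform u h j ^+ 2.
  move=> hc; rewrite /quad fcompX // fcompD // fcompM // fcomp_const // !fcomp_var //.
  by rewrite mpair_lshift mpair_rshift.
have := fcomp_gain Ac Bc AB r3; rewrite !fcompB // Efg !quadE // addn2.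
set x := fcomp _ _; set y := qform _ _ _; set z := qform _ _ _.
have -> : x - y ^+ 2 - (x - z ^+ 2) = - ((y + z) * (y - z)) by ring.
by move/fordN; rewrite opprK.
Qed.

Lemma qform_cancel d u f g : (forall j, ford d (qform u f j - qform u g j)) ->
  forall j, ford d (f j - g j).
Proof.
move=> h j; have [k <-] : exists k, pr k = j.
  by have /codomP[k ->] : j \in codom pr by [rewrite (inj_card_onto pr_inj)]; exists k.
have c2 : 2 * c k != 0 by rewrite mulf_neq0 // pnatr_eq0.
have -> : f (pr k) - g (pr k) = fconst ((2 * c k)^-1) * (qform u f k - qform u g k).
  rewrite /qform opprD addrACA subrr add0r -mulrBr mulrA -fconstM mulVf //.
  by rewrite fps1E mul1r.
exact: fordMr.
Qed.

(** The quadratic part of (q(f) + q(g))(q(f) - q(g)) vanishes. If the sum has a nonzero linear part,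
    [ford_cancel] removes that factor. *)
Lemma quad_sign u f g j : centered u -> centered f -> centered g ->
  fcomp (E j) (mpair u f) = fcomp (E j) (mpair u g) ->
  (forall i, qform u f j (munit i) = qform u g j (munit i)) \/
  (forall i, qform u f j (munit i) = - qform u g j (munit i)).
Proof.
move=> uc fc gc Efg.
have [h|/existsNP[i hi]] := pselect (forall i, qform u f j (munit i) = - qform u g j (munit i)).
  by right.
left=> k; have fg1 l : ford 1 (f l - g l).
  by move/centeredP: fc => fc; move/centeredP: gc => gc; apply: fordB.
have yc := qform_centered j uc fc; have zc := qform_centered j uc gc.
have yz0 : (qform u f j + qform u g j) (munit i) != 0.
  by rewrite fcoefD -[qform u g j _]opprK subr_eq0; apply/eqP.
have := ford_cancel (fordD yc zc) yz0 (fordB yc zc) (fcomp_E_quad uc fc gc fg1 Efg).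
move=> /(_ (munit k)); rewrite mdeg_unit => /(_ isT).
by move/eqP; rewrite fcoefB subr_eq0 => /eqP.
Qed.

(** As the linear parts agree, q(f) + q(g) starts with twice the nonzero linear part of q(f) and can
    be cancelled: each agreement of f and g up to some order improves by one. *)
Lemma quad_unique u f g : centered u -> centered f -> centered g ->
  (forall j, fcomp (E j) (mpair u f) = fcomp (E j) (mpair u g)) ->
  (forall j i, qform u f j (munit i) = qform u g j (munit i)) ->
  (forall j, exists i, qform u f j (munit i) != 0) -> f = g.
Proof.
move=> uc fc gc Efg fg1 f0.
have qc h j : centered h -> ford 1 (qform u h j) by move=> hc; apply: qform_centered.
have key d j : ford d.+1 (f j - g j).
  elim: d j => [|d IH] j.
    by move/centeredP: fc => fc; move/centeredP: gc => gc; apply: fordB.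
  move: j; apply: qform_cancel => j; have [i fi] := f0 j.
  apply: (@ford_cancel _ _ _ i (qform u f j + qform u g j)).
  - by apply: fordD; apply: qc.
  - by rewrite fcoefD -fg1 -mulr2n mulrn_eq0.
  - by rewrite /qform opprD addrACA subrr add0r -mulrBr; apply: fordMr.
  - exact: fcomp_E_quad.
by apply: funext => j; apply: ford_ext => -[|d].
Qed.

End Comp.
End Quadric.

(** * Convergence and majorants *)

Section Modulus.
Variable R : realType.
Local Notation nc := (@Normc.normc R).
Implicit Types x y : R[i].

Lemma nc_ge0 x : 0 <= nc x.
Proof. by case: x => a b /=; rewrite sqrtr_ge0. Qed.

Lemma nc0 : nc 0 = 0. Proof. exact: Normc.normc0. Qed.
Lemma nc1 : nc 1 = 1. Proof. exact: Normc.normc1. Qed.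
Lemma ncM x y : nc (x * y) = nc x * nc y. Proof. exact: Normc.normcM. Qed.
Lemma ncD x y : nc (x + y) <= nc x + nc y. Proof. exact: le_normcD. Qed.
Lemma ncN x : nc (- x) = nc x. Proof. exact: normcN. Qed.

Lemma nc_eq0 x : (nc x == 0) = (x == 0).
Proof. by apply/eqP/eqP => [/Normc.eq0_normc|->]; rewrite ?nc0. Qed.

Lemma nc_gt0 x : (0 < nc x) = (x != 0).
Proof. by rewrite lt0r nc_ge0 andbT nc_eq0. Qed.

Lemma nc_conj x : nc x^* = nc x.
Proof. by rewrite (_ : x^* = x^*%C) //; case: x => a b /=; rewrite sqrrN. Qed.

Lemma nc_sum (I : Type) (r : seq I) (C : pred I) (F : I -> R[i]) :
  nc (\sum_(i <- r | C i) F i) <= \sum_(i <- r | C i) nc (F i).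
Proof.
elim/big_ind2: _ => [|x1 x2 y1 y2 h1 h2|//]; first by rewrite nc0.
exact: le_trans (ncD _ _) (lerD h1 h2).
Qed.

End Modulus.

Section Norms.
Variable R : realType.
Local Notation nc := (@Normc.normc R).

(** A weighted l1 norm truncated at degree [d]. It is a finite sum, so estimates make sense before
    convergence is known; convergence is a bound uniform in [d]. *)
Definition nrm n (v : mindex n -> R) (d : nat) (a : fps R n) : R :=
  \sum_(P <- mlist n d) nc (a P) * v P.

Definition rpow n (r : R) (P : mindex n) : R := r ^+ mdeg P.

Section Weight.
Variables (n : nat) (v : mindex n -> R).
Hypothesis v_ge0 : forall P, 0 <= v P.
Implicit Types (a b : fps R n) (d : nat).

Lemma nrm_ge0 d a : 0 <= nrm v d a.
Proof. by apply: sumr_ge0 => P _; rewrite mulr_ge0 ?nc_ge0. Qed.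

Lemma nrm_nondecreasing d d' a : (d <= d')%N -> nrm v d a <= nrm v d' a.
Proof.
move=> dd'; rewrite /nrm -(big_mlist_cond _ dd'); apply: ler_sum => P _.
by case: ifP => // _; rewrite mulr_ge0 ?nc_ge0.
Qed.

Lemma nrmD d a b : nrm v d (a + b) <= nrm v d a + nrm v d b.
Proof.
rewrite /nrm -big_split; apply: ler_sum => P _ /=.
by rewrite -mulrDl ler_wpM2r // ncD.
Qed.

Lemma nrm0 d : nrm v d 0 = 0.
Proof. by apply: big1 => P _; rewrite nc0 mul0r. Qed.

Lemma nrm_const d (x : R[i]) : nrm v d (fconst x) = nc x * v 0.
Proof.
rewrite -(@big_mlist_pred1 _ _ d 0 (fun P => nc x * v P)) ?mdeg0 //.
apply: eq_bigr => P _; rewrite /fconst; case: eqP => // _.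
by rewrite nc0 mul0r.
Qed.

Lemma nrm_scale d (x : R[i]) a : nrm v d (fconst x * a) = nc x * nrm v d a.
Proof.
by rewrite /nrm big_distrr; apply: eq_bigr => P _; rewrite fcoefCM ncM /= mulrA.
Qed.

Hypothesis vD : forall P Q, v (P + Q) <= v P * v Q.
Hypothesis v0 : v 0 <= 1.

Lemma nrmM d a b : nrm v d (a * b) <= nrm v d a * nrm v d b.
Proof.
pose F P S := (nc (a P) * v P) * (nc (b S) * v S).
have F0 P S : 0 <= F P S by rewrite /F; do !apply: mulr_ge0 => //; apply: nc_ge0.
apply: (@le_trans _ _ (\sum_(Q <- mlist n d) \sum_(P <- mlist n d) \sum_(S <- mlist n d)
   if P + S == Q then F P S else 0)).
  rewrite /nrm big_seq [leRHS]big_seq; apply: ler_sum => Q; rewrite mem_mlist => Qd.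
  rewrite (fcoefM _ _ Qd); apply: (le_trans (ler_wpM2r (v_ge0 Q) (nc_sum _ _ _))).
  rewrite big_distrl; apply: ler_sum => P _ /=.
  apply: (le_trans (ler_wpM2r (v_ge0 Q) (nc_sum _ _ _))).
  rewrite big_distrl; apply: ler_sum => S _ /=.
  case: eqP => [<-|_]; last by rewrite nc0 mul0r.
  by rewrite ncM /F mulrACA ler_wpM2l ?mulr_ge0 ?nc_ge0.
rewrite /nrm big_distrl exchange_big; apply: ler_sum => P _ /=.
rewrite big_distrr exchange_big; apply: ler_sum => S _ /=.
have [PS|PS] := leqP (mdeg (P + S)) d.
  under eq_bigr => Q _ do rewrite eq_sym.
  by rewrite (big_mlist_pred1 (fun=> F P S) PS).
rewrite big_seq big1 => [|Q]; first exact: F0.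
by rewrite mem_mlist; case: eqP => // <-; rewrite leqNgt PS.
Qed.

Lemma nrm1 d : nrm v d 1 <= 1.
Proof. by rewrite -fps1E nrm_const nc1 mul1r. Qed.

Lemma nrm_fmonom m (g : fpsmap R n m) (rho : R) d P :
  (forall i, nrm v d (g i) <= rho) -> nrm v d (fmonom g P) <= rho ^+ mdeg P.
Proof.
move=> gr; have X i k : nrm v d (g i ^+ k) <= rho ^+ k.
  elim: k => [|k IH]; first exact: nrm1.
  by rewrite !exprS (le_trans (nrmM _ _ _)) // ler_pM ?nrm_ge0.
rewrite fmonomE /mdeg; elim/big_ind2: _ => [|x1 x2 y1 y2 h1 h2|i _]; first exact: nrm1.
  by rewrite exprD (le_trans (nrmM _ _ _)) // ler_pM ?nrm_ge0.
exact: X.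
Qed.

Lemma nrm_fcomp m (f : fps R m) (g : fpsmap R n m) (rho : R) d : centered g ->
  (forall i, nrm v d (g i) <= rho) -> nrm v d (fcomp f g) <= nrm (rpow rho) d f.
Proof.
move=> gc gr.
apply: (@le_trans _ _ (\sum_(Q <- mlist n d) \sum_(P <- mlist m d)
    nc (f P) * (nc (fmonom g P Q) * v Q))).
  rewrite /nrm big_seq [leRHS]big_seq; apply: ler_sum => Q; rewrite mem_mlist => Qd.
  rewrite (fcompE _ gc Qd); apply: (le_trans (ler_wpM2r (v_ge0 Q) (nc_sum _ _ _))).
  rewrite big_distrl; apply: ler_sum => P _ /=.
  by rewrite ncM mulrA.
rewrite exchange_big; apply: ler_sum => P _; rewrite -big_distrr /=.
by rewrite ler_wpM2l ?nc_ge0 //; apply: nrm_fmonom.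
Qed.

End Weight.

Lemma rpow_ge0 n (r : R) (P : mindex n) : 0 <= r -> 0 <= rpow r P.
Proof. exact: exprn_ge0. Qed.

Lemma rpowD n (r : R) (P Q : mindex n) : rpow r (P + Q) = rpow r P * rpow r Q.
Proof. by rewrite /rpow mdegD exprD. Qed.

Lemma rpow0 n (r : R) : rpow r (0 : mindex n) = 1.
Proof. by rewrite /rpow mdeg0. Qed.

Lemma fconvergentP n (a : fps R n) : fconvergent a <->
  exists2 r, 0 < r & exists C, forall d, nrm (rpow r) d a <= C.
Proof.
split=> [[r r0 h]|[r r0 [C h]]]; exists r => //.
  set S := esum _ _ in h; exists (fine S) => d.
  have le : ((nrm (rpow r) d a)%:E <= S)%E.
    apply: esum_ge; exists [set` mlist n d]%classic; first by split=> [|x _]; [exact: finite_seq|].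
    by rewrite -fsbig_seq ?mlist_uniq // sumEFin.
  rewrite -lee_fin fineK // fin_numElt h andbT.
  by rewrite (lt_le_trans _ le) // ltNyr.
apply: (@le_lt_trans _ _ C%:E); last exact: ltry.
apply: ge_ereal_sup => _ [X [finX _] <-].
rewrite fsbig_finite //= sumEFin lee_fin.
set s := finmap.enum_fset (fset_set X).
have s_uniq : uniq s by apply: finmap.fset_uniq.
clearbody s; pose d := (\max_(P <- s) mdeg P)%N.
apply: le_trans (h d); rewrite /nrm.
rewrite [leRHS](bigID (mem s)) /=.
have -> : \sum_(P <- s) nc (a P) * r ^+ mdeg P =
    \sum_(P <- mlist n d | P \in s) nc (a P) * rpow r P.
  rewrite -[RHS]big_filter; apply: perm_big; apply: uniq_perm => //.
  - exact/filter_uniq/mlist_uniq.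
  - move=> P; rewrite mem_filter mem_mlist andb_idr // => PX.
    by rewrite /d (big_rem P) //= leq_maxl.
rewrite lerDl; apply: sumr_ge0 => P _; rewrite mulr_ge0 ?nc_ge0 // rpow_ge0 //.
exact: ltW.
Qed.
End Norms.

Lemma ler_sum_subset (R : numDomainType) (T : eqType) (s t : seq T) (F : T -> R) :
  uniq s -> uniq t -> {subset s <= t} -> (forall x, 0 <= F x) ->
  \sum_(x <- s) F x <= \sum_(x <- t) F x.
Proof.
move=> us ut st F0; rewrite [leRHS](bigID (mem s)) /=.
suff <- : \sum_(x <- s) F x = \sum_(x <- t | x \in s) F x.
  by rewrite lerDl sumr_ge0.
rewrite -[RHS]big_filter; apply: perm_big; apply: uniq_perm; rewrite ?filter_uniq // => x.
by rewrite mem_filter andb_idr //; apply: st.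
Qed.

Section Convergence.
Variable R : realType.
Local Notation nc := (@Normc.normc R).

Lemma nrm_radius_le n (r r' : R) d (a : fps R n) : 0 <= r' -> r' <= r ->
  nrm (rpow r') d a <= nrm (rpow r) d a.
Proof.
move=> r0 rr; apply: ler_sum => P _; rewrite ler_wpM2l ?nc_ge0 //.
by apply: lerXn2r; rewrite ?nnegrE // (le_trans r0).
Qed.

Lemma mconvergentP n m (g : fpsmap R n m) : mconvergent g <->
  exists2 r, 0 < r & exists2 C, 0 <= C & forall i d, nrm (rpow r) d (g i) <= C.
Proof.
split=> [gc|[r r0 [C _ h]] i]; last first.
  by apply/fconvergentP; exists r => //; exists C.
have /choice[rC hr] : forall i, exists rC : R * R,
    0 < rC.1 /\ forall d, nrm (rpow rC.1) d (g i) <= rC.2.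
  move=> i; have /fconvergentP[r r0 [C hC]] := gc i.
  by exists (r, C).
pose r := \big[Num.min/1]_i (rC i).1.
have r0 : 0 < r.
  rewrite /r; elim/big_ind: _ => // [x y x0 y0|i _]; first by rewrite lt_min x0.
  by case: (hr i).
have C0 i : 0 <= (rC i).2.
  case: (hr i) => ri /(_ 0%N); apply: le_trans; apply: nrm_ge0 => P.
  by apply: rpow_ge0; apply: ltW.
exists r => //; exists (\sum_i (rC i).2) => [|i d]; first exact: sumr_ge0.
have [_ /(_ d) h] := hr i.
apply: (@le_trans _ _ (rC i).2); last first.
  by rewrite (bigD1 i) //= lerDl sumr_ge0.
apply: le_trans h; apply: nrm_radius_le; first exact: ltW.
by rewrite /r; apply: bigmin_le_cond.
Qed.

(** A Schwarz lemma: without constant term every monomial gains at least one factor t. *)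
Lemma nrm_shrink n (r t : R) d (a : fps R n) : 0 <= r -> 0 <= t <= 1 -> a 0 = 0 ->
  nrm (rpow (t * r)) d a <= t * nrm (rpow r) d a.
Proof.
move=> r0 /andP[t0 t1] a0; rewrite /nrm big_distrr; apply: ler_sum => P _ /=.
have [->|P0] := eqVneq P 0; first by rewrite a0 nc0 !mul0r mulr0.
rewrite mulrCA ler_wpM2l ?nc_ge0 // /rpow exprMn ler_wpM2r ?exprn_ge0 //.
by rewrite -[leRHS]expr1 ler_wiXn2l // mdeg_gt0.
Qed.

Lemma mconvergent_small n m (g : fpsmap R n m) (rho : R) : mconvergent g -> centered g ->
  0 < rho -> exists2 r, 0 < r & forall i d, nrm (rpow r) d (g i) <= rho.
Proof.
move=> /mconvergentP[r r0 [C C0 h]] gc rho0.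
have C1 : 0 < C + rho by rewrite ltr_wpDl.
have t1 : 0 <= rho / (C + rho) <= 1.
  by rewrite divr_ge0 ?(ltW rho0) ?(ltW C1) //= ler_pdivrMr // mul1r lerDr.
exists (rho / (C + rho) * r); first by rewrite mulr_gt0 ?divr_gt0.
move=> i d; apply: (le_trans (nrm_shrink d (ltW r0) t1 (gc i))).
rewrite mulrAC ler_pdivrMr // ler_wpM2l ?(ltW rho0) //.
by apply: (le_trans (h i d)); rewrite lerDl ltW.
Qed.

Lemma fconvergent_fcomp n m (f : fps R m) (g : fpsmap R n m) :
  fconvergent f -> mconvergent g -> centered g -> fconvergent (fcomp f g).
Proof.
move=> /fconvergentP[rho rho0 [C h]] gv gc.
have [r r0 hr] := mconvergent_small gv gc rho0.
apply/fconvergentP; exists r => //; exists C => d; apply: le_trans (h d).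
apply: nrm_fcomp => //.
- by move=> P; apply/rpow_ge0/ltW.
- by move=> P Q; rewrite rpowD.
- by rewrite rpow0.
Qed.

Lemma mconvergent_mcomp n m k (f : fpsmap R m k) (g : fpsmap R n m) :
  mconvergent f -> mconvergent g -> centered g -> mconvergent (mcomp f g).
Proof. by move=> fv gv gc i; apply: fconvergent_fcomp. Qed.

Lemma fconvergent_var n i : fconvergent (fvar i : fps R n).
Proof.
apply/fconvergentP; exists 1 => //; exists (\sum_(P <- mlist n 1) nc ((fvar i : fps R n) P)) => d.
have F0 P : 0 <= nc ((fvar i : fps R n) P) * rpow 1 P.
  by rewrite mulr_ge0 ?nc_ge0 // rpow_ge0.
apply: (@le_trans _ _ (nrm (rpow 1) d.+1 (fvar i : fps R n))).
  by apply: nrm_nondecreasing => // P; apply: rpow_ge0.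
rewrite /nrm -(@big_mlist_cond _ _ 1 d.+1) //; apply: ler_sum => P _.
rewrite /rpow expr1n mulr1; case: leqP => // P1.
by rewrite /fvar; case: eqP P1 => [->|_ _]; rewrite ?mdeg_unit ?nc0.
Qed.

Lemma fconvergentD n (a b : fps R n) : fconvergent a -> fconvergent b -> fconvergent (a + b).
Proof.
move=> av bv; pose g : fpsmap R n 2 := fun i => if i == ord0 then a else b.
have /mconvergentP[r r0 [C C0 h]] : mconvergent g by move=> i; rewrite /g; case: ifP.
apply/fconvergentP; exists r => //; exists (C + C) => d.
apply: le_trans (nrmD _ _ _ _) _; first by move=> P; apply/rpow_ge0/ltW.
exact: lerD (h ord0 d) (h (lift ord0 ord0) d).
Qed.

Lemma fconvergentN n (a : fps R n) : fconvergent a -> fconvergent (- a).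
Proof.
move=> /fconvergentP[r r0 [C h]]; apply/fconvergentP; exists r => //; exists C => d.
by apply: le_trans (h d); apply: ler_sum => P _; rewrite fcoefN ncN.
Qed.

Lemma fconvergent_scale n x (a : fps R n) : fconvergent a -> fconvergent (fconst x * a).
Proof.
move=> /fconvergentP[r r0 [C h]]; apply/fconvergentP; exists r => //; exists (nc x * C) => d.
by rewrite nrm_scale ler_wpM2l ?nc_ge0.
Qed.

Lemma fconvergent_sum n (I : Type) (r : seq I) (C : pred I) (F : I -> fps R n) :
  (forall i, C i -> fconvergent (F i)) -> fconvergent (\sum_(i <- r | C i) F i).
Proof.
move=> h; elim/big_ind: _ => //; last exact: fconvergentD.
apply/fconvergentP; exists 1 => //; exists 0 => d; by rewrite nrm0.
Qed.

Lemma mconvergent_lin n m k (M : 'M[R[i]]_(m, k)) (g : fpsmap R n k) :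
  mconvergent g -> mconvergent (lin M g).
Proof.
by move=> gv i; apply: fconvergent_sum => j _; apply: fconvergent_scale.
Qed.

Lemma mconvergent_midm n : mconvergent (@midm R n).
Proof. by move=> i; apply: fconvergent_var. Qed.

Lemma mconvergent_nonlin n m (g : fpsmap R n m) : mconvergent g -> mconvergent (nonlin g).
Proof.
move=> gv i; apply: fconvergentD => //; apply: fconvergentN.
exact/mconvergent_lin/mconvergent_midm.
Qed.

Lemma nrm_fdiv n (r : R) d i (a : fps R n) : 0 <= r ->
  r * nrm (rpow r) d (fdiv i a) <= nrm (rpow r) d.+1 a.
Proof.
move=> r0; pose F P := nc (a P) * rpow r P.
have F0 P : 0 <= F P by rewrite mulr_ge0 ?nc_ge0 ?rpow_ge0.
apply: (@le_trans _ _ (\sum_(P <- [seq P + munit i | P <- mlist n d]) F P)).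
  rewrite big_map /nrm big_distrr; apply: ler_sum => P _ /=.
  rewrite /F rpowD {3}/rpow mdeg_unit expr1 mulrCA [r * _]mulrC.
  rewrite ler_wpM2r ?mulr_ge0 ?rpow_ge0 //.
  by rewrite /fdiv; case: ifP => // _; rewrite nc0 nc_ge0.
apply: ler_sum_subset => //; rewrite ?mlist_uniq //.
  rewrite map_inj_uniq ?mlist_uniq // => P Q; rewrite ![_ + munit i]addrC.
  exact: mindex_addI.
move=> _ /mapP[P + ->]; rewrite !mem_mlist mdegD mdeg_unit addn1.
by rewrite ltnS.
Qed.

(* The recursion for phi is estimated in the norm with weights r^|Q| / w Q;
   [w_delta] absorbs the divisor [delta Q], since every product contributing to
   phi Q splits Q into two nonzero indices. *)
Section Majorant.
Variables (n m k : nat) (phi : fpsmap R n m) (g : fpsmap R m k).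
Variables (w delta : mindex n -> R) (c B : R).
Hypothesis phic : centered phi.
Hypothesis gv : mconvergent g.
Hypothesis g2 : forall i, ford 2 (g i).
Hypothesis w_gt0 : forall P, 0 < w P.
Hypothesis w0 : 1 <= w 0.
Hypothesis wM : forall P Q, w P * w Q <= w (P + Q).
Hypothesis B0 : 0 < B.
Hypothesis wB : forall P, w P <= B ^+ mdeg P.
Hypothesis c0 : 0 <= c.
Hypothesis delta_gt0 : forall Q, (2 <= mdeg Q)%N -> 0 < delta Q.
Hypothesis w_delta : forall P Q, P != 0 -> Q != 0 ->
  w P * w Q <= delta (P + Q) * w (P + Q).
Hypothesis phi_le : forall i Q, (2 <= mdeg Q)%N ->
  delta Q * nc (phi i Q) <= c * \sum_l nc (fcomp (g l) phi Q).

Let v (r : R) (Q : mindex n) := rpow r Q / w Q.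

Let v_ge0 r P : 0 <= r -> 0 <= v r P.
Proof. by move=> r0; apply: divr_ge0; [exact: rpow_ge0|exact: ltW]. Qed.

Let vM r P Q : 0 <= r -> v r (P + Q) <= v r P * v r Q.
Proof.
move=> r0; rewrite /v rpowD mulrACA -invfM ler_wpM2l ?mulr_ge0 ?rpow_ge0 //.
by rewrite lef_pV2 ?posrE ?mulr_gt0.
Qed.

Let v0 r : v r 0 <= 1.
Proof. by rewrite /v rpow0 mul1r invf_le1. Qed.

Let v_delta r P Q : 0 <= r -> P != 0 -> Q != 0 ->
  v r (P + Q) / delta (P + Q) <= v r P * v r Q.
Proof.
move=> r0 P0 Q0; have d0 : 0 < delta (P + Q).
  by apply: delta_gt0; move: P0 Q0; rewrite -!mdeg_gt0 mdegD; lia.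
rewrite /v rpowD mulrACA -invfM -mulrA -invfM ler_wpM2l ?mulr_ge0 ?rpow_ge0 //.
by rewrite lef_pV2 ?posrE ?mulr_gt0 // [leRHS]mulrC w_delta.
Qed.

(* Both factors being without constant term, only coefficients of degree at
   most d contribute to the product up to degree d + 1. *)
Let nrm_mul_gain r d (a b : fps R n) : 0 <= r -> a 0 = 0 -> b 0 = 0 ->
  \sum_(Q <- mlist n d.+1) (if (2 <= mdeg Q)%N then nc ((a * b) Q) * (v r Q / delta Q) else 0)
    <= nrm (v r) d a * nrm (v r) d b.
Proof.
move=> r0 a0 b0.
pose f (x : fps R n) P := if (mdeg P <= d)%N then nc (x P) * v r P else 0.
have f0 x P : 0 <= f x P.
  by rewrite /f; case: ifP => // _; rewrite mulr_ge0 ?nc_ge0 ?v_ge0.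
apply: (@le_trans _ _ (\sum_(Q <- mlist n d.+1) \sum_(P <- mlist n d.+1)
    \sum_(S <- mlist n d.+1) if P + S == Q then f a P * f b S else 0)).
  rewrite big_seq [leRHS]big_seq; apply: ler_sum => Q; rewrite mem_mlist => Qd.
  case: ifP => Q2; last first.
    by apply: sumr_ge0 => P _; apply: sumr_ge0 => S _; case: ifP => // _; rewrite mulr_ge0.
  have vd0 : 0 <= v r Q / delta Q by rewrite divr_ge0 ?v_ge0 // ltW // delta_gt0.
  rewrite (fcoefM _ _ Qd); apply: (le_trans (ler_wpM2r vd0 (nc_sum _ _ _))).
  rewrite big_distrl; apply: ler_sum => P _ /=.
  apply: (le_trans (ler_wpM2r vd0 (nc_sum _ _ _))).
  rewrite big_distrl; apply: ler_sum => S _ /=.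
  case: eqP => [PS|_]; last by rewrite nc0 mul0r.
  have [P0|P0] := eqVneq P 0; first by rewrite P0 a0 mul0r nc0 mul0r mulr_ge0.
  have [S0|S0] := eqVneq S 0; first by rewrite S0 b0 mulr0 nc0 mul0r mulr_ge0.
  rewrite /f !ifT.
  - by rewrite ncM [leRHS]mulrACA ler_wpM2l ?mulr_ge0 ?nc_ge0 // -PS v_delta.
  - by move: Qd P0 S0; rewrite -!mdeg_gt0 -PS mdegD; lia.
  - by move: Qd P0 S0; rewrite -!mdeg_gt0 -PS mdegD; lia.
rewrite /nrm -!(@big_mlist_cond _ _ d d.+1) // big_distrl exchange_big.
apply: ler_sum => P _ /=; rewrite big_distrr exchange_big; apply: ler_sum => S _ /=.
rewrite -/(f a P) -/(f b S); have [PS|PS] := leqP (mdeg (P + S)) d.+1.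
  under eq_bigr => Q _ do rewrite eq_sym.
  by rewrite (big_mlist_pred1 (fun=> f a P * f b S) PS).
rewrite big_seq big1 => [|Q]; first by rewrite mulr_ge0.
by rewrite mem_mlist; case: eqP => // <-; rewrite leqNgt PS.
Qed.

Let X r d := \sum_i nrm (v r) d (phi i).

Let X_ge0 r d : 0 <= r -> 0 <= X r d.
Proof. by move=> r0; apply: sumr_ge0 => i _; apply: nrm_ge0 => P; apply: v_ge0. Qed.

Let S0 := \sum_i \sum_(P <- mlist n 1) nc (phi i P) / w P.

Let S0_ge0 : 0 <= S0.
Proof.
apply: sumr_ge0 => i _; apply: sumr_ge0 => P _.
by apply: divr_ge0; [exact: nc_ge0|exact: ltW].
Qed.

(** In g_l(phi) = sum_a phi_a u_(l,a) both factors lack a constant term, so the part up to degree d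
    + 1 is controlled by the norms up to degree d. Hence a quadratic recursion in [d]. *)
Let X_step rho C : 0 < rho -> 0 <= C -> (forall l d, nrm (rpow rho) d (g l) <= C) ->
  exists2 M, 0 <= M & forall r d, 0 <= r -> X r d <= rho ->
    X r d.+1 <= S0 * r + M * X r d ^+ 2.
Proof.
(* One factor 1 / rho comes from the division by a variable, the other from shrinking the radius rho
   to X r d. *)
move=> rho0 C0 gC; pose K := C / rho ^+ 2.
have K0 : 0 <= K by rewrite divr_ge0 ?exprn_ge0 ?(ltW rho0).
exists (\sum_(i < m) c * \sum_(l < k) \sum_(a < m) K).
  by apply: sumr_ge0 => i _; rewrite mulr_ge0 //; apply: sumr_ge0 => l _; apply: sumr_ge0.
move=> r d r0 Xrho; have X0 := X_ge0 d r0.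
have phiX a : nrm (v r) d (phi a) <= X r d.
  rewrite /X (bigD1 a) //= lerDl; apply: sumr_ge0 => i _.
  by apply: nrm_ge0 => P; apply: v_ge0.
pose u l a := fcomp (fdiv a (g l)) phi.
have u0 l a : u l a 0 = 0.
  by rewrite /u fcomp_coef0 // fcoef0_fdiv g2 // mdeg_unit.
have uX l a : nrm (v r) d (u l a) <= K * X r d.
  apply: (@le_trans _ _ (nrm (rpow (X r d)) d (fdiv a (g l)))).
    by apply: nrm_fcomp => // P; [exact: v_ge0|move=> Q; exact: vM].
  have t1 : 0 <= X r d / rho <= 1.
    by rewrite divr_ge0 ?(ltW rho0) //= ler_pdivrMr // mul1r.
  rewrite -[X in rpow X](divfK (lt0r_neq0 rho0)).
  apply: (le_trans (nrm_shrink d (ltW rho0) t1 _)).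
    by rewrite fcoef0_fdiv g2 // mdeg_unit.
  rewrite /K [leRHS]mulrC -mulrA ler_wpM2l // mulrC ler_pdivrMr // expr2 invfM.
  rewrite mulrA divfK ?lt0r_neq0 // ler_pdivlMr // mulrC.
  by apply: (le_trans (nrm_fdiv _ _ _ (ltW rho0))); apply: gC.
rewrite /S0 mulr_suml mulr_suml /X -big_split; apply: ler_sum => i _ /=.
rewrite {1}/nrm (eq_bigr (fun Q => (if (mdeg Q <= 1)%N then nc (phi i Q) * v r Q else 0) +
   (if (2 <= mdeg Q)%N then nc (phi i Q) * v r Q else 0))); last first.
  by move=> Q _; case: leqP; rewrite ?addr0 ?add0r.
rewrite big_split; apply: lerD.
  rewrite big_mlist_cond // big_distrl big_seq [leRHS]big_seq.
  apply: ler_sum => Q; rewrite mem_mlist => Q1 /=.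
  have [->|Q0] := eqVneq Q 0; first by rewrite (phic i) nc0 !mul0r.
  rewrite /v /rpow (_ : mdeg Q = 1%N) ?expr1; last by move: Q0; rewrite -mdeg_gt0; lia.
  by rewrite mulrA mulrAC.
apply: (@le_trans _ _ (\sum_(Q <- mlist n d.+1) c * \sum_l \sum_a
    if (2 <= mdeg Q)%N then nc ((phi a * u l a) Q) * (v r Q / delta Q) else 0)).
  apply: ler_sum => Q _; case: ifP => Q2; last first.
    by rewrite big1 ?mulr0 // => l _; rewrite big1.
  have d0 := delta_gt0 Q2.
  have vd0 : 0 <= v r Q / delta Q by rewrite divr_ge0 ?v_ge0 // ltW.
  have -> : nc (phi i Q) * v r Q = delta Q * nc (phi i Q) * (v r Q / delta Q).
    by field; rewrite !lt0r_neq0.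
  apply: (le_trans (ler_wpM2r vd0 (phi_le i Q2))); rewrite -mulrA ler_wpM2l //.
  rewrite big_distrl; apply: ler_sum => l _ /=; rewrite -big_distrl /= ler_wpM2r //.
  rewrite (fcomp_fdiv phic) (_ : g l 0 = 0) ?g2 ?mdeg0 // fcoefD fcoef_sum.
  rewrite (_ : fconst 0 Q = 0) ?add0r; first exact: nc_sum.
  by rewrite /fconst; case: eqP.
rewrite -big_distrr /= -mulrA ler_wpM2l //.
rewrite exchange_big big_distrl; apply: ler_sum => l _ /=.
rewrite exchange_big big_distrl; apply: ler_sum => a _ /=.
apply: (le_trans (nrm_mul_gain d r0 (phic a) (u0 l a))).
apply: (@le_trans _ _ (X r d * (K * X r d))); last by rewrite mulrCA expr2.
by apply: ler_pM => //; apply: nrm_ge0 => P; apply: v_ge0.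
Qed.

Lemma majorant_convergent : mconvergent phi.
Proof.
have /mconvergentP[rho rho0 [C C0 gC]] := gv.
have [M M0 step] := X_step rho0 C0 gC.
pose S1 := S0 + 1; have S1_gt0 : 0 < S1 by rewrite ltr_wpDl.
(* This gives 2 S1 r <= rho and 4 M S1 r <= 1, so that the bound X <= 2 S1 r reproduces itself: S1 r
   + M (2 S1 r)^2 <= 2 S1 r. *)
pose r := (2 * S1 / rho + 4 * M * S1 + 1)^-1.
have h1 : 0 <= 2 * S1 / rho.
  by apply: divr_ge0; [apply: mulr_ge0 => //; apply: ltW|apply: ltW].
have h2 : 0 <= 4 * M * S1.
  by apply: mulr_ge0; [apply: mulr_ge0|apply: ltW].
have den_gt0 : 0 < 2 * S1 / rho + 4 * M * S1 + 1.
  by move: h1 h2; lra.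
have r0 : 0 < r by rewrite invr_gt0.
have e1 : r * (2 * S1 / rho + 4 * M * S1 + 1) = 1 by rewrite mulVf // lt0r_neq0.
have a0 : 0 <= r * (2 * S1 / rho).
  by apply: mulr_ge0 => //; apply: ltW.
have b0 : 0 <= r * (4 * M * S1) by apply: mulr_ge0 => //; apply: ltW.
have r1 : 2 * S1 * r <= rho.
  have : r * (2 * S1 / rho) <= 1 by lra.
  by rewrite mulrA ler_pdivrMr // mul1r mulrC.
have r2 : 4 * M * S1 * r <= 1 by lra.
have y0 : 0 <= 2 * S1 * r.
  by apply: mulr_ge0; [apply: mulr_ge0 => //|]; apply: ltW.
have Xr d : X r d <= 2 * S1 * r.
  elim: d => [|d IH].
    rewrite {1}/X big1 // => i _.
    by rewrite /nrm big_mlist0 (phic i) nc0 mul0r.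
  apply: (le_trans (step r d (ltW r0) (le_trans IH r1))).
  have Xd0 := X_ge0 d (ltW r0).
  have X2 : X r d ^+ 2 <= (2 * S1 * r) ^+ 2.
    by rewrite lerXn2r // nnegrE (le_trans Xd0).
  apply: (@le_trans _ _ (S1 * r + M * (2 * S1 * r) ^+ 2)).
    apply: lerD; last exact: ler_wpM2l.
    by rewrite ler_wpM2r ?(ltW r0) // lerDl.
  have -> : M * (2 * S1 * r) ^+ 2 = (4 * M * S1 * r) * (S1 * r) by ring.
  have z0 : 0 <= S1 * r by move: y0; rewrite -mulrA; lra.
  by have := ler_wpM2r z0 r2; lra.
(* Since w P <= B^|P|, the radius r / B absorbs the division by the weight. *)
apply/mconvergentP; exists (r / B); first exact: divr_gt0.
exists (2 * S1 * r) => // i d.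
apply: le_trans (Xr d); apply: (@le_trans _ _ (nrm (v r) d (phi i))); last first.
  rewrite /X (bigD1 i) //= lerDl; apply: sumr_ge0 => j _.
  by apply: nrm_ge0 => P; apply/v_ge0/ltW.
apply: ler_sum => P _; rewrite ler_wpM2l ?nc_ge0 // /v /rpow expr_div_n.
by rewrite ler_wpM2l ?exprn_ge0 ?(ltW r0) // lef_pV2 ?posrE ?exprn_gt0.
Qed.

End Majorant.

(** The majorant argument without small divisors: in degrees at least 2, G_Q = - J^-1 N(G)_Q, and
    both the weight and the divisors are 1. *)
Lemma convergent_inverse n (A G : fpsmap R n n) : mconvergent A -> centered A ->
  centered G -> jac A \in unitmx -> mcomp A G = midm -> mconvergent G.
Proof.
move=> Av Ac Gc Au AG.
pose c := \sum_i \sum_j nc (invmx (jac A) i j).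
have cij i j : nc (invmx (jac A) i j) <= c.
  rewrite /c (bigD1 i) //= (bigD1 j) //= -addrA lerDl addr_ge0 //.
    by apply: sumr_ge0 => k _; apply: nc_ge0.
  by apply: sumr_ge0 => k _; apply: sumr_ge0 => l _; apply: nc_ge0.
have c0 : 0 <= c by apply: sumr_ge0 => k _; apply: sumr_ge0 => l _; apply: nc_ge0.
apply: (@majorant_convergent _ _ _ G (nonlin A) (fun=> 1) (fun=> 1) c 1)  => // [||P|i Q Q2]; rewrite ?mul1r ?expr1n //.
- exact: mconvergent_nonlin.
- by move=> i; apply: ford_nonlin.
have e : cvec G Q = - (invmx (jac A) *m cvec (mcomp (nonlin A) G) Q).
  have := cvec_mcomp_nonlin A Q Gc; rewrite AG (_ : cvec midm Q = 0) => [/eqP|].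
    rewrite eq_sym addr_eq0 => /eqP e; rewrite -mulmxN.
    by rewrite -[cvec _ _ in RHS]opprK -e opprK mulKmx.
  apply/matrixP => j l; rewrite !mxE /midm /fvar; case: eqP Q2 => // ->.
  by rewrite mdeg_unit.
have -> : G i Q = cvec G Q i ord0 by rewrite mxE.
rewrite e mxE ncN mxE; apply: (le_trans (nc_sum _ _ _)).
rewrite big_distrr; apply: ler_sum => l _ /=.
by rewrite ncM !mxE ler_wpM2r ?nc_ge0.
Qed.

End Convergence.

(** * Small divisors *)

Section Counting.
Variables (R : realType) (n : nat) (bad : pred (mindex n)) (q : nat).
Hypothesis q_gt0 : (0 < q)%N.
Hypothesis bad_deg : forall P, bad P -> (q < mdeg P)%N.
Hypothesis bad_gap : forall P S, bad P -> bad (P + S) -> S != 0 -> (q <= mdeg S)%N.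
Implicit Types P Q S : mindex n.

(** The factor 2 leaves room for the corrections: a bad index has t >= 2 and so counts for t - 1 >=
    1, and two distinct comparable bad indices differ by at least 2 in t. *)
Let t (P : mindex n) : R := 2 * (mdeg P)%:R / q%:R.

Let q_gt0' : 0 < q%:R :> R. Proof. by rewrite ltr0n. Qed.

Let tD P Q : t (P + Q) = t P + t Q.
Proof. by rewrite /t mdegD natrD mulrDr mulrDl. Qed.

Let t_ge0 P : 0 <= t P.
Proof. by rewrite /t divr_ge0 ?mulr_ge0. Qed.

Let t_ge2 P : (q <= mdeg P)%N -> 2 <= t P.
Proof. by move=> h; rewrite /t ler_pdivlMr // ler_wpM2l // ler_nat. Qed.

Let t_le2 P : (mdeg P <= q)%N -> t P <= 2.
Proof. by move=> h; rewrite /t ler_pdivrMr // ler_wpM2l // ler_nat. Qed.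

(* An explicit bound for the number of bad indices met along any decomposition
   of Q into sums. It is superadditive because two bad indices P <= P + S are
   at distance at least q: this is Brjuno's counting lemma without recursion. *)
Definition bad_count Q : R :=
  Num.max (2 * (mdeg Q)%:R / q%:R - 2)
  (\big[Num.max/0]_(P <- mlist n (mdeg Q) | bad P && [forall i, (P i <= Q i)%N])
     (2 * (mdeg P)%:R / q%:R - 1)).
Local Notation A := bad_count.

Let A_ge_t Q : t Q - 2 <= A Q.
Proof. by rewrite /A le_max lexx. Qed.

Lemma bad_count_ge0 Q : 0 <= A Q.
Proof. by rewrite /A le_max bigmax_ge_id orbT. Qed.

Let A_ge_bad P S : bad P -> t P - 1 <= A (P + S).
Proof.
move=> bP; rewrite /A le_max; apply/orP; right.
apply: (@bigmax_sup_seq _ _ _ _ _ P) => //; first by rewrite mem_mlist mdegD leq_addr.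
by rewrite bP; apply/forallP => i; rewrite mindexDE leq_addr.
Qed.

Let A_le Q y : 0 <= y -> t Q - 2 <= y ->
  (forall P S, Q = P + S -> bad P -> t P - 1 <= y) -> A Q <= y.
Proof.
move=> y0 ty h; rewrite /A ge_max ty /=; apply: bigmax_le => // P /andP[bP /forallP PQ].
apply: (h P [ffun i => Q i - P i]%N) => //.
by apply/ffunP => i; rewrite mindexDE ffunE subnKC.
Qed.

Lemma bad_count_le Q : A Q <= 2 * (mdeg Q)%:R / q%:R.
Proof.
apply: A_le; rewrite -?/(t Q) ?t_ge0 //; first by have := t_ge0 Q; lra.
by move=> P S -> _; rewrite tD; have := t_ge0 S; lra.
Qed.

Lemma bad_count_small Q : (mdeg Q <= q)%N -> A Q = 0.
Proof.
move=> Qq; apply/le_anti; rewrite bad_count_ge0 andbT; apply: A_le => //.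
  by have := t_le2 Qq; lra.
move=> P S QPS /bad_deg; rewrite ltnNge (leq_trans _ Qq) //.
by rewrite QPS [X in (_ <= X)%N]mdegD leq_addr.
Qed.

Let A_mono P S : A P <= A (P + S).
Proof.
apply: A_le; first exact: bad_count_ge0.
  by apply: le_trans (A_ge_t _); rewrite tD; have := t_ge0 S; lra.
by move=> P' S' -> bP'; rewrite -addrA; apply: A_ge_bad.
Qed.

Let A_case P : A P = 0 \/ A P <= t P - 1.
Proof.
have [Pq|qP] := leqP (mdeg P) q; first by left; apply: bad_count_small.
right; have := t_ge2 (ltnW qP) => t2; apply: A_le; try lra.
by move=> P' S' -> _; rewrite tD; have := t_ge0 S'; lra.
Qed.

Let A_bad P S : bad (P + S) -> S != 0 -> A P <= t (P + S) - 2.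
Proof.
move=> bPS S0; have t2 := t_ge2 (ltnW (bad_deg bPS)); apply: A_le; try lra.
  by rewrite tD; have := t_ge0 S; lra.
move=> P' S' PS' bP'; have : (q <= mdeg (S' + S)%R)%N.
  apply: (@bad_gap P') => //; first by rewrite addrA -PS'.
  by rewrite -mdeg_gt0 mdegD addn_gt0 orbC mdeg_gt0 S0.
by move/t_ge2; rewrite PS' -addrA [t (P' + _)]tD; lra.
Qed.

(** If both counts are nonzero, their sum is at most t(P + S) - 2, and a bad P + S provides the
    value t(P + S) - 1. If only one is nonzero and P + S is bad, [A_bad] bounds it by t(P + S) - 2,
    because the gap keeps the bad indices below it away from P + S. *)
Lemma bad_count_super P S : P != 0 -> S != 0 ->
  A P + A S + (bad (P + S))%:R <= A (P + S).
Proof.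
move=> P0 S0; case: (A_case P) (A_case S) => [eP|hP] [eS|hS].
- rewrite eP eS !add0r; case b : (bad _); last exact: bad_count_ge0.
  have := A_ge_bad 0 b; rewrite addr0; have := t_ge2 (ltnW (bad_deg b)).
  by rewrite /=; lra.
- rewrite eP add0r; case b : (bad _) => /=; last by rewrite addr0 addrC A_mono.
  have := A_ge_bad 0 b; rewrite addr0.
  by have := @A_bad S P; rewrite [S + P]addrC b => /(_ isT P0); lra.
- rewrite eS addr0; case b : (bad _) => /=; last by rewrite addr0 A_mono.
  have := A_ge_bad 0 b; rewrite addr0.
  by have := @A_bad P S b S0; lra.
- have := A_ge_t (P + S); case b : (bad _) => /=; last by rewrite tD; lra.
  by have := A_ge_bad 0 b; rewrite addr0 tD; lra.
Qed.

End Counting.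

Section MultiPower.
Variables (R : realType) (n : nat) (lam : 'I_n -> R[i]).
Local Notation nc := (@Normc.normc R).

Lemma mpowD P Q : mpow lam (P + Q) = mpow lam P * mpow lam Q.
Proof. by rewrite /mpow -big_split; apply: eq_bigr => i _; rewrite mindexDE exprD. Qed.

Lemma mpow_unit i : mpow lam (munit i) = lam i.
Proof.
rewrite /mpow (bigD1 i) //= ffunE eqxx expr1 big1 ?mulr1 // => j /negbTE ji.
by rewrite ffunE ji.
Qed.

End MultiPower.

(** Abel summation: with S_K the partial sums, the left side equals 2 S_(K+1) - l_1 - S_K, and S_K
    is bounded below since l_k >= l_1. *)
Lemma dyadic_increments_bound (R : realType) (l : nat -> R) (C : R) :
  (forall k, (1 <= k)%N -> l k <= l k.+1) ->
  (forall K, \sum_(1 <= k < K) l k / 2 ^+ k <= C) ->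
  forall K, (1 <= K)%N ->
    \sum_(1 <= k < K) (l k.+1 - l k) / 2 ^+ k <= 2 * C + 2 * `|l 1%N|.
Proof.
move=> lS lC; pose S K := \sum_(1 <= k < K) l k / 2 ^+ k.
have S1 : S 1%N = 0 by rewrite /S big_geq.
have SS K : (1 <= K)%N -> S K.+1 = S K + l K / 2 ^+ K.
  by move=> K1; rewrite /S big_nat_recr.
have l1 k : (1 <= k)%N -> - `|l 1%N| <= l k.
  elim: k => // -[_ _|k IH _]; first by rewrite lerNl ler_normr lexx orbT.
  by apply: le_trans (lS _ _); rewrite ?IH.
have S_lb K : (1 <= K)%N -> - `|l 1%N| * (1 - 2 / 2 ^+ K) <= S K.
  elim: K => // -[_ _|K IH _]; first by rewrite S1 expr1 divff // subrr mulr0.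
  rewrite SS //; have := IH isT; have := l1 K.+1 isT.
  have p0 : 0 < (2 ^+ K.+1 : R)^-1 by rewrite invr_gt0 exprn_gt0.
  move=> /(ler_wpM2r (ltW p0)) h1 h2; have := lerD h2 h1; apply: le_trans.
  have -> : (2 ^+ K.+2 : R)^-1 = 2^-1 * (2 ^+ K.+1)^-1 by rewrite [in LHS]exprS invfM.
  by rewrite le_eqVlt; apply/orP; left; apply/eqP; field.
move=> K K1; have -> : \sum_(1 <= k < K) (l k.+1 - l k) / 2 ^+ k =
    2 * S K.+1 - l 1%N - S K.
  elim: K K1 => // -[_ _|K IH _].
    by rewrite big_geq // SS // S1 expr1; field.
  rewrite big_nat_recr //= IH // [S K.+3]SS // [S K.+2]SS //.
  have p0 : (2 ^+ K.+1 : R) != 0 by rewrite expf_neq0.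
  by rewrite ![2 ^+ K.+2]exprS; field.
have := S_lb K K1; have := lC K.+1; rewrite -/(S K.+1) => h1 h2.
have a1 : `|l 1%N| * (2 / 2 ^+ K) >= 0 by rewrite mulr_ge0 ?divr_ge0 ?exprn_ge0.
have a2 : - l 1%N <= `|l 1%N| by rewrite ler_normr lexx orbT.
by move: h2; rewrite mulrBr mulr1 mulNr; lra.
Qed.

(** * Brjuno weights for the divisors lam^Q - D_j *)

Section Bruno.
Variables (R : realType) (n m : nat) (lam : 'I_n -> R[i]) (D : 'I_m -> R[i]).
Variables (om : nat -> R) (C : R).
Local Notation nc := (@Normc.normc R).
Hypothesis om_gt0 : forall k, (1 <= k)%N -> 0 < om k.
Hypothesis om_dec : forall k, (1 <= k)%N -> om k.+1 <= om k.
Hypothesis om_le : forall k Q j, (1 <= k)%N -> (2 <= mdeg Q <= 2 ^ k)%N ->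
  om k <= nc (mpow lam Q - D j).
Hypothesis lam_neq0 : forall i, lam i != 0.
Hypothesis D_neq0 : forall j, D j != 0.
Hypothesis lam_D : forall i, exists j, D j = lam i.
Hypothesis om_sum : forall K, \sum_(1 <= k < K) (- ln (om k)) / 2 ^+ k <= C.

Let om_le1 k : (1 <= k)%N -> om k <= om 1%N.
Proof.
elim: k => // -[//|k] IH _; apply: le_trans (om_dec _) (IH _) => //.
Qed.

(** A divisor will be called bad at scale k if it is below [th * om k]. The second condition then
    gives |lam^P| >= |D_j| / 2 for a bad P; the third makes two bad indices close to each other
    contradict the definition of [om k]. *)
Let theta_ex : exists2 th : R, 0 < th & [/\ th <= 1,
  forall j, th * om 1%N <= nc (D j) / 2 &
  forall i j, 4 * th * nc (lam i) <= nc (D j)].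
Proof.
pose a := \big[Num.min/1]_j nc (D j); pose b := \big[Num.max/1]_i nc (lam i).
have a0 : 0 < a.
  by rewrite /a; elim/big_ind: _ => // [x y x0 y0|j _]; rewrite ?lt_min ?x0 ?nc_gt0.
have a1 : a <= 1 by rewrite /a; apply: bigmin_le_id.
have aD j : a <= nc (D j) by apply: bigmin_le_cond.
have b1 : 1 <= b by apply: bigmax_ge_id.
have bl i : nc (lam i) <= b by apply: le_bigmax.
have o0 := om_gt0 (leqnn 1).
have d0 : 0 < 4 * b * (1 + om 1%N) by apply: mulr_gt0; lra.
exists (a / (4 * b * (1 + om 1%N))); first exact: divr_gt0.
split=> [|j|i j].
- rewrite ler_pdivrMr // mul1r; nra.
- have x0 := nc_ge0 (D j); rewrite mulrAC ler_pdivrMr //.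
  have h1 : 0 <= (b - 1) * (nc (D j) * (1 + om 1%N)).
    by apply: mulr_ge0; [lra|apply: mulr_ge0 => //; lra].
  have h3 : 0 <= nc (D j) * om 1%N by apply: mulr_ge0 => //; lra.
  have h2 : 0 <= (nc (D j) - a) * om 1%N by apply: mulr_ge0; [rewrite subr_ge0|lra].
  by lra.
- have -> : 4 * (a / (4 * b * (1 + om 1%N))) * nc (lam i) = a * nc (lam i) / (b * (1 + om 1%N)).
    by field; apply/andP; split; apply: lt0r_neq0; lra.
  have x0 := nc_ge0 (D j); rewrite ler_pdivrMr; last by apply: mulr_gt0; lra.
  have h1 : 0 <= (nc (D j) - a) * nc (lam i).
    by apply: mulr_ge0; rewrite ?subr_ge0 // nc_ge0.
  have h2 : 0 <= nc (D j) * (b - nc (lam i)) by apply: mulr_ge0; rewrite ?subr_ge0.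
  have h3 : 0 <= nc (D j) * (b * om 1%N) by apply: mulr_ge0 => //; apply: mulr_ge0; lra.
  by lra.
Qed.

Section Weights.
Variable th : R.
Hypothesis th_gt0 : 0 < th.
Hypothesis th_le1 : th <= 1.
Hypothesis th_D : forall j, th * om 1%N <= nc (D j) / 2.
Hypothesis th_lam : forall i j, 4 * th * nc (lam i) <= nc (D j).

Let bad k j : pred (mindex n) := fun Q =>
  (2 <= mdeg Q)%N && (nc (mpow lam Q - D j) < th * om k).

Let bad_deg k j Q : (1 <= k)%N -> bad k j Q -> (2 ^ k < mdeg Q)%N.
Proof.
move=> k1 /andP[Q2 h]; rewrite ltnNge; apply/negP => Qk.
have := @om_le k Q j k1; rewrite Q2 Qk => /(_ isT); have := om_gt0 k1.
move=> o0; have : th * om k <= om k by rewrite ler_piMl // ltW.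
by move: h; lra.
Qed.

(** The difference of the two divisors is lam^P (lam^S - 1), so lam^S - 1 is small. Times lam_i it
    is again a divisor, for the index S + e_i and the entry of [D] equal to lam_i. If |S| < 2^k, the
    degree |S| + 1 is within reach of [om_le], which contradicts the smallness. *)
Let bad_gap k j P S : (1 <= k)%N -> bad k j P -> bad k j (P + S) -> S != 0 ->
  (2 ^ k <= mdeg S)%N.
Proof.
move=> k1 /andP[_ hP] /andP[_ hPS] S0; rewrite leqNgt; apply/negP => Sk.
have [i _] := mindex_neq0 S0; have [j' Dj'] := lam_D i.
have S1 : (0 < mdeg S)%N by rewrite mdeg_gt0.
have := @om_le k (S + munit i) j' k1; rewrite mdegD mdeg_unit addn1 !ltnS.
rewrite S1 Sk => /(_ isT); rewrite mpowD mpow_unit Dj' -{2}[lam i]mul1r -mulrBl ncM.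
set x := nc (_ - 1) => om_x; have ok := om_gt0 k1.
have hPx : nc (mpow lam P) * x < 2 * (th * om k).
  rewrite /x -ncM mulrBr mulr1 -mpowD.
  rewrite (_ : _ - _ = (mpow lam (P + S) - D j) - (mpow lam P - D j)); last by ring.
  by apply: le_lt_trans (ncD _ _) _; rewrite ncN; lra.
have hP2 : nc (D j) / 2 <= nc (mpow lam P).
  have := th_D j; have : th * om k <= th * om 1%N by rewrite ler_wpM2l ?om_le1 // ltW.
  have := ncD (mpow lam P) (D j - mpow lam P); rewrite addrC subrK.
  by rewrite -ncN opprB in hP; lra.
have l0 : 0 < nc (lam i) by rewrite nc_gt0.
have d0 : 0 < nc (D j) by rewrite nc_gt0.
have x0 : 0 <= x by apply: nc_ge0.
have h1 : nc (D j) / 2 * x <= nc (mpow lam P) * x by rewrite ler_wpM2r.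
have h2 : nc (D j) / 2 * x * nc (lam i) < 2 * (th * om k) * nc (lam i).
  by rewrite ltr_pM2r //; lra.
have h3 : 4 * th * nc (lam i) * om k <= nc (D j) * om k by rewrite ler_wpM2r // ltW.
have h4 : nc (D j) * om k <= nc (D j) * (x * nc (lam i)) by rewrite ler_wpM2l // ltW.
by lra.
Qed.

Let A k j := @bad_count R n (bad k j) (2 ^ k).

Let exp2_gt0 k : (0 < 2 ^ k)%N. Proof. by rewrite expn_gt0. Qed.

Let A_small k j Q : (1 <= k)%N -> (mdeg Q <= k)%N -> A k j Q = 0.
Proof.
move=> k1 Qk; apply: bad_count_small => // [P|]; first exact: bad_deg.
by rewrite (leq_trans Qk) // ltnW // ltn_expl.
Qed.

Let L k := ln (om k) - ln (om k.+1).

Let L_ge0 k : (1 <= k)%N -> 0 <= L k.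
Proof.
move=> k1; rewrite /L subr_ge0 ler_ln ?posrE ?om_gt0 //; exact: om_dec.
Qed.

Let c0 := Num.max 0 (- ln (th * om 1%N)).

Let c0_ge0 : 0 <= c0. Proof. by rewrite le_max lexx. Qed.

Let hs N Q := \sum_j \sum_(1 <= k < N) L k * A k j Q.

(* The logarithm of the weight: [c0] pays for a divisor above the first scale,
   and [L k] for passing from scale [k] to scale [k + 1]. *)
Let h Q := c0 * (mdeg Q).-1%:R + hs (mdeg Q) Q.

Let hs_widen N Q : (mdeg Q <= N)%N -> hs N Q = hs (mdeg Q) Q.
Proof.
move=> QN; apply: eq_bigr => j _; have [Q1|Q1] := posnP (mdeg Q).
  rewrite Q1 [RHS]big_geq // big_nat_cond big1 // => k /andP[/andP[k1 _] _].
  by rewrite A_small ?mulr0 // Q1.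
rewrite (big_cat_nat Q1 QN) /= [X in _ + X]big_nat_cond [X in _ + X]big1 ?addr0 //.
move=> k /andP[/andP[Qk _] _]; rewrite A_small ?mulr0 //.
exact: leq_trans Q1 Qk.
Qed.

Let hs_super N P S j : P != 0 -> S != 0 ->
  hs N P + hs N S + \sum_(1 <= k < N) L k * (bad k j (P + S))%:R <= hs N (P + S).
Proof.
move=> P0 S0; have key k j' : (1 <= k)%N ->
    L k * A k j' P + L k * A k j' S + L k * (bad k j' (P + S))%:R <= L k * A k j' (P + S).
  move=> k1; rewrite -!mulrDr ler_wpM2l ?L_ge0 //.
  by apply: bad_count_super => // [T|T U]; [exact: bad_deg|exact: bad_gap].
have w j' : \sum_(1 <= k < N) L k * A k j' P + \sum_(1 <= k < N) L k * A k j' S +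
   \sum_(1 <= k < N) L k * (bad k j' (P + S))%:R <= \sum_(1 <= k < N) L k * A k j' (P + S).
  rewrite -!big_split big_nat_cond [leRHS]big_nat_cond.
  by apply: ler_sum => k /andP[/andP[k1 _] _]; apply: key.
have b0 j' : 0 <= \sum_(1 <= k < N) L k * (bad k j' (P + S))%:R.
  rewrite big_nat_cond; apply: sumr_ge0 => k /andP[/andP[k1 _] _].
  by rewrite mulr_ge0 ?L_ge0.
apply: (@le_trans _ _ (\sum_j' (\sum_(1 <= k < N) L k * A k j' P +
    \sum_(1 <= k < N) L k * A k j' S + \sum_(1 <= k < N) L k * (bad k j' (P + S))%:R))).
  by rewrite !big_split /= lerD2l (bigD1 j) //= lerDl sumr_ge0.
by apply: ler_sum => j' _; apply: w.
Qed.

(** A telescoping sum: each scale at which the divisor x is bad pays [L k] to lower the threshold.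
    The truncation max(x, th om_K) disappears at K = |Q|, where |Q| < 2^K gives x >= om_K. *)
Let bad_log j Q : (2 <= mdeg Q)%N ->
  - ln (nc (mpow lam Q - D j)) <= c0 + \sum_(1 <= k < mdeg Q) L k * (bad k j Q)%:R.
Proof.
move=> Q2; set x := nc _.
have thom k : (1 <= k)%N -> 0 < th * om k by move=> k1; rewrite mulr_gt0 ?om_gt0.
have key K : (1 <= K)%N -> - ln (Num.max x (th * om K)) <=
    c0 + \sum_(1 <= k < K) L k * (bad k j Q)%:R.
  elim: K => // -[_ _|K IH _].
    rewrite big_geq // addr0 /c0 le_max; apply/orP; right; rewrite lerN2.
    by rewrite ler_ln ?posrE ?lt_max ?thom ?orbT // le_max lexx orbT.
  rewrite big_nat_recr //= addrA; have := IH isT.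
  have [b|b] := ltP x (th * om K.+1); rewrite /bad Q2 -/x /=.
    rewrite b mulr1 => h1.
    apply: (@le_trans _ _ (- ln (th * om K.+2))).
      by rewrite lerN2 ler_ln ?posrE ?lt_max ?thom ?orbT // le_max lexx orbT.
    by rewrite /L !lnM ?posrE ?om_gt0 // in h1 *; lra.
  rewrite ltNge b /= mulr0 addr0; apply: le_trans; rewrite lerN2.
  have x0 : 0 < x by apply: lt_le_trans b; apply: thom.
  rewrite max_l // (le_trans _ b) // ler_wpM2l ?om_dec //; exact: ltW.
have := key (mdeg Q) (ltnW Q2); rewrite max_l //.
have ox : om (mdeg Q) <= x by apply: om_le; rewrite ?Q2 ?(ltnW Q2) // ltnW // ltn_expl.
by apply: le_trans ox; rewrite ler_piMl // ltW // om_gt0 // ltnW.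
Qed.

Let h0 : h 0 = 0.
Proof. by rewrite /h mdeg0 mulr0 add0r /hs big1 // => j _; rewrite big_geq. Qed.

Let h_super j P S : P != 0 -> S != 0 ->
  h P + h S + Num.max 0 (- ln (nc (mpow lam (P + S) - D j))) <= h (P + S).
Proof.
move=> P0 S0; have P1 : (0 < mdeg P)%N by rewrite mdeg_gt0.
have S1 : (0 < mdeg S)%N by rewrite mdeg_gt0.
have e := mdegD P S.
rewrite /h -(@hs_widen (mdeg (P + S)) P) ?e ?leq_addr //.
rewrite -(@hs_widen (mdeg (P + S)) S) ?e ?leq_addl // -e.
have := @hs_super (mdeg (P + S)) P S j P0 S0.
have : Num.max 0 (- ln (nc (mpow lam (P + S) - D j))) <=
    c0 + \sum_(1 <= k < mdeg (P + S)) L k * (bad k j (P + S))%:R.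
  rewrite ge_max bad_log ?andbT; last by rewrite e; lia.
  apply: addr_ge0 => //; rewrite big_nat_cond; apply: sumr_ge0 => k /andP[/andP[k1 _] _].
  by rewrite mulr_ge0 ?L_ge0.
(* The predecessor in the definition of [h] leaves exactly one [c0] free for each sum of two nonzero
   indices. *)
have -> : (mdeg (P + S)).-1%:R = (mdeg P).-1%:R + (mdeg S).-1%:R + 1 :> R.
  by rewrite -natrD natr1 e; congr (_%:R); lia.
by rewrite !mulrDr mulr1; lra.
Qed.

Let Cb := 2 * C + 2 * `|- ln (om 1%N)|.

Let h_le Q : h Q <= (c0 + m%:R * (2 * `|Cb|)) * (mdeg Q)%:R.
Proof.
have [Q1|Q1] := posnP (mdeg Q).
  by move/eqP: Q1; rewrite mdeg_eq0 => /eqP ->; rewrite h0 mdeg0 mulr0.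
rewrite mulrDl; apply: lerD.
  by rewrite ler_wpM2l // ler_nat leq_pred.
rewrite -mulrA mulr_natl -[X in _ *+ X]card_ord -sumr_const; apply: ler_sum => j _.
apply: (@le_trans _ _ (\sum_(1 <= k < mdeg Q) ((- ln (om k.+1)) - (- ln (om k))) / 2 ^+ k
    * (2 * (mdeg Q)%:R))).
  rewrite big_nat_cond [leRHS]big_nat_cond; apply: ler_sum => k /andP[/andP[k1 _] _].
  have -> : (- ln (om k.+1) - - ln (om k)) = L k by rewrite /L opprK addrC.
  rewrite -mulrA ler_wpM2l ?L_ge0 //; apply: le_trans (bad_count_le _ _ _ _) _ => //.
  by rewrite natrX mulrC.
rewrite -big_distrl /=; set N := (mdeg Q)%:R; have N0 : 0 <= 2 * N by rewrite mulr_ge0.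
suff /(ler_wpM2r N0) : \sum_(1 <= k < mdeg Q) (- ln (om k.+1) - - ln (om k)) / 2 ^+ k <= `|Cb|.
  by move/le_trans; apply; rewrite mulrCA mulrA.
apply: le_trans (ler_norm _); apply: dyadic_increments_bound => // k k1.
by rewrite lerN2 ler_ln ?posrE ?om_gt0 // om_dec.
Qed.

Lemma bruno_weight_aux : exists (w : mindex n -> R) (B : R),
  [/\ 0 < B, forall P, 0 < w P, w 0 = 1, forall P, w P <= B ^+ mdeg P &
   (forall P S, w P * w S <= w (P + S)) /\
   (forall P S j, P != 0 -> S != 0 -> nc (mpow lam (P + S) - D j) != 0 ->
     w P * w S <= nc (mpow lam (P + S) - D j) * w (P + S))].
Proof.
exists (fun Q => expR (h Q)), (expR (c0 + m%:R * (2 * `|Cb|))).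
have sup0 (j : 'I_m) P S : P != 0 -> S != 0 -> h P + h S <= h (P + S).
  move=> P0 S0; have := h_super j P0 S0.
  have : 0 <= Num.max 0 (- ln (nc (mpow lam (P + S) - D j))) by rewrite le_max lexx.
  by lra.
split; [exact: expR_gt0|by move=> P; apply: expR_gt0|by rewrite h0 expR0| |].
  by move=> P; rewrite -expRM_natr ler_expR.
split=> [P S|P S j P0 S0 x0].
  have [->|P0] := eqVneq P 0; first by rewrite h0 expR0 mul1r add0r.
  have [->|S0] := eqVneq S 0; first by rewrite h0 expR0 mulr1 addr0.
  have [i _] := mindex_neq0 P0; have [j _] := lam_D i.
  by rewrite -expRD ler_expR (sup0 j).
have x1 : 0 < nc (mpow lam (P + S) - D j) by rewrite lt0r x0 nc_ge0.
rewrite -{1}(lnK x1) -!expRD ler_expR; have := h_super j P0 S0.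
have : - ln (nc (mpow lam (P + S) - D j)) <= Num.max 0 (- ln (nc (mpow lam (P + S) - D j))).
  by rewrite le_max lexx orbT.
by lra.
Qed.

End Weights.

Lemma bruno_weight : exists (w : mindex n -> R) (B : R),
  [/\ 0 < B, forall P, 0 < w P, w 0 = 1, forall P, w P <= B ^+ mdeg P &
   (forall P S, w P * w S <= w (P + S)) /\
   (forall P S j, P != 0 -> S != 0 -> nc (mpow lam (P + S) - D j) != 0 ->
     w P * w S <= nc (mpow lam (P + S) - D j) * w (P + S))].
Proof. by have [th th0 [th1 thD thl]] := theta_ex; apply: (@bruno_weight_aux th). Qed.

End Bruno.

(** * Spectrum of sigma *)

Section Diagonalization.
Variable F : closedFieldType.

Lemma char_poly_similar n (N A B : 'M[F]_n) : N \in unitmx ->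
  A *m N = N *m B -> char_poly A = char_poly B.
Proof.
move=> Nu AN; rewrite /char_poly.
pose N' := map_mx (@polyC F) N.
have N'u : \det N' != 0.
  by rewrite det_map_mx polyC_eq0 -unitfE -unitmxE.
apply: (mulfI N'u); rewrite mulrC -!det_mulmx; congr (\det _).
rewrite /char_poly_mx mulmxBl mulmxBr scalar_mxC; congr (_ - _).
by rewrite -!map_mxM AN.
Qed.

Lemma diagonalize_separable n (A : 'M[F]_n) : separable_poly (char_poly A) ->
  exists2 T : 'M[F]_n, T \in unitmx & exists2 d : 'I_n -> F,
    A *m T = T *m diag_mx (\row_j d j) & injective d /\ forall j, root (char_poly A) (d j).
Proof.
move=> sepA.
have [r er] := closed_field_poly_normal (char_poly A).
rewrite (monicP (char_poly_monic A)) scale1r in er.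
have ur : uniq r by rewrite -separable_prod_XsubC -er.
have [T Tu [d Ad]] : exists2 T : 'M[F]_n, T \in unitmx & exists d : 'rV_n,
    A *m T = T *m diag_mx d.
  case: n A sepA er => [|n] A sepA er.
    by exists 1%:M; rewrite ?unitmx1 //; exists 0; apply/matrixP => -[].
  have [|P Pu /diagonalizable_forPex[D AD]] := (@diagonalizableP _ _ A).2.
    by exists r => //; rewrite -er mxminpoly_dvd_char.
  exists (invmx P); first by rewrite unitmx_inv.
  by exists D; move/simmxP: AD => /(_ Pu) PA; rewrite -[A](mulKmx Pu) PA mulmxA mulmxK.
have eA := char_poly_similar Tu Ad.
have ed : char_poly A = \prod_(x <- [seq d ord0 i | i <- enum 'I_n]) ('X - x%:P).
  rewrite eA char_poly_trig ?diag_mx_is_trig // big_map enumT.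
  by apply: eq_bigr => i _; rewrite mxE eqxx mulr1n.
exists T => //; exists (d ord0).
  by rewrite Ad; congr (_ *m diag_mx _); apply/rowP => j; rewrite mxE.
split=> [i j dij|j].
  move: sepA; rewrite ed separable_prod_XsubC => /(uniqP (d ord0 i)).
  move=> /(_ i j); rewrite !inE size_map size_enum_ord !ltn_ord => /(_ isT isT).
  have nthE (k : 'I_n) : nth (d ord0 i) [seq d ord0 l | l <- enum 'I_n] k = d ord0 k.
    by rewrite (nth_map i) ?size_enum_ord // nth_ord_enum.
  by rewrite !nthE => /(_ dij) /val_inj.
by rewrite ed root_prod_XsubC map_f ?mem_enum.
Qed.

End Diagonalization.

Section Spectrum.
Variables (R : realType) (p : nat) (mu : 'I_p -> R[i]).
Hypothesis mu_neq0 : forall j, mu j != 0.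
Hypothesis mu_nonres : nonresonant mu.
Implicit Types i j : 'I_(p + p).

Definition pair_index i : 'I_p :=
  match fintype.split i with inl j => j | inr j => j end.

Definition pair_sign i : int :=
  match fintype.split i with inl _ => 1 | inr _ => -1 end.

Lemma mu_hatE i : mu_hat mu i = mu (pair_index i) ^ pair_sign i.
Proof.
rewrite /mu_hat /mpair /pair_index /pair_sign; case: fintype.split => k //.
Qed.

Lemma pair_sign_neq0 i : pair_sign i != 0.
Proof. by rewrite /pair_sign; case: fintype.split. Qed.

Lemma pair_indexP i j : pair_index i = pair_index j ->
  i = j \/ mu_hat mu j = (mu_hat mu i)^-1.
Proof.
rewrite /mu_hat /mpair /pair_index => e.
have := splitK i; have := splitK j.
case: (fintype.split i) e => a; case: (fintype.split j) => b <- <- <-.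
- by left.
- by right.
- by right; rewrite invrK.
- by left.
Qed.

Lemma mu_hat_neq0 i : mu_hat mu i != 0.
Proof. by rewrite /mu_hat /mpair; case: fintype.split => k; rewrite ?invr_eq0. Qed.

(** A coincidence is a relation mu^Q = 1 with Q a difference of two signed unit vectors, and Q = 0
    forces i = j. So the spectrum is simple. *)
Lemma mu_hat_inj : injective (mu_hat mu).
Proof.
move=> i j; rewrite !mu_hatE => e.
pose Q : {ffun 'I_p -> int} := [ffun l => (if l == pair_index i then pair_sign i else 0)
  - (if l == pair_index j then pair_sign j else 0)].
have eQ : \prod_l mu l ^ Q l = 1.
  transitivity ((\prod_l mu l ^ (if l == pair_index i then pair_sign i else 0)) *
     (\prod_l mu l ^ (if l == pair_index j then pair_sign j else 0))^-1).
    rewrite -prodfV -big_split; apply: eq_bigr => l _ /=.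
    by rewrite ffunE expfzDr // invr_expz.
  have one k : \prod_l mu l ^ (if l == pair_index k then pair_sign k else 0) =
      mu (pair_index k) ^ pair_sign k.
    by rewrite (bigD1 (pair_index k)) //= eqxx big1 ?mulr1 // => l /negbTE ->.
  by rewrite !one e divff // expfz_neq0.
have Q0 : Q = 0.
  by apply/eqP; apply: contraT => /mu_nonres; rewrite eQ eqxx.
have := congr1 (fun f : {ffun 'I_p -> int} => f (pair_index i)) Q0.
rewrite !ffunE eqxx; case: eqP => [eij|_]; last first.
  by rewrite subr0 => /eqP; rewrite (negbTE (pair_sign_neq0 i)).
move/eqP; rewrite subr_eq0 => /eqP; move: eij.
rewrite /pair_index /pair_sign; have := splitK i; have := splitK j.
by case: (fintype.split i) => a; case: (fintype.split j) => b <- <- //= ->.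
Qed.

(* x = mu_hat i and x^-1 cannot both be eigenvalues of the block S, since the
   complementary block is similar to S^-1 and all eigenvalues are simple. *)
Lemma block_spectrum (L N : 'M[R[i]]_(p + p)) (S S' H : 'M[R[i]]_p) :
  char_poly L = \prod_(i < p + p) ('X - (mu_hat mu i)%:P) ->
  N \in unitmx -> H \in unitmx -> L *m N = N *m block_mx S 0 0 S' ->
  S' *m H *m S = H ->
  exists2 P : 'M[R[i]]_p, P \in unitmx & exists2 kappa : 'I_p -> 'I_(p + p),
    S *m P = P *m diag_mx (\row_j mu_hat mu (kappa j)) &
    injective (pair_index \o kappa).
Proof.
move=> cL Nu Hu LN S'S.
have cLS : char_poly L = char_poly S * char_poly S'.
  rewrite (char_poly_similar Nu LN) /char_poly char_block_diag_mx.
  by rewrite det_ublock.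
have rootL x : root (char_poly L) x -> exists i, x = mu_hat mu i.
  rewrite cL -(big_map (mu_hat mu) xpredT (fun y => 'X - y%:P)) root_prod_XsubC.
  by case/mapP => i _ ->; exists i.
have : separable_poly (char_poly L).
  rewrite cL -(big_map (mu_hat mu) xpredT (fun y => 'X - y%:P)) separable_prod_XsubC.
  by rewrite map_inj_uniq ?index_enum_uniq //; apply: mu_hat_inj.
rewrite cLS separable_mul => /and3P[sepS _ cop].
have [P Pu [d SP [d_inj dr]]] := diagonalize_separable sepS.
have /choice[kappa hk] : forall k, exists i, d k = mu_hat mu i.
  by move=> k; apply: rootL; rewrite cLS rootM dr.
exists P => //; exists kappa.
  by rewrite SP; congr (_ *m diag_mx _); apply/rowP => j; rewrite !mxE hk.
move=> a b /= /pair_indexP[kab|kab]; first by apply: d_inj; rewrite !hk kab.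
(* If d b = (d a)^-1, an eigenvector v of S for d a yields the eigenvector H v of S' for d b, which
   would be a common root of two coprime characteristic polynomials. *)
have := coprimep_root cop (dr b); rewrite -rootE -eigenvalue_root_char => /negP[].
have dab : d b = (d a)^-1 by rewrite !hk.
have da0 : d a != 0 by rewrite hk mu_hat_neq0.
(* [eigenvalue] refers to row vectors, whereas S' H S = H is applied to columns; hence the
   transposes. *)
have /eigenvalueP[v Sv v0] : eigenvalue S^T (d a).
  rewrite eigenvalue_root_char; have -> : char_poly S^T = char_poly S; last exact: dr.
  by rewrite /char_poly -det_tr; congr (\det _); rewrite /char_poly_mx linearB /= tr_scalar_mx -map_trmx trmxK.
have Sv' : S *m v^T = d a *: v^T.
  by rewrite -[S]trmxK -trmx_mul Sv linearZ.
have S'v : S' *m (H *m v^T) = (d a)^-1 *: (H *m v^T).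
  apply: (scalerI da0); rewrite scalerA divff // scale1r.
  by rewrite -[in RHS]S'S -!mulmxA Sv' -!scalemxAr.
rewrite dab eigenvalue_root_char.
have -> : char_poly S' = char_poly S'^T.
  by rewrite /char_poly -[in RHS]det_tr; congr (\det _); rewrite /char_poly_mx linearB /= tr_scalar_mx -map_trmx trmxK.
rewrite -eigenvalue_root_char; apply/eigenvalueP; exists (H *m v^T)^T.
  by rewrite -trmx_mul S'v linearZ.
apply: contra v0 => /eqP e; apply/eqP.
by rewrite -[v]trmxK -[v^T](mulKmx Hu) -[H *m _]trmxK e trmx0 mulmx0 trmx0.
Qed.

Lemma spectrum_diagonalizable (L : 'M[R[i]]_(p + p)) :
  char_poly L = \prod_(i < p + p) ('X - (mu_hat mu i)%:P) ->
  exists2 T : 'M[R[i]]_(p + p), T \in unitmx & exists kappa : 'I_(p + p) -> 'I_(p + p),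
    L *m T = T *m diag_mx (\row_j mu_hat mu (kappa j)).
Proof.
move=> cL.
have : separable_poly (char_poly L).
  rewrite cL -(big_map (mu_hat mu) xpredT (fun y => 'X - y%:P)) separable_prod_XsubC.
  by rewrite map_inj_uniq ?index_enum_uniq //; apply: mu_hat_inj.
move=> /diagonalize_separable[T Tu [d LT [_ dr]]]; exists T => //.
have /choice[kappa hk] : forall j, exists i, d j = mu_hat mu i.
  move=> j; have := dr j.
  rewrite cL -(big_map (mu_hat mu) xpredT (fun y => 'X - y%:P)) root_prod_XsubC.
  by case/mapP => i _ ->; exists i.
by exists kappa; rewrite LT; congr (_ *m diag_mx _); apply/rowP => j; rewrite !mxE hk.
Qed.

End Spectrum.
Arguments pair_index {p}.
Arguments pair_sign {p}.

(** * Divisors for one eigenvalue out of each pair *)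

Section SmallDivisors.
Variables (R : realType) (p : nat) (mu : 'I_p -> R[i]).
Local Notation nc := (@Normc.normc R).
Hypothesis mu_neq0 : forall j, mu j != 0.
Hypothesis mu_nonres : nonresonant mu.

Lemma resonant_monomial Q : @resonant_ideal R p (fmonom midm Q) ->
  exists j, (0 < Q (lshift p j))%N /\ (0 < Q (rshift p j))%N.
Proof.
case=> c cE; apply: contrapT => noj.
have : (fmonom (@midm R (p + p)) Q) Q = 1 by rewrite fmonom_midm eqxx.
rewrite cE; have -> : \big[@fadd R (p + p)/fzero]_(i < p)
    fmul (c i) (fmul (fvar (lshift p i)) (fvar (rshift p i))) =
  \sum_(i < p) c i * (fvar (lshift p i) * fvar (rshift p i)) by [].
rewrite fcoef_sum big1 => [/esym/eqP|k _]; first by rewrite oner_eq0.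
have [Ql|Ql] := posnP (Q (lshift p k)).
  by rewrite mulrCA fcoefVM0.
have [Qr|Qr] := posnP (Q (rshift p k)).
  by rewrite mulrA mulrC fcoefVM0.
by case: noj; exists k.
Qed.

Section Family.
Variable kappa : 'I_p -> 'I_(p + p).
Hypothesis kappa_inj : injective (pair_index \o kappa).
Let lam k := mu_hat mu (kappa k).

(** An equality would be a relation between the mu_l. As each pair is hit by one variable only,
    nonresonance concentrates Q on the variable belonging to the pair of j, with exponent at most
    1. *)
Lemma nonresonant_divisor Q j : (2 <= mdeg Q)%N -> mpow lam Q != mu_hat mu j.
Proof.
move=> Q2; apply/eqP => e; pose b := pair_index \o kappa.
pose q : {ffun 'I_p -> int} := [ffun l => \sum_(k | b k == l) pair_sign (kappa k) * (Q k)%:Z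
  - (if l == pair_index j then pair_sign j else 0)].
have eb k : \sum_(k' | b k' == b k) pair_sign (kappa k') * (Q k')%:Z =
    pair_sign (kappa k) * (Q k)%:Z.
  by rewrite (eq_bigl (pred1 k)) ?big_pred1_eq // => k'; rewrite (inj_eq kappa_inj).
have eq1 : \prod_l mu l ^ q l = 1.
  transitivity ((\prod_l \prod_(k | b k == l) mu l ^ (pair_sign (kappa k) * (Q k)%:Z)) *
     (\prod_l mu l ^ (if l == pair_index j then pair_sign j else 0))^-1).
    rewrite -prodfV -big_split; apply: eq_bigr => l _ /=.
    rewrite ffunE expfzDr // invr_expz; congr (_ * _).
    apply: (big_morph (fun z => mu l ^ z)) => [x y|//]; exact: expfzDr.
  have -> : \prod_l mu l ^ (if l == pair_index j then pair_sign j else 0) = mu_hat mu j.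
    rewrite (bigD1 (pair_index j)) //= eqxx big1 ?mulr1 ?mu_hatE // => l /negbTE -> //.
  rewrite -e; have -> : \prod_l \prod_(k | b k == l) mu l ^ (pair_sign (kappa k) * (Q k)%:Z) =
      mpow lam Q.
    rewrite /mpow (exchange_big_dep xpredT) //=; apply: eq_bigr => k _.
    rewrite (big_pred1 (b k)) => [|l]; last by rewrite /= eq_sym.
    by rewrite /lam mu_hatE exprnP exprz_exp.
  by rewrite divff // e mu_hat_neq0.
have q0 l : q l = 0.
  suff -> : q = 0 by rewrite ffunE.
  by apply/eqP; apply: contraT => /mu_nonres; rewrite eq1 eqxx.
have Q1 k : b k != pair_index j -> Q k = 0%N.
  move=> /negbTE bk; have := q0 (b k); rewrite ffunE bk subr0 eb => /eqP.
  by rewrite mulf_eq0 (negbTE (pair_sign_neq0 _)) => /eqP [].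
have [k Qk] : exists k, (0 < Q k)%N by apply: mindex_neq0; rewrite -mdeg_gt0; lia.
have bk : b k = pair_index j by apply: contraTeq Qk => /Q1 ->.
have : (Q k <= 1)%N.
  have := q0 (b k); rewrite ffunE eb bk eqxx /pair_sign.
  by case: fintype.split => _; case: fintype.split => _; lia.
move: Q2; rewrite /mdeg (bigD1 k) //= big1 ?addn0 => [|k' k'k]; first lia.
by apply: Q1; rewrite -bk (inj_eq kappa_inj).
Qed.

(** The exponent Q rewritten in the 2p variables (xi, eta). It uses at most one variable of each
    pair, so the monomial lies outside the resonant ideal and its divisors are among those of
    [omega]. *)
Let push (Q : mindex p) : mindex (p + p) := [ffun i => \sum_(k | kappa k == i) Q k]%N.

Let mdeg_push Q : mdeg (push Q) = mdeg Q.
Proof.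
rewrite /mdeg; under eq_bigr => i _ do rewrite ffunE.
rewrite (exchange_big_dep xpredT) //=; apply: eq_bigr => k _.
by rewrite (big_pred1 (kappa k)) => [//|l]; rewrite /= eq_sym.
Qed.

Let mpow_push Q : \prod_(i < p + p) mu_hat mu i ^+ push Q i = mpow lam Q.
Proof.
transitivity (\prod_(i < p + p) \prod_(k | kappa k == i) mu_hat mu i ^+ Q k).
  by apply: eq_bigr => i _; rewrite ffunE expr_sum.
rewrite (exchange_big_dep xpredT) //=; apply: eq_bigr => k _.
by rewrite (big_pred1 (kappa k)) => [//|l]; rewrite /= eq_sym.
Qed.

Let push_nonresonant Q : ~ @resonant_ideal R p (fmonom midm (push Q)).
Proof.
move=> /resonant_monomial[j []]; rewrite !ffunE => hl hr.
have ex i : (0 < \sum_(k | kappa k == i) Q k)%N -> exists k, kappa k = i.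
  apply: contraPP => /forallNP h; rewrite big1 // => k /eqP ki.
  by case: (h k).
have [k kl] := ex _ hl; have [k' kr] := ex _ hr.
have kk : k = k'.
  by apply: kappa_inj; rewrite /= kl kr /pair_index (unsplitK (inl j)) (unsplitK (inr j)).
by move: kr; rewrite -kk kl => /eqP; rewrite eq_lrshift.
Qed.

Let omset k : set R := [set x | exists (Q : mindex (p + p)) (j : 'I_(p + p)),
    [/\ (2 <= mdeg Q <= 2 ^ k)%N,
        ~ resonant_ideal (fmonom (@midm R (p + p)) Q),
        x = Normc.normc (\prod_(i < p + p) mu_hat mu i ^+ Q i - mu_hat mu j) &
        x != 0]]%classic.

Let omset_lb k : lbound (omset k) 0.
Proof. by move=> x [Q [j [_ _ -> _]]]; apply: nc_ge0. Qed.

Lemma omega_le k Q j : (2 <= mdeg Q <= 2 ^ k)%N ->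
  omega mu k <= nc (mpow lam Q - mu_hat mu j).
Proof.
move=> Qk; apply: ge_inf; first by exists 0; apply: omset_lb.
exists (push Q), j; split; rewrite ?mdeg_push ?mpow_push //.
rewrite nc_eq0 subr_eq0; apply: nonresonant_divisor.
by case/andP: Qk.
Qed.

Hypothesis p_gt0 : (0 < p)%N.

(** The square of the first variable supplies an element. For an empty set [inf] would take the
    default value 0 and positivity would be lost. *)
Let omset_neq0 k : (1 <= k)%N -> (omset k !=set0)%classic.
Proof.
move=> k1; pose i0 : 'I_p := Ordinal p_gt0; pose Q := munit i0 + munit i0.
have Q2 : mdeg Q = 2%N by rewrite mdegD mdeg_unit.
exists (nc (mpow lam Q - mu_hat mu (lshift p i0))), (push Q), (lshift p i0).
split; rewrite ?mdeg_push ?mpow_push ?Q2 //.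
  by rewrite /= -{1}[2%N]expn1 leq_exp2l.
by rewrite nc_eq0 subr_eq0; apply: nonresonant_divisor; rewrite Q2.
Qed.

Lemma omega_gt0 k : (1 <= k)%N -> 0 < omega mu k.
Proof.
move=> k1; pose f (Q : mindex (p + p)) j :=
  nc (\prod_(i < p + p) mu_hat mu i ^+ Q i - mu_hat mu j).
(* Finitely many Q have degree at most 2^k, so the infimum is bounded below by this minimum, in
   which zero values are replaced by 1. *)
pose c := \big[Num.min/1]_(Q <- mlist (p + p) (2 ^ k))
  \big[Num.min/1]_(j < p + p) (if f Q j == 0 then 1 else f Q j).
have c0 : 0 < c.
  rewrite /c; elim/big_ind: _ => // [x y x0 y0|Q _]; first by rewrite lt_min x0.
  elim/big_ind: _ => // [x y x0 y0|j _]; first by rewrite lt_min x0.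
  by case: ifP => // /negbT f0; rewrite lt0r f0 nc_ge0.
apply: (lt_le_trans c0); apply: lb_le_inf; first exact: omset_neq0.
move=> x [Q [j [/andP[_ Qk] _ xE x0]]].
have QL : Q \in mlist (p + p) (2 ^ k) by rewrite mem_mlist.
rewrite /c; apply: (@bigmin_inf_seq _ R _ (mlist (p + p) (2 ^ k)) 1 Q xpredT) => //; apply: (bigmin_inf j) => //.
by rewrite /f -xE (negbTE x0).
Qed.

Lemma omega_nonincreasing k : (1 <= k)%N -> omega mu k.+1 <= omega mu k.
Proof.
move=> k1; apply: lb_le_inf; first exact: omset_neq0.
move=> x [Q [j [/andP[Q2 Qk] ? ? ?]]]; apply: ge_inf; first by exists 0; apply: omset_lb.
exists Q, j; split=> //; rewrite Q2 (leq_trans Qk) // leq_exp2l //.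
Qed.

(* The terms being bounded above by a geometric series, unbounded partial sums
   would make the series converge to -oo. *)
Lemma bruno_partial_sums : bruno mu ->
  exists C, forall K, \sum_(1 <= k < K) (- ln (omega mu k)) / 2 ^+ k <= C.
Proof.
move=> br; apply: contrapT => /forallNP unb.
pose T K := \sum_(1 <= k < K) ln (omega mu k) / 2 ^+ k.
have TN K : \sum_(1 <= k < K) (- ln (omega mu k)) / 2 ^+ k = - T K.
  by rewrite /T -sumrN; apply: eq_bigr => k _; rewrite mulNr.
pose a := `|ln (omega mu 1)|.
have om1 k : (1 <= k)%N -> ln (omega mu k) <= a.
  move=> k1; apply: le_trans (ler_norm _); rewrite ler_ln ?posrE ?omega_gt0 //.
  elim: k k1 => // -[//|k] IH _; apply: le_trans (omega_nonincreasing _) (IH _) => //.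
have Tle K d : (1 <= K)%N -> T (K + d)%N <= T K + a * (1 - 1 / 2 ^+ d).
  move=> K1; elim: d => [|d IH]; first by rewrite addn0 expr0 divr1 subrr mulr0 addr0.
  rewrite addnS /T big_nat_recr ?(leq_trans K1) ?leq_addr //=.
  have h : ln (omega mu (K + d)) / 2 ^+ (K + d) <= a / 2 ^+ d.+1.
    apply: (@le_trans _ _ (a / 2 ^+ (K + d))).
      by rewrite ler_wpM2r ?invr_ge0 ?exprn_ge0 // om1 // (leq_trans K1) ?leq_addr.
    rewrite ler_wpM2l ?normr_ge0 // lef_pV2 ?posrE ?exprn_gt0 // ler_weXn2l ?ler1n //; lia.
  apply: (le_trans (lerD IH h)); rewrite -addrA lerD2l exprS.
  have p0 : (2 ^+ d : R) != 0 by rewrite expf_neq0.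
  by rewrite le_eqVlt; apply/orP; left; apply/eqP; field.
move: br; rewrite /bruno.
rewrite (_ : limn _ = -oo%E) //; apply: cvg_lim => //; apply/cvgeNyPle => A.
have [K hK] : exists K, a - A < - T K.
  by have /existsNP[K /negP] := unb (a - A); rewrite -ltNge TN; exists K.
(* [Tle] needs a starting index at least 1; for K = 0 one starts from 1, both partial sums being
   empty. *)
have [K0|K1] := posnP K.
  exists 1%N => // k /= k1; rewrite sumEFin lee_fin -/(T k).
  have := Tle 1%N (k - 1)%N isT; rewrite subnKC //; move: hK; rewrite K0.
  have -> : T 0%N = 0 by rewrite /T big_geq.
  have -> : T 1%N = 0 by rewrite /T big_geq.
  rewrite add0r oppr0 => hA hT.
  have : a * (1 - 1 / 2 ^+ (k - 1)) <= a.
    by rewrite ler_piMr ?normr_ge0 // gerBl divr_ge0 ?exprn_ge0.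
  by lra.
exists K => // k /= Kk; rewrite sumEFin lee_fin -/(T k).
have := Tle K (k - K)%N K1; rewrite subnKC // => hT.
have : a * (1 - 1 / 2 ^+ (k - K)) <= a.
  by rewrite ler_piMr ?normr_ge0 // gerBl divr_ge0 ?exprn_ge0.
by lra.
Qed.

Lemma small_divisor_weight : bruno mu -> exists (w : mindex p -> R) (B : R),
  [/\ 0 < B, forall P, 0 < w P, w 0 = 1, forall P, w P <= B ^+ mdeg P &
   (forall P S, w P * w S <= w (P + S)) /\
   (forall P S j, P != 0 -> S != 0 ->
     w P * w S <= nc (mpow lam (P + S) - mu_hat mu j) * w (P + S))].
Proof.
move=> /bruno_partial_sums[C hC].
have [|||||||w [B [B0 w0 w1 wB [wM wD]]]] := @bruno_weight R p (p + p) lam (mu_hat mu) (omega mu) C.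
- exact: omega_gt0.
- exact: omega_nonincreasing.
- by move=> k Q j _ Qk; apply: omega_le.
- by move=> k; apply: mu_hat_neq0.
- by move=> k; apply: mu_hat_neq0.
- by move=> k; exists (kappa k).
- by [].
exists w, B; split=> //; split=> // P S j P0 S0; apply: wD => //.
rewrite nc_eq0 subr_eq0; apply: nonresonant_divisor.
by rewrite mdegD; move: P0 S0; rewrite -!mdeg_gt0; lia.
Qed.

End Family.
End SmallDivisors.

(** * Deck transformations *)

Section Deck.
Variables (R : realType) (p : nat) (c : 'I_p -> R[i]) (pr : 'I_p -> 'I_p).
Hypothesis c0 : forall j, c j != 0.
Hypothesis pr_inj : injective pr.
Variable E : fpsmap R (p + p) p.
Hypothesis EQ : forall j Q, (mdeg Q <= 2)%N -> E j Q = quad c pr j Q.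

Definition zvar : fpsmap R (p + p) p := fun j => fvar (lshift p j).
Definition wvar : fpsmap R (p + p) p := fun j => fvar (rshift p j).

Lemma mpair_split T (a : 'I_(p + p) -> T) : mpair (mfst a) (msnd a) = a.
Proof.
apply: funext => i; rewrite /mpair /mfst /msnd; have := splitK i.
by case: (fintype.split i) => k <-.
Qed.

Lemma mfst_mpair T (a b : 'I_p -> T) : mfst (mpair a b) = a.
Proof. by apply: funext => j; rewrite /mfst mpair_lshift. Qed.

Lemma msnd_mpair T (a b : 'I_p -> T) : msnd (mpair a b) = b.
Proof. by apply: funext => j; rewrite /msnd mpair_rshift. Qed.

Lemma mpair_zw : mpair zvar wvar = midm.
Proof. exact: (mpair_split midm). Qed.

Lemma zvar_centered : centered zvar.
Proof. by apply/centeredP => j; apply: ford_var. Qed.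

Lemma wvar_centered : centered wvar.
Proof. by apply/centeredP => j; apply: ford_var. Qed.

Lemma mcomp_mpair n k (a b : fpsmap R n p) (h : fpsmap R k n) :
  mcomp (mpair a b) h = mpair (mcomp a h) (mcomp b h).
Proof. by apply: funext => i; rewrite /mcomp /mpair; case: fintype.split. Qed.

Lemma mcomp_zvar n (a b : fpsmap R n p) : centered a -> centered b ->
  mcomp zvar (mpair a b) = a.
Proof.
move=> ac bc; apply: funext => j; rewrite /mcomp fcomp_var ?mpair_lshift //.
exact: mpair_centered.
Qed.

Lemma ford2_E j : ford 2 (E j).
Proof.
move=> Q Q2; rewrite EQ ?(ltnW Q2) //.
by apply: (@fordX _ _ 1 2) => //; apply: (qform_centered c pr j zvar_centered wvar_centered).
Qed.

Lemma E_centered : centered E.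
Proof. by apply/centeredP => j; apply: fordW (ford2_E j). Qed.

Lemma pi1_mpair : pi1 E = mpair zvar E. Proof. by []. Qed.

(** Deck transformations without the inverse: words in the generators are covered without having to
    invert them. *)
Definition fiber_map (F : fpsmap R (p + p) (p + p)) :=
  [/\ mconvergent F, centered F & mcomp (pi1 E) F = pi1 E].

Lemma deck_fiber_map F : deck E F -> fiber_map F.
Proof. by case=> -[Fv Fc _]. Qed.

Lemma fiber_map_midm : fiber_map midm.
Proof.
split; [exact: mconvergent_midm|exact: midm_centered|exact: mcomp_idr].
Qed.

Lemma fiber_map_mcomp F G : fiber_map F -> fiber_map G -> fiber_map (mcomp F G).
Proof.
move=> [Fv Fc FE] [Gv Gc GE]; split.
- exact: mconvergent_mcomp.
- exact: mcomp_centered.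
- by rewrite -mcompA // FE.
Qed.

Lemma fiber_map_fst F : fiber_map F -> mfst F = zvar.
Proof.
case=> Fv Fc; rewrite pi1_mpair mcomp_mpair => FE.
have := congr1 (@mfst _ p p) FE; rewrite !mfst_mpair => <-.
by apply: funext => j; rewrite /mcomp fcomp_var.
Qed.

Lemma fiber_map_E F j : fiber_map F -> fcomp (E j) F = E j.
Proof.
case=> Fv Fc; rewrite pi1_mpair mcomp_mpair => FE.
by have := congr1 (@msnd _ p p) FE; rewrite !msnd_mpair => /(congr1 (fun f => f j)).
Qed.

Lemma fiber_map_mpair F : fiber_map F -> F = mpair zvar (msnd F).
Proof. by move=> dF; rewrite -{1}[F]mpair_split (fiber_map_fst dF). Qed.

Definition qrow j : 'rV[R[i]]_(p + p) := \row_i qform c pr zvar wvar j (munit i).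

Lemma qrowE j i : qrow j ord0 i = qform c pr zvar wvar j (munit i).
Proof. by rewrite mxE. Qed.

Lemma qrow_lshift j k : qrow j ord0 (lshift p k) = (k == j)%:R.
Proof.
rewrite qrowE /qform fcoefD fcoefCM /zvar /wvar /fvar !(inj_eq (@munit_inj _)).
by rewrite eq_lrshift mulr0 addr0 (inj_eq (@lshift_inj _ _)); case: eqP.
Qed.

Lemma qrow_neq0 j : qrow j != 0.
Proof.
apply/eqP => /rowP/(_ (lshift p j)); rewrite qrow_lshift eqxx mxE.
by move/eqP; rewrite oner_eq0.
Qed.

Lemma qform_jac n (u f : fpsmap R n p) j i : centered u -> centered f ->
  qform c pr u f j (munit i) = (qrow j *m jac (mpair u f)) ord0 i.
Proof.
move=> uc fc; have mc := mpair_centered uc fc.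
have -> : qform c pr u f j = fcomp (qform c pr zvar wvar j) (mpair u f).
  rewrite /qform fcompD // fcompM // fcomp_const // !fcomp_var //.
  by rewrite mpair_lshift mpair_rshift.
by rewrite fcomp_unit // mxE; apply: eq_bigr => k _; rewrite !mxE.
Qed.

Definition signs F (eps : 'I_p -> bool) :=
  forall j, qrow j *m jac F = (-1) ^+ eps j *: qrow j.

Lemma signs_exist F : fiber_map F -> exists eps : {ffun 'I_p -> bool}, signs F eps.
Proof.
move=> dF; have [Fv Fc _] := dF; have eF := fiber_map_mpair dF.
have sc : centered (msnd F) by move=> j; rewrite /msnd Fc.
have /choice[eps he] : forall j, exists b : bool, qrow j *m jac F = (-1) ^+ b *: qrow j.
  move=> j; have EF : fcomp (E j) (mpair zvar (msnd F)) = fcomp (E j) (mpair zvar wvar).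
    by rewrite -eF fiber_map_E // mpair_zw fcomp_midm.
  have [h|h] := quad_sign EQ zvar_centered sc wvar_centered EF; [exists false|exists true].
    by apply/rowP => i; rewrite expr0 scale1r qrowE -h (qform_jac _ _ zvar_centered sc) -eF.
  by apply/rowP => i; rewrite expr1 [RHS]mxE qrowE mulN1r -h (qform_jac _ _ zvar_centered sc) -eF.
by exists [ffun j => eps j] => j; rewrite ffunE.
Qed.

Lemma signs_midm : signs midm (fun=> false).
Proof. by move=> j; rewrite jac_midm mulmx1 expr0 scale1r. Qed.

Lemma signs_mcomp F G e e' : centered G -> signs F e -> signs G e' ->
  signs (mcomp F G) (fun j => e j (+) e' j).
Proof.
move=> Gc Fe Ge j; rewrite jac_mcomp // mulmxA Fe -scalemxAl Ge scalerA.
by rewrite signr_addb.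
Qed.

Lemma signs_inj F e e' : signs F e -> signs F e' -> e =1 e'.
Proof.
move=> Fe Fe' j; have := Fe j; rewrite Fe' => /eqP; rewrite -subr_eq0 -scalerBl scaler_eq0.
rewrite (negbTE (qrow_neq0 j)) orbF subr_eq0.
have m1 : -1 != 1 :> R[i] by rewrite eq_sym -addr_eq0 -mulr2n pnatr_eq0.
by case: (e j); case: (e' j); rewrite ?expr0 ?expr1 // ?(eq_sym 1) (negbTE m1).
Qed.

Lemma signs_unique F G e : fiber_map F -> fiber_map G -> signs F e -> signs G e -> F = G.
Proof.
move=> dF dG Fe Ge; have [Fv Fc _] := dF; have [Gv Gc _] := dG.
have eF := fiber_map_mpair dF; have eG := fiber_map_mpair dG.
have Fs : centered (msnd F) by move=> j; rewrite /msnd Fc.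
have Gs : centered (msnd G) by move=> j; rewrite /msnd Gc.
rewrite eF eG; congr mpair.
apply: (quad_unique c0 pr_inj EQ zvar_centered Fs Gs) => [j|j i|j].
- by rewrite -eF -eG !fiber_map_E.
- by rewrite (qform_jac _ _ zvar_centered Fs) (qform_jac _ _ zvar_centered Gs) -eF -eG Fe Ge.
- exists (lshift p j); rewrite (qform_jac _ _ zvar_centered Fs) -eF Fe mxE qrow_lshift eqxx.
  by rewrite mulr1 signr_eq0.
Qed.

(** Two negative signs would make two independent linear forms vanish on the tangent space of the
    fixed hypersurface, and 2 + (2p - 1) > 2p. *)
Lemma fixes_hypersurface_signs F e j k : centered F -> fixes_hypersurface F ->
  signs F e -> e j -> e k -> j = k.
Proof.
move=> Fc [phi [phiv phic phir Fphi]] Fe ej ek; apply/eqP; apply: contraT => jk.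
have kill l : e l -> qrow l *m jac phi = 0.
  move=> el; have : qrow l *m jac phi = - (qrow l *m jac phi).
    by rewrite -{1}Fphi jac_mcomp // mulmxA Fe el expr1 scaleN1r mulNmx.
  move/eqP; rewrite -addr_eq0 -mulr2n -scaler_nat scaler_eq0 pnatr_eq0 /=.
  by move/eqP.
pose M := col_mx (qrow j) (qrow k).
pose N : 'M[R[i]]_(p + p, 1 + 1) :=
  row_mx (delta_mx (lshift p j) ord0) (delta_mx (lshift p k) ord0).
have MN : M *m N = 1%:M.
  have d l l' : qrow l *m (delta_mx (lshift p l') ord0 : 'cV_(p + p)) = (l' == l)%:R%:M.
    apply/matrixP => a b; rewrite !ord1 mxE (bigD1 (lshift p l')) //= big1.
      by rewrite !mxE !eqxx mulr1 addr0 -qrowE qrow_lshift mulr1n.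
    by move=> m /negbTE ml; rewrite !mxE ml mulr0.
  rewrite mul_col_row !d !eqxx (negbTE jk) eq_sym (negbTE jk).
  by rewrite !raddf0 mulr1n -scalar_mx_block.
have Mf : row_free M by apply/row_freeP; exists N.
have : M *m jac phi = 0 by rewrite mul_col_mx !kill // col_mx0.
move/mulmx0_rank_max; rewrite phir (eqP Mf).
have : (0 < p)%N by apply: leq_ltn_trans (ltn_ord j).
by lia.
Qed.

Variable tau : 'I_p -> fpsmap R (p + p) (p + p).
Hypothesis maxE : max_deck E.
Hypothesis tau_gen : deck_generators E tau.

(** The sign vector is injective on deck transformations by [signs_unique]; having 2^p of them, it
    is onto. *)
Lemma all_signs (e : {ffun 'I_p -> bool}) : exists2 F, deck E F & signs F e.
Proof.
have /card_bijP[f [g _ fK]] := maxE.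
pose mk (k : 'I_(2 ^ p)) : `I_(2 ^ p)%classic :=
  exist (fun x => x \in `I_(2 ^ p)%classic) (val k) (mem_set (ltn_ord k)).
have dg k : deck E (val (g (mk k))) by apply/set_mem/valP.
have /choice[sg hsg] : forall k, exists eps : {ffun 'I_p -> bool}, signs (val (g (mk k))) eps.
  by move=> k; apply/signs_exist/deck_fiber_map.
have sg_inj : injective sg.
  move=> k k' kk; have := hsg k'; rewrite -kk => hk'.
  have /val_inj/(congr1 f) := signs_unique (deck_fiber_map (dg k)) (deck_fiber_map (dg k')) (hsg k) hk'.
  by rewrite !fK => /(congr1 val) /= /val_inj.
have /codomP[k ->] : e \in codom sg.
  by rewrite (inj_card_onto sg_inj) // card_ffun card_bool !card_ord.
by exists (val (g (mk k))).
Qed.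

Lemma mprod_signs (eps : 'I_p -> 'I_p -> bool) : (forall i, signs (tau i) (eps i)) ->
  forall w, fiber_map (mprod tau w) /\
    signs (mprod tau w) (fun j => \big[addb/false]_(i <- w) eps i j).
Proof.
move=> he; have dt i : fiber_map (tau i).
  by apply: deck_fiber_map; have [/(_ i)[]] := tau_gen.
elim=> [|i w [IHd IHs]].
  split; first exact: fiber_map_midm.
  move=> j; rewrite big_nil; exact: signs_midm.
split; first exact: fiber_map_mcomp.
move=> j; rewrite big_cons; have [_ mc _] := IHd.
exact: (signs_mcomp mc (he i) IHs).
Qed.

(* Each generator changes at most one sign, and the generators produce all
   sign vectors: they are in bijection with the coordinates. *)
Lemma tau1_signs : fiber_map (tau1 tau) /\ signs (tau1 tau) (fun=> true).
Proof.
have dt i : deck E (tau i) by have [/(_ i)[]] := tau_gen.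
have /choice[eps he] : forall i, exists e : {ffun 'I_p -> bool}, signs (tau i) e.
  by move=> i; apply/signs_exist/deck_fiber_map.
have e1 i j k : eps i j -> eps i k -> j = k.
  have [_ tc _] := deck_fiber_map (dt i).
  by apply: fixes_hypersurface_signs (tc) _ (he i); have [/(_ i)[]] := tau_gen.
(* The transformation that changes the sign j alone is a word in the generators, so some letter
   changes the sign j. *)
have /choice[g hg] : forall j, exists i, eps i j.
  move=> j; have [F dF Fs] := all_signs [ffun k => k == j].
  have [w Fw] := (tau_gen.2 F dF).
  have [_ ws] := @mprod_signs (fun i => eps i) he w.
  rewrite -Fw in ws; have := signs_inj ws Fs j; rewrite ffunE eqxx => sw.
  apply: contrapT => noi; move: sw; rewrite big1 // => i _.
  by apply/negbTE/negP => ij; case: noi; exists i.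
have g_inj : injective g by move=> j k jk; apply: (e1 (g j)); rewrite // jk.
have [td ts] := @mprod_signs (fun i => eps i) he (enum 'I_p).
(* Among all generators only [g j] changes the sign j, and [enum 'I_p] contains it once. *)
split=> // j; have := ts j; rewrite big_enum /= (bigD1 (g j)) //= hg big1 //.
move=> i ij; apply/negbTE/negP => eij.
have /codomP[k ik] : i \in codom g by rewrite (inj_card_onto g_inj).
by move: eij ij; rewrite ik => /(e1 _ _ _ (hg k)) ->; rewrite eqxx.
Qed.

End Deck.

(** * Conjugated series and the involution rho_0 *)

Section Conjugation.
Variable R : realType.
Local Notation nc := (@Normc.normc R).
Local Notation conjc := (@Num.conj_op R[i]).

Definition mconj n m (g : fpsmap R n m) : fpsmap R n m := fun i => fconj (g i).

Lemma fconjM n (a b : fps R n) : fconj (a * b) = fconj a * fconj b.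
Proof.
apply: fps_ext => Q; rewrite /fconj (fcoefM _ _ (leqnn _)) (fcoefM _ _ (leqnn _)) rmorph_sum.
apply: eq_bigr => P _; rewrite rmorph_sum; apply: eq_bigr => S _.
by case: ifP => _; rewrite ?rmorph0 // rmorphM.
Qed.

Lemma fconj1 n : fconj 1 = 1 :> fps R n.
Proof.
by apply: fps_ext => Q; rewrite /fconj !fcoef1; case: ifP => _; rewrite ?rmorph0 ?rmorph1.
Qed.

Lemma fconj_fmonom n m (g : fpsmap R n m) P : fconj (fmonom g P) = fmonom (mconj g) P.
Proof.
rewrite !fmonomE; elim/big_ind2: _ => [|? ? ? ? <- <-|i _]; first exact: fconj1.
  exact: fconjM.
by elim: (P i) => [|d IH]; rewrite ?expr0 ?fconj1 // !exprS fconjM IH.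
Qed.

Lemma mconj_centered n m (g : fpsmap R n m) : centered g -> centered (mconj g).
Proof. by move=> gc i; rewrite /mconj /fconj gc rmorph0. Qed.

Lemma fconj_fcomp n m (a : fps R m) (g : fpsmap R n m) : centered g ->
  fconj (fcomp a g) = fcomp (fconj a) (mconj g).
Proof.
move=> gc; apply: fps_ext => Q; rewrite /fconj (fcompE _ gc (leqnn _)).
rewrite (fcompE _ (mconj_centered gc) (leqnn _)) rmorph_sum; apply: eq_bigr => P _.
by rewrite rmorphM -fconj_fmonom.
Qed.

Lemma mconj_mcomp n m k (f : fpsmap R m k) (g : fpsmap R n m) : centered g ->
  mconj (mcomp f g) = mcomp (mconj f) (mconj g).
Proof. by move=> gc; apply: funext => i; apply: fconj_fcomp. Qed.

Lemma mconjK n m (g : fpsmap R n m) : mconj (mconj g) = g.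
Proof. by apply: funext => i; apply: fps_ext => Q; rewrite /mconj /fconj conjCK. Qed.

Lemma jac_mconj n m (g : fpsmap R n m) : jac (mconj g) = map_mx conjc (jac g).
Proof. by apply/matrixP => i j; rewrite !mxE. Qed.

Variable p : nat.

Lemma mswapK : involutive (@mswap p).
Proof.
move=> Q; apply/ffunP => i; rewrite /mswap ffunE /mpair /msnd /mfst.
have := splitK i; case: (fintype.split i) => k <-; rewrite ffunE /mpair.
  by rewrite (unsplitK (inr k)).
by rewrite (unsplitK (inl k)).
Qed.

Lemma mdeg_mswap (Q : mindex (p + p)) : mdeg (mswap Q) = mdeg Q.
Proof.
rewrite /mdeg !big_split_ord [RHS](addnC (\sum_(i < p) Q (lshift p i))%N); congr (_ + _)%N; apply: eq_bigr => k _.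
  by rewrite ffunE mpair_lshift.
by rewrite ffunE mpair_rshift.
Qed.

Lemma big_mlist_mswap (V : nmodType) d (F : mindex (p + p) -> V) :
  \sum_(P <- mlist (p + p) d) F (mswap P) = \sum_(P <- mlist (p + p) d) F P.
Proof.
rewrite -(big_map (@mswap p) xpredT F); apply: perm_big; apply: uniq_perm.
- by rewrite map_inj_uniq ?mlist_uniq //; apply: can_inj mswapK.
- exact: mlist_uniq.
move=> P; rewrite mem_mlist; apply/mapP/idP => [[Q + ->]|Pd].
  by rewrite mem_mlist mdeg_mswap.
by exists (mswap P); rewrite ?mem_mlist ?mdeg_mswap ?mswapK.
Qed.

Definition fswap (a : fps R (p + p)) : fps R (p + p) := fun Q => a (mswap Q).

Lemma fmonom_mswap n (a b : fpsmap R n p) P :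
  fmonom (mpair a b) (mswap P) = fmonom (mpair b a) P.
Proof.
rewrite !fmonomE !big_split_ord /= mulrC; congr (_ * _); apply: eq_bigr => k _.
  by rewrite ffunE !mpair_rshift !mpair_lshift.
by rewrite ffunE !mpair_rshift !mpair_lshift.
Qed.

Lemma fcomp_fswap n (f : fps R (p + p)) (a b : fpsmap R n p) :
  centered a -> centered b ->
  fcomp (fswap f) (mpair a b) = fcomp f (mpair b a).
Proof.
move=> ac bc; apply: fps_ext => Q.
rewrite (fcompE _ (mpair_centered ac bc) (leqnn _)).
rewrite (fcompE _ (mpair_centered bc ac) (leqnn _)) -big_mlist_mswap.
by apply: eq_bigr => P _; rewrite /fswap mswapK fmonom_mswap.
Qed.

Lemma rho0_conjE (F : fpsmap R (p + p) (p + p)) :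
  rho0_conj F = mpair (fun j => fconj (fswap (msnd F j))) (fun j => fconj (fswap (mfst F j))).
Proof. by []. Qed.

(** For b = conj a the inner argument is (a, conj a) again: over real parameters these points are
    fixed by rho_0. So the action of tau_2 on N_i is read off from that of tau_1. *)
Lemma rho0_conj_mcomp n (F : fpsmap R (p + p) (p + p)) (a b : fpsmap R n p) :
  centered a -> centered b ->
  mcomp (rho0_conj F) (mpair a b) =
    mpair (mconj (mcomp (msnd F) (mpair (mconj b) (mconj a))))
          (mconj (mcomp (mfst F) (mpair (mconj b) (mconj a)))).
Proof.
move=> ac bc; have ac' := mconj_centered ac; have bc' := mconj_centered bc.
have key (f : fps R (p + p)) : fcomp (fconj (fswap f)) (mpair a b) =
    fconj (fcomp f (mpair (mconj b) (mconj a))).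
  rewrite -[in RHS]fcomp_fswap // fconj_fcomp; last exact: mpair_centered.
  congr fcomp; apply: funext => i; apply: fps_ext => Q.
  by rewrite /mconj /mpair; case: fintype.split => j; rewrite /fconj conjCK.
rewrite rho0_conjE mcomp_mpair; congr mpair; apply: funext => j; exact: key.
Qed.

Lemma rho0_conj_convergent (F : fpsmap R (p + p) (p + p)) :
  mconvergent F -> mconvergent (rho0_conj F).
Proof.
move=> Fv; have key f : fconvergent f -> fconvergent (fconj (fswap f) : fps R (p + p)).
  move=> /fconvergentP[r r0 [C h]]; apply/fconvergentP; exists r => //; exists C => d.
  apply: le_trans (h d); rewrite /nrm -[leRHS]big_mlist_mswap; apply: ler_sum => P _.
  by rewrite /fconj /fswap nc_conj /rpow mdeg_mswap.
move=> i; rewrite rho0_conjE /mpair.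
by case: fintype.split => j; apply: key; apply: Fv.
Qed.

Lemma rho0_conj_centered (F : fpsmap R (p + p) (p + p)) :
  centered F -> centered (rho0_conj F).
Proof.
move=> Fc i; have z : mswap (Defs.mzero (p + p)) = 0.
  by apply/eqP; rewrite -mdeg_eq0 mdeg_mswap mdeg0.
by rewrite rho0_conjE /mpair; case: fintype.split => j; rewrite /fconj /fswap z [X in conjc X]Fc rmorph0.
Qed.

End Conjugation.

(** * Ideals of graphs *)

Section Ideals.
Variables (R : realType) (p : nat).

Lemma idealP n m (f : fpsmap R n m) a :
  ideal f a <-> exists c : fpsmap R n m, a = \sum_i c i * f i.
Proof. by []. Qed.

Lemma ideal_generator n m (f : fpsmap R n m) i : ideal f (f i).
Proof.
apply/idealP; exists (fun j => if j == i then 1 else 0).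
rewrite (bigD1 i) //= eqxx mul1r big1 ?addr0 // => j /negbTE ->.
by rewrite mul0r.
Qed.

Lemma ideal_sub n m k (f : fpsmap R n m) (g : fpsmap R n k) :
  (forall i, ideal f (g i)) -> (ideal g `<=` ideal f)%classic.
Proof.
move=> gf a /idealP[c ->]; have /choice[d dE] : forall i, exists d : fpsmap R n m,
    g i = \sum_j d j * f j by move=> i; have /idealP := gf i.
apply/idealP; exists (fun j => \sum_i c i * d i j).
under [RHS]eq_bigr => j _ do rewrite big_distrl.
rewrite exchange_big; apply: eq_bigr => i _ /=; rewrite dE big_distrr.
by apply: eq_bigr => j _ /=; rewrite mulrA.
Qed.

Local Notation zero_map n m := ((fun=> 0) : fpsmap R n m).

Let zero_centered n m : centered (zero_map n m). Proof. by []. Qed.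
Arguments zero_centered : clear implicits.

Lemma fcomp_restrict (a : fps R (p + p)) (Q : mindex (p + p)) : (forall j, Q (rshift p j) = 0%N) ->
  fcomp a (mpair (@zvar R p) (zero_map _ _)) Q = a Q.
Proof.
move=> Q0; have zc := mpair_centered (@zvar_centered R p) (zero_centered (p + p) p).
rewrite (fcompE _ zc (leqnn _)).
rewrite -(big_mlist_pred1 a (leqnn (mdeg Q))); apply: eq_bigr => P _.
have [P0|/existsNP[j /eqP Pj]] := pselect (forall j, P (rshift p j) = 0%N).
  have -> : fmonom (mpair (@zvar R p) (zero_map _ _)) P = fmonom midm P.
    rewrite !fmonomE !big_split_ord; congr (_ * _); apply: eq_bigr => j _.
      by rewrite mpair_lshift.
    by rewrite P0 !expr0.
  by rewrite fmonom_midm eq_sym; case: eqP => _; rewrite ?mulr1 ?mulr0.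
have -> : (P == Q) = false.
  by apply/negbTE/negP => /eqP PQ; move: Pj; rewrite PQ Q0.
rewrite (_ : fmonom _ _ = 0) ?mulr0 // fmonomE (bigD1 (rshift p j)) //=.
by rewrite mpair_rshift expr0n (negbTE Pj) mul0r.
Qed.

(** The order of the variables matters: [fdiv] divides by the last variable of a monomial and z
    precedes w, so the quotients by z_j see only monomials in z, whose coefficients vanish. *)
Lemma ideal_wvar (a : fps R (p + p)) :
  fcomp a (mpair (@zvar R p) (zero_map _ _)) = 0 ->
  ideal (@wvar R p) a.
Proof.
move=> a0; have az (Q : mindex (p + p)) : (forall j, Q (rshift p j) = 0%N) -> a Q = 0.
  by move=> Q0; rewrite -(fcomp_restrict a Q0) a0.
apply/idealP; exists (fun j => fdiv (rshift p j) a).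
rewrite {1}(fdiv_sum a) az => [|j]; last by rewrite ffunE.
rewrite (_ : fconst 0 = 0); last by apply: fps_ext => Q; rewrite /fconst; case: eqP.
rewrite add0r big_split_ord /= [X in X + _]big1 ?add0r => [|j _].
  by apply: eq_bigr => j _; rewrite mulrC.
suff -> : fdiv (lshift p j) a = 0 by rewrite mulr0.
apply: fps_ext => Q; rewrite /fdiv; case: ifP => // /forallP Q0.
apply: az => k; rewrite mindexDE ffunE eq_rlshift addn0; apply/eqP.
by have /implyP := Q0 (rshift p k); apply; rewrite /= ltn_addr.
Qed.

(* In the coordinates (z, f), the graph w = k(z) becomes w = 0. *)
Lemma graph_ideal (f g : fpsmap R (p + p) p) (k : fpsmap R p p) (B : 'M[R[i]]_p) :
  centered f -> centered k -> jac f *m col_mx 0 1%:M = B -> B \in unitmx ->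
  mcomp f (mpair midm k) = (fun=> 0) -> mcomp g (mpair midm k) = (fun=> 0) ->
  forall j, ideal f (g j).
Proof.
move=> fc kc fB Bu fk gk j; pose Phi := mpair (@zvar R p) f.
have zc := @zvar_centered R p; have Phic : centered Phi by apply: mpair_centered.
have jz : jac (@zvar R p) = row_mx 1%:M 0.
  apply/matrixP => a b; rewrite !mxE /zvar /fvar (inj_eq (@munit_inj _)).
  have := splitK b; case: (fintype.split b) => b' <-; rewrite ?mxE.
    by rewrite /= (inj_eq (@lshift_inj _ _)) eq_sym; case: eqP.
  by rewrite /= eq_rlshift.
have jPhi : jac Phi = block_mx 1%:M 0 (jac f *m col_mx 1%:M 0) B.
  have -> : jac Phi = col_mx (jac (@zvar R p)) (jac f).
    apply/matrixP => a b; rewrite !mxE /Phi /mpair.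
    by case: (fintype.split a) => a'; rewrite mxE.
  rewrite jz /block_mx -fB -mul_mx_row; congr col_mx.
  have -> : row_mx (col_mx 1%:M 0) (col_mx 0 1%:M) = 1%:M :> 'M[R[i]]_(p + p).
    by rewrite -block_mxEh -scalar_mx_block.
  by rewrite mulmx1.
have Phiu : jac Phi \in unitmx.
  by rewrite unitmxE jPhi det_lblock det1 mul1r -unitmxE.
have [Psi [Psic PhiPsi PsiPhi _]] := formal_inverse Phic Phiu.
have mc := @midm_centered R p; have mkc : centered (mpair midm k) by apply: mpair_centered.
have Phik : mcomp Phi (mpair midm k) = mpair midm (zero_map p p).
  by rewrite mcomp_mpair fk mcomp_zvar.
have Psi0 : mcomp Psi (mpair midm (zero_map p p)) = mpair midm k.
  by rewrite -Phik -mcompA // PsiPhi mcomp_idl.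
have h : fcomp (fcomp (g j) Psi) (mpair (@zvar R p) (zero_map _ _)) = 0.
  have z0c : centered (mpair (@zvar R p) (zero_map (p + p) p)) by apply: mpair_centered.
  have -> : mpair (@zvar R p) (zero_map (p + p) p) =
      mcomp (mpair midm (zero_map p p)) (@zvar R p).
    rewrite mcomp_mpair mcomp_idl //; congr mpair.
    by apply: funext => i; rewrite /mcomp fcomp0.
  have m0c : centered (mpair midm (zero_map p p)) by apply: mpair_centered.
  rewrite -fcompA // [fcomp (fcomp (g j) Psi) _]fcompA // Psi0.
  by have /(congr1 (fun u => u j)) := gk; rewrite /mcomp => ->; rewrite fcomp0.
have /idealP[c cE] := ideal_wvar h.
apply/idealP; exists (fun l => fcomp (c l) Phi).
rewrite -[LHS]fcomp_midm -PsiPhi -fcompA // cE fcomp_sum //; apply: eq_bigr => l _.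
by rewrite fcompM // /wvar fcomp_var // [Phi _]mpair_rshift.
Qed.

End Ideals.

(* Otherwise unification unfolds compositions of series. *)
Local Opaque fcomp.

(** * Attached submanifolds *)

(** In the eigenbasis [T] of jac s, the recursion reads (lam^Q - D_j) x_j = (T^-1 N(phi)_Q)_j. The
    changes of basis cost the constant c2 c1, and the weight absorbs the smallest divisor. *)
Lemma conjugacy_convergent (R : realType) n m (s : fpsmap R m m) (phi : fpsmap R n m)
    (lam : 'I_n -> R[i]) (T : 'M[R[i]]_m) (D : 'I_m -> R[i]) (w : mindex n -> R) (B : R) :
  mconvergent s -> centered s -> centered phi ->
  mcomp s phi = mcomp phi (diag_map lam) ->
  T \in unitmx -> jac s *m T = T *m diag_mx (\row_j D j) ->
  0 < B -> (forall P, 0 < w P) -> w 0 = 1 -> (forall P, w P <= B ^+ mdeg P) ->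
  (forall P S, w P * w S <= w (P + S)) ->
  (forall P S j, P != 0 -> S != 0 ->
     w P * w S <= Normc.normc (mpow lam (P + S) - D j) * w (P + S)) ->
  mconvergent phi.
Proof.
move=> sv sc phic sphi Tu sT B0 w0 w1 wB wM wD; pose nc := @Normc.normc R.
(* The cap 1 is harmless in the inequality for the weights, since w P w S <= w (P + S). *)
pose delta Q := \big[Num.min/1]_j nc (mpow lam Q - D j).
pose c1 := \sum_a \sum_b nc (invmx T a b); pose c2 := \sum_a \sum_b nc (T a b).
have entry (M : 'M[R[i]]_m) a b : nc (M a b) <= \sum_a \sum_b nc (M a b).
  rewrite (bigD1 a) //= (bigD1 b) //= -addrA lerDl addr_ge0 //.
    by apply: sumr_ge0 => k _; apply: nc_ge0.
  by apply: sumr_ge0 => k _; apply: sumr_ge0 => l _; apply: nc_ge0.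
have sum_ge0 (M : 'M[R[i]]_m) : 0 <= \sum_a \sum_b nc (M a b).
  by apply: sumr_ge0 => k _; apply: sumr_ge0 => l _; apply: nc_ge0.
have row_le (M : 'M[R[i]]_m) a : \sum_b nc (M a b) <= \sum_a \sum_b nc (M a b).
  rewrite [leRHS](bigD1 a) //= lerDl.
  by apply: sumr_ge0 => k _; apply: sumr_ge0 => l _; apply: nc_ge0.
apply: (@majorant_convergent _ _ _ _ phi (nonlin s) w delta (c2 * c1) B) => //.
- exact: mconvergent_nonlin.
- by move=> i; apply: ford_nonlin.
- by rewrite w1 lexx.
- by apply: mulr_ge0; apply: sum_ge0.
(* Splitting Q as P + e_i, the weight inequality bounds each divisor below by a positive number. *)
- move=> Q Q2; have Q0 : Q != 0 by rewrite -mdeg_gt0 ltnW.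
  have [i Qi] := mindex_neq0 Q0; have [P QP PQ] := munitP Qi.
  have P0 : P != 0 by rewrite -mdeg_gt0; lia.
  rewrite /delta; elim/big_ind: _ => // [x y x0 y0|j _]; first by rewrite lt_min x0.
  have := wD P (munit i) j P0 (munit_neq0 i); rewrite -QP => h.
  have wp : 0 < w P * w (munit i) by rewrite mulr_gt0.
  by have := lt_le_trans wp h; rewrite pmulr_lgt0.
- move=> P S P0 S0; rewrite /delta; elim/big_ind: _ => [|x y hx hy|j _].
  + by rewrite mul1r.
  + by rewrite minEle; case: ifP.
  + exact: wD.
move=> i Q Q2; set y := \sum_l _.
pose x := invmx T *m cvec phi Q; pose v := cvec (mcomp (nonlin s) phi) Q.
have xv : mpow lam Q *: x = diag_mx (\row_j D j) *m x + invmx T *m v.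
  have TD : diag_mx (\row_j D j) *m invmx T = invmx T *m jac s.
    by rewrite -[diag_mx _](mulKmx Tu) -sT mulmxA mulmxK.
  rewrite /x mulmxA TD -mulmxA.
  by rewrite -mulmxDr -cvec_mcomp_nonlin // sphi cvec_diag scalemxAr.
have d0 : 0 <= delta Q.
  rewrite /delta; elim/big_ind: _ => // [a b a0 b0|j _]; last exact: nc_ge0.
  by rewrite le_min a0.
have xj j : delta Q * nc (x j ord0) <= c1 * y.
  have e : (mpow lam Q - D j) * x j ord0 = (invmx T *m v) j ord0.
    have := congr1 (fun M : 'cV[R[i]]_m => M j ord0) xv.
    by rewrite mul_diag_mx !mxE mulrBl => ->; rewrite addrAC subrr add0r.
  apply: (@le_trans _ _ (nc (mpow lam Q - D j) * nc (x j ord0))).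
    by rewrite ler_wpM2r ?nc_ge0 // /delta bigmin_le_cond.
  rewrite /nc -ncM e mxE; apply: (le_trans (nc_sum _ _ _)).
  rewrite /y big_distrr; apply: ler_sum => l _ /=.
  by rewrite ncM !mxE ler_wpM2r ?nc_ge0 // entry.
have -> : phi i Q = (T *m x) i ord0 by rewrite /x mulKVmx // mxE.
rewrite mxE; apply: (le_trans (ler_wpM2l d0 (nc_sum _ _ _))); rewrite big_distrr /=.
have y0 : 0 <= c1 * y.
  by apply: mulr_ge0; [apply: sum_ge0|apply: sumr_ge0 => l _; apply: nc_ge0].
apply: (@le_trans _ _ (\sum_j nc (T i j) * (c1 * y))).
  by apply: ler_sum => j _; rewrite ncM mulrCA ler_wpM2l ?nc_ge0.
by rewrite -big_distrl /= -mulrA ler_wpM2r // row_le.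
Qed.

Section Attached.
Variables (R : realType) (p : nat) (c : 'I_p -> R[i]) (pr : 'I_p -> 'I_p).
Hypothesis c0 : forall j, c j != 0.
Hypothesis pr_inj : injective pr.
Variable E : fpsmap R (p + p) p.
Hypothesis EQ : forall j Q, (mdeg Q <= 2)%N -> E j Q = quad c pr j Q.
Local Notation nc := (@Normc.normc R).
Local Notation conjm := (map_mx (@Num.conj_op R[i])).
Local Notation "A %:CM" := (map_mx (real_complex R) A) (at level 2, format "A %:CM").

Definition pullback n (a : fpsmap R n p) : fpsmap R n (p + p) := mpair a (mconj a).

Lemma pullback_centered n (a : fpsmap R n p) : centered a -> centered (pullback a).
Proof. by move=> ac; apply: mpair_centered => //; apply: mconj_centered. Qed.

Lemma jac_mpair n (a b : fpsmap R n p) : jac (mpair a b) = col_mx (jac a) (jac b).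
Proof.
apply/matrixP => i j; rewrite !mxE /mpair.
by case: (fintype.split i) => k; rewrite mxE.
Qed.

Lemma conj_real n m (u : 'M[R]_(n, m)) : conjm u%:CM = u%:CM.
Proof. by apply/matrixP => i j; rewrite !mxE; apply/eqP; rewrite eq_complex /= oppr0 !eqxx. Qed.

Section Transversal.
Variables (A1 A2 : 'M[R[i]]_p).
Hypothesis spanA : forall w : 'cV[R[i]]_p, exists u v : 'cV[R]_p,
  w = A1 *m u%:CM + A2 *m v%:CM.

(* If the row (l1, l2) kills the matrix, then l1 w + l2 conj(w) = 0 for every
   w; comparing w and iw gives l1 w = l2 w = 0. *)
Lemma transversal_unit : block_mx A1 A2 (conjm A1) (conjm A2) \in unitmx.
Proof.
rewrite -row_free_unit -kermx_eq0; apply/rowV0P => l /sub_kermxP.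
rewrite -[l]hsubmxK mul_row_block => /eqP.
set l1 := lsubmx l; set l2 := rsubmx l.
rewrite -[0]row_mx0 => /eqP/eq_row_mx[e1 e2].
have key (w : 'cV[R[i]]_p) : l1 *m w + l2 *m conjm w = 0.
  have [u [v ->]] := spanA w; rewrite map_mxD !map_mxM !conj_real !mulmxDr.
  rewrite addrACA !mulmxA -!mulmxDl e1 e2 !mul0mx addr0 //.
have key2 (w : 'cV[R[i]]_p) : l1 *m w = 0.
  have ci : ('i%C : R[i])^* = - 'i%C.
    by rewrite (_ : _^* = ('i%C)^*%C) //; apply/eqP; rewrite eq_complex /= oppr0 !eqxx.
  have cz : conjm ('i%C *: w) = - ('i%C *: conjm w).
    by apply/matrixP => a b; rewrite !mxE rmorphM /= ci mulNr.
  have h := key ('i%C *: w); have := key w.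
  rewrite cz mulmxN -!scalemxAr -scalerBr in h; move/eqP: h; rewrite scaler_eq0.
  have i0 : ('i%C == 0 :> R[i]) = false by rewrite eq_complex /= oner_eq0 andbF.
  rewrite i0 /= subr_eq0 => /eqP <- /eqP; rewrite -mulr2n -scaler_nat scaler_eq0 pnatr_eq0 /=.
  by move/eqP.
have zero (l' : 'rV[R[i]]_p) : (forall w : 'cV_p, l' *m w = 0) -> l' = 0.
  move=> h; apply/rowP => j; have := congr1 (fun M : 'M[R[i]]_1 => M ord0 ord0) (h (delta_mx j ord0)).
  by rewrite -colE !mxE.
have l1z : l1 = 0 by apply: zero.
have l2z : l2 = 0.
  apply: zero => w; have := key (conjm w); rewrite l1z mul0mx add0r.
  by congr (_ *m _ = _); apply/matrixP => i j; rewrite !mxE conjCK.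
by rewrite l1z l2z row_mx0.
Qed.

End Transversal.

Section Swap.
Variables (a1 a2 eta : fpsmap R p p).
Hypothesis a1c : centered a1.
Hypothesis a2c : centered a2.
Hypothesis etac : centered eta.
Hypothesis a2eta : mcomp a2 eta = a1.
Hypothesis E_eq : forall j, fcomp (E j) (pullback a1) =
  fcomp (E j) (mpair a1 (mcomp (mconj a2) eta)).
Hypothesis rows_neq0 : forall l,
  exists i, (conjm (jac a1) - conjm (jac a2) *m jac eta) l i != 0.

(** [quad_sign] compares conj a_1 with conj a_2(eta) in every form; equality is excluded by
    [rows_neq0], so all signs are opposite. F also reverses all signs, so F(n_1) and n_2(eta) agree
    to first order, and [quad_unique] concludes. *)
Lemma fiber_map_swap F : fiber_map E F -> signs c pr F (fun=> true) ->
  mcomp F (pullback a1) = mcomp (pullback a2) eta.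
Proof.
move=> dF Fs; have [Fv Fc _] := dF; have eF := fiber_map_mpair dF.
have n1c := pullback_centered a1c; have a1c' := mconj_centered a1c.
pose f := mcomp (msnd F) (pullback a1); pose b := mcomp (mconj a2) eta.
have fc : centered f by apply: mcomp_centered => // j; apply: Fc.
have bc : centered b by apply: mcomp_centered => //; apply: mconj_centered.
have Fn1 : mcomp F (pullback a1) = mpair a1 f.
  by rewrite eF mcomp_mpair {1}/pullback mcomp_zvar // msnd_mpair.
have qf j i : qform c pr a1 f j (munit i) = - qform c pr a1 (mconj a1) j (munit i).
  rewrite !qform_jac // -Fn1 jac_mcomp // mulmxA Fs expr1 scaleN1r mulNmx mxE //.
have neq j : ~ (forall i, qform c pr a1 (mconj a1) j (munit i) = qform c pr a1 b j (munit i)).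
  move=> h; have [i /eqP] := rows_neq0 (pr j); apply.
  have -> : conjm (jac a1) - conjm (jac a2) *m jac eta = jac (mconj a1) - jac b.
    by rewrite /b (jac_mcomp (mconj a2) etac) (jac_mconj a1) (jac_mconj a2).
  have c2 : 2 * c j != 0 by rewrite mulf_neq0 // pnatr_eq0.
  have := h i; rewrite /qform !fcoefD !fcoefCM => /addrI /(mulfI c2) e.
  by rewrite !mxE e subrr.
have opp j i : qform c pr a1 (mconj a1) j (munit i) = - qform c pr a1 b j (munit i).
  by have [/(neq j)|] := quad_sign EQ a1c a1c' bc (E_eq j).
have fb : f = b.
  apply: (quad_unique c0 pr_inj EQ a1c fc bc) => [j|j i|j].
  - by rewrite -Fn1 -E_eq -fcompA // (fiber_map_E _ dF).
  - by rewrite qf opp opprK.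
  apply: contrapT => /forallNP h; apply: (neq j) => i.
  have /negP/negPn/eqP z := h i; rewrite qf opp opprK in z.
  by rewrite opp z oppr0.
by rewrite Fn1 fb {1}/pullback mcomp_mpair a2eta.
Qed.

End Swap.

Section Pair.
Variables (a1 a2 : fpsmap R p p).
Hypothesis a1c : centered a1.
Hypothesis a2c : centered a2.
Hypothesis spanA : forall w : 'cV[R[i]]_p, exists u v : 'cV[R]_p,
  w = jac a1 *m u%:CM + jac a2 *m v%:CM.

(** The matrix W in question satisfies N (1, -B) = (0, W) with N invertible. Hence W has a left
    inverse and no zero row. *)
Lemma pair_rows_neq0 (B : 'M[R[i]]_p) l : jac a2 *m B = jac a1 ->
  exists i, (conjm (jac a1) - conjm (jac a2) *m B) l i != 0.
Proof.
move=> aB; apply: contrapT => /forallNP h.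
set W := conjm (jac a1) - conjm (jac a2) *m B in h.
have Nu := transversal_unit spanA; set N := block_mx _ _ _ _ in Nu.
have NW : N *m col_mx 1%:M (- B) = col_mx 0 W.
  by rewrite mul_block_col !mulmx1 !mulmxN aB subrr.
pose X := row_mx 1%:M 0 *m invmx N.
have : X *m col_mx 0 W = 1%:M.
  by rewrite -NW /X -mulmxA mulKmx // mul_row_col mulmx1 mul0mx addr0.
rewrite -[X]hsubmxK mul_row_col mulmx0 add0r => /mulmx1_unit[_ Wu].
have : delta_mx ord0 l *m W = 0 :> 'rV_p.
  by rewrite -rowE; apply/rowP => i; rewrite !mxE; have /negP/negPn/eqP := h i; rewrite !mxE.
move/(congr1 (mulmx^~ (invmx W))); rewrite mulmxK // mul0mx => /rowP/(_ l).
by rewrite !mxE !eqxx => /eqP; rewrite oner_eq0.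
Qed.

End Pair.

Lemma jac_real_part (a : fpsmap R p p) : centered a -> jac (mcomp E (pullback a)) = 0.
Proof.
move=> ac; rewrite jac_mcomp; last exact: pullback_centered.
suff -> : jac E = 0 by rewrite mul0mx.
by apply/matrixP => i j; rewrite !mxE (ford2_E EQ) // mdeg_unit.
Qed.

(** A complex kernel vector u + iv gives A u = i A(-v). Total reality then kills the tangent vector
    of u, and injectivity gives u = 0 and v = 0. *)
Lemma totally_real_unitmx (psi : fpsmap R p (p + p)) (A : 'M[R[i]]_p) :
  totally_real psi -> jac psi = col_mx A 0 -> A \in unitmx.
Proof.
case=> _ inj tot jpsi; rewrite -unitmx_tr -row_free_unit -kermx_eq0.
apply/rowV0P => l /sub_kermxP lA; have Al : A *m l^T = 0.
  by rewrite -[A]trmxK -trmx_mul lA trmx0.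
pose u : 'cV[R]_p := \col_j complex.Re (l ord0 j).
pose v : 'cV[R]_p := \col_j complex.Im (l ord0 j).
have le : l^T = u%:CM + 'i%C *: v%:CM.
  apply/matrixP => j k; rewrite !mxE !ord1; apply/eqP.
  by rewrite eq_complex /= !(mul0r, mul1r, add0r, addr0, subr0, mulr0, sub0r, oppr0) !eqxx.
have tE x : tangent_map psi x = col_mx (A *m x%:CM) 0.
  by rewrite /tangent_map jpsi mul_col_mx mul0mx.
have Auv : A *m u%:CM = 'i%C *: (A *m (- v)%:CM).
  move: Al; rewrite le mulmxDr -scalemxAr => /eqP; rewrite addr_eq0 => /eqP ->.
  by rewrite map_mxN mulmxN scalerN.
have u0 : tangent_map psi u = 0.
  by apply: (tot u (- v)); rewrite !tE scale_col_mx scaler0 -Auv.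
have uz := inj _ u0.
have vz : v = 0.
  apply: inj; rewrite tE; suff -> : A *m v%:CM = 0 by rewrite col_mx0.
  have i0 : ('i%C : R[i]) != 0 by rewrite eq_complex /= oner_eq0 andbF.
  apply: (scalerI i0); rewrite scaler0 scalemxAr.
  by move: Al; rewrite le uz map_mx0 add0r.
by rewrite -[l]trmxK le uz vz !map_mx0 scaler0 addr0 trmx0.
Qed.

Section Main.
Variable tau : 'I_p -> fpsmap R (p + p) (p + p).
Variable mu : 'I_p -> R[i].
Hypothesis Ev : mconvergent E.
Hypothesis maxE : max_deck E.
Hypothesis tau_gen : deck_generators E tau.
Hypothesis eigen : eigenvalues (sigma tau) mu.
Hypothesis nonres : nonresonant mu.
Hypothesis brunoE : bruno mu.

Section Parametrizations.
Variables (a1 a2 k : fpsmap R p p).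
Hypothesis a1c : centered a1.
Hypothesis a2c : centered a2.
Hypothesis a1u : jac a1 \in unitmx.
Hypothesis a2u : jac a2 \in unitmx.
Hypothesis ka1 : mcomp k a1 = mcomp E (pullback a1).
Hypothesis ka2 : mcomp k a2 = mcomp E (pullback a2).
Hypothesis spanA : forall w : 'cV[R[i]]_p, exists u v : 'cV[R]_p,
  w = jac a1 *m u%:CM + jac a2 *m v%:CM.

(** Stated for general b1, b2 because it is used for both orders of a1 and a2. *)
Lemma graph_swap (b1 b2 eta : fpsmap R p p) F :
  centered b1 -> centered b2 -> centered eta -> mcomp b2 eta = b1 ->
  mcomp k b1 = mcomp E (pullback b1) -> mcomp k b2 = mcomp E (pullback b2) ->
  (forall w : 'cV[R[i]]_p, exists u v : 'cV[R]_p,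
     w = jac b1 *m u%:CM + jac b2 *m v%:CM) ->
  fiber_map E F -> signs c pr F (fun=> true) ->
  mcomp F (pullback b1) = mcomp (pullback b2) eta.
Proof.
move=> b1c b2c etac b2eta kb1 kb2 span dF Fs; apply: fiber_map_swap => // [j|l].
  have e : mpair b1 (mcomp (mconj b2) eta) = mcomp (pullback b2) eta.
    by rewrite mcomp_mpair b2eta.
  rewrite e -fcompA //; last exact: pullback_centered.
  have := congr1 (fun f => f j) kb1; rewrite /mcomp => <-.
  have := congr1 (fun f => f j) kb2; rewrite /mcomp => <-.
  by rewrite fcompA // b2eta.
apply: pair_rows_neq0 => //.
by rewrite -jac_mcomp // b2eta.
Qed.

Lemma graph_convergent : mconvergent k.
Proof.
have [td ts] := tau1_signs c0 pr_inj EQ maxE tau_gen.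
have [tv tc _] := td.
have t2c : centered (tau2 tau) by apply: rho0_conj_centered.
have t2v : mconvergent (tau2 tau) by apply: rho0_conj_convergent.
have sc : centered (sigma tau) by apply: mcomp_centered.
have sv : mconvergent (sigma tau) by apply: mconvergent_mcomp.
have [al1 [al1c a1al1 al1a1 jal1]] := formal_inverse a1c a1u.
have [al2 [al2c a2al2 al2a2 jal2]] := formal_inverse a2c a2u.
have span' w : exists u v : 'cV[R]_p, w = jac a2 *m u%:CM + jac a1 *m v%:CM.
  by have [u [v ->]] := spanA w; exists v, u; rewrite addrC.
(* [eta] and [eta'] match the parameters of points of N_1 and N_2 that have the same z', hence the
   same image in K. *)
pose eta := mcomp al2 a1; pose eta' := mcomp al1 a2.
have etac : centered eta by apply: mcomp_centered.
have eta'c : centered eta' by apply: mcomp_centered.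
have a2eta : mcomp a2 eta = a1 by rewrite /eta -mcompA // a2al2 mcomp_idl.
have a1eta' : mcomp a1 eta' = a2 by rewrite /eta' -mcompA // a1al1 mcomp_idl.
have ceta := mconj_centered etac; have ceta' := mconj_centered eta'c.
have n1c := pullback_centered a1c; have n2c := pullback_centered a2c.
have t1n1 : mcomp (tau1 tau) (pullback a1) = mcomp (pullback a2) eta by apply: graph_swap.
have t1n2 : mcomp (tau1 tau) (pullback a2) = mcomp (pullback a1) eta' by apply: graph_swap.
have tau2_swap (b1 b2 et : fpsmap R p p) : centered b1 -> centered b2 -> centered et ->
    mcomp (tau1 tau) (pullback b1) = mcomp (pullback b2) et ->
    mcomp (tau2 tau) (pullback b1) = mcomp (pullback b2) (mconj et).
  move=> b1c b2c etc; rewrite /tau2 => h.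
  rewrite rho0_conj_mcomp //; last exact: mconj_centered.
  rewrite mconjK -/(pullback b1).
  have hf : mcomp (mfst (tau1 tau)) (pullback b1) = mcomp b2 et.
    move: h; rewrite -{1}[tau1 tau]mpair_split mcomp_mpair /pullback mcomp_mpair.
    by move/(congr1 (@mfst _ p p)); rewrite !mfst_mpair.
  have hs : mcomp (msnd (tau1 tau)) (pullback b1) = mcomp (mconj b2) et.
    move: h; rewrite -{1}[tau1 tau]mpair_split mcomp_mpair /pullback mcomp_mpair.
    by move/(congr1 (@msnd _ p p)); rewrite !msnd_mpair.
  by rewrite hf hs /pullback mcomp_mpair !mconj_mcomp // mconjK.
have t2n1 := tau2_swap a1 a2 eta a1c a2c etac t1n1.
have t2n2 := tau2_swap a2 a1 eta' a2c a1c eta'c t1n2.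
(* sigma n_1 = tau_1 n_2 (conj eta) = n_1 eta' (conj eta): [s] is sigma on N_1 in the parameters of
   n_1, and [s'] is its analogue on N_2. *)
pose s := mcomp eta' (mconj eta); pose s' := mcomp eta (mconj eta').
have sgn1 : mcomp (sigma tau) (pullback a1) = mcomp (pullback a1) s.
  by rewrite /sigma mcompA // t2n1 -mcompA // t1n2 mcompA.
have sgn2 : mcomp (sigma tau) (pullback a2) = mcomp (pullback a2) s'.
  by rewrite /sigma mcompA // t2n2 -mcompA // t1n1 mcompA.
have sc1 : centered s by apply: mcomp_centered.
have sc2 : centered s' by apply: mcomp_centered.
pose H := jac eta; have HA : H = invmx (jac a2) *m jac a1 by rewrite /H /eta jac_mcomp // jal2.
have Hu : H \in unitmx by rewrite HA unitmx_mul unitmx_inv a2u.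
have jeta' : jac eta' = invmx H.
  rewrite /eta' jac_mcomp // jal1; apply: (can_inj (mulKmx Hu)).
  by rewrite mulmxV // HA -mulmxA mulKVmx // mulVmx.
have js : jac s = invmx H *m conjm H by rewrite /s jac_mcomp // jeta' jac_mconj.
have js' : jac s' = H *m conjm (invmx H) by rewrite /s' jac_mcomp // jac_mconj jeta'.
pose N := block_mx (jac a1) (jac a2) (conjm (jac a1)) (conjm (jac a2)).
have Nu : N \in unitmx := transversal_unit spanA.
have jn (b : fpsmap R p p) : jac (pullback b) = col_mx (jac b) (conjm (jac b)).
  by rewrite jac_mpair jac_mconj.
have NE : N = row_mx (jac (pullback a1)) (jac (pullback a2)).
  by rewrite !jn -block_mxEh.
have LN : jac (sigma tau) *m N = N *m block_mx (jac s) 0 0 (jac s').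
  rewrite NE mul_mx_row mul_row_block !mulmx0 addr0 add0r.
  by rewrite -!jac_mcomp // sgn1 sgn2.
have [mu0 cp] := eigen.
(* With S = H^-1 conj(H) and S' = H conj(H^-1), this says that S' is conjugate to S^-1 by H. *)
have S'S : jac s' *m H *m jac s = H.
  by rewrite js js' -!mulmxA mulKVmx // -map_mxM mulVmx // map_mx1 mulmx1.
have [P Pu [kappa sP kappa_inj]] := block_spectrum mu0 nonres cp Nu Hu LN S'S.
have [T Tu [kappa' LT]] := spectrum_diagonalizable mu0 nonres cp.
pose lam j := mu_hat mu (kappa j).
have [th [thc jth] sth] := formal_linearization sc1 Pu sP
  (fun Q j h => nonresonant_divisor mu0 nonres kappa_inj (kappa j) h).
pose phi := mcomp (pullback a1) th.
have phic : centered phi by apply: mcomp_centered.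
have sphi : mcomp (sigma tau) phi = mcomp phi (diag_map lam).
  have lc := @diag_map_centered R p lam.
  by rewrite /phi -mcompA // sgn1 mcompA // sth mcompA.
have phiv : mconvergent phi.
  have [p0|p_gt0] := posnP p; first by move=> i; exfalso; case: i => i; lia.
  have [w [B [B0 w0 w1 wB [wM wD]]]] :=
    small_divisor_weight mu0 nonres kappa_inj p_gt0 brunoE.
  apply: (conjugacy_convergent sv sc phic sphi Tu LT B0 w0 w1 wB wM) => P' S' j.
  exact: wD.
(* Neither a_1 nor theta is known to converge. Their composite does, being the first half of [phi],
   and only this composite is inverted. *)
pose phi' := mcomp a1 th.
have phi'E : phi' = mfst phi by rewrite /phi /pullback mcomp_mpair mfst_mpair.
have phi'v : mconvergent phi' by rewrite phi'E => i; apply: phiv.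
have phi'c : centered phi' by apply: mcomp_centered.
have phi'u : jac phi' \in unitmx by rewrite jac_mcomp // jth unitmx_mul a1u.
have [be [bec phibe _ _]] := formal_inverse phi'c phi'u.
have bev := convergent_inverse phi'v phi'c bec phi'u phibe.
have -> : k = mcomp (mcomp E phi) be.
  by rewrite /phi -mcompA // -ka1 [mcomp (mcomp k a1) th]mcompA // mcompA // phibe mcomp_idr.
apply: mconvergent_mcomp => //; exact: mconvergent_mcomp.
Qed.

End Parametrizations.

Lemma fconvergent_sub_graph (k : fpsmap R p p) j : mconvergent k ->
  fconvergent (fvar (rshift p j) - fcomp (k j) (@zvar R p)).
Proof.
move=> kv; apply: fconvergentD; first exact: fconvergent_var.
apply: fconvergentN; apply: fconvergent_fcomp => //; last exact: zvar_centered.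
by move=> i; apply: fconvergent_var.
Qed.

Lemma attached_convergent (K : set (fps R (p + p))) :
  attached E K -> convergent_submanifold p K.
Proof.
case=> -[f0 [f0c f0r] KE] [psi1 [psi2 [[tr1 tr2] [pK1 pK2] [pE1 pE2] trans]]].
have cen (psi : fpsmap R p (p + p)) : totally_real psi -> centered (mfst psi) by case=> h _ _ j; apply: h.
pose a1 := mfst psi1; pose a2 := mfst psi2.
have a1c : centered a1 := cen _ tr1; have a2c : centered a2 := cen _ tr2.
have psiE (psi : fpsmap R p (p + p)) : contained_in_real psi E -> psi = mpair (mfst psi) (mcomp E (pullback (mfst psi))).
  by move=> h; rewrite -{1}[psi]mpair_split [msnd psi]h.
have e1 : psi1 = mpair a1 (mcomp E (pullback a1)) := psiE _ pE1.
have e2 : psi2 = mpair a2 (mcomp E (pullback a2)) := psiE _ pE2.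
have j1 : jac psi1 = col_mx (jac a1) 0 by rewrite e1 jac_mpair jac_real_part.
have j2 : jac psi2 = col_mx (jac a2) 0 by rewrite e2 jac_mpair jac_real_part.
have a1u := totally_real_unitmx tr1 j1; have a2u := totally_real_unitmx tr2 j2.
have [psi1c _ _] := tr1; have [psi2c _ _] := tr2.
(* The columns of jac psi1 are those of jac a1 completed by 0; as jac a1 is invertible over C, a
   complex linear form killing them kills every (w, 0). *)
have lin_zero (a : fps R (p + p)) : fcomp a psi1 = 0 ->
    forall w, \sum_i a (munit i) * (col_mx w 0 : 'cV_(p + p)) i ord0 = 0.
  move=> az w; have -> : col_mx w 0 = jac psi1 *m (invmx (jac a1) *m w).
    by rewrite j1 mul_col_mx mulKVmx // mul0mx.
  have rz : (\row_i a (munit i)) *m jac psi1 = 0.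
    apply/rowP => j; have := congr1 (fun x : fps R p => x (munit j)) az.
    rewrite fcomp_unit // => h; rewrite !mxE -[RHS]h.
    by apply: eq_bigr => i _; rewrite !mxE.
  have : (\row_i a (munit i)) *m (jac psi1 *m (invmx (jac a1) *m w)) = 0.
    by rewrite mulmxA rz mul0mx.
  move/(congr1 (fun M : 'M[R[i]]_1 => M ord0 ord0)); rewrite mxE [RHS]mxE => h.
  by rewrite -[RHS]h; apply: eq_bigr => i _; rewrite [in RHS]mxE.
have spanA (w : 'cV[R[i]]_p) : exists u v : 'cV[R]_p,
    w = jac a1 *m u%:CM + jac a2 *m v%:CM.
  have [|u [v]] := trans (col_mx w 0); first by move=> a /pK1 az; apply: lin_zero.
  rewrite /tangent_map j1 j2 !mul_col_mx !mul0mx add_col_mx addr0.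
  by move=> /eq_col_mx[-> _]; exists u, v.
have [al1 [al1c a1al1 al1a1 _]] := formal_inverse a1c a1u.
pose k := mcomp (mcomp E (pullback a1)) al1.
have n1c := pullback_centered a1c; have n2c := pullback_centered a2c.
have Ec := E_centered EQ.
have En1c : centered (mcomp E (pullback a1)) by apply: mcomp_centered.
have kc : centered k by apply: mcomp_centered.
have zc := @zvar_centered R p; have mc := @midm_centered R p.
pose g : fpsmap R (p + p) p := fun j => fvar (rshift p j) - fcomp (k j) (@zvar R p).
have gc : centered g.
  apply/centeredP => j; apply: fordB; first exact: ford_var.
  by apply: ford_fcomp => //; have /centeredP := kc; apply.
have mkc : centered (mpair midm k) by apply: mpair_centered.
have gk n (a b : fpsmap R n p) j : centered a -> centered b ->
    fcomp (g j) (mpair a b) = b j - fcomp (k j) a.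
  move=> ac bc; have abc := mpair_centered ac bc; rewrite /g fcompB // fcomp_var // mpair_rshift.
  by rewrite fcompA // mcomp_zvar.
have gk0 : mcomp g (mpair midm k) = (fun=> 0).
  by apply: funext => j; rewrite /mcomp gk // fcomp_midm subrr.
have psi1al1 : mcomp psi1 al1 = mpair midm k.
  by rewrite e1 mcomp_mpair a1al1.
have f0k : mcomp f0 (mpair midm k) = (fun=> 0).
  rewrite -psi1al1; apply: funext => j; rewrite /mcomp -fcompA // pK1; last first.
    by rewrite KE; apply: ideal_generator.
  exact: fcomp0.
have jg1 : jac g *m col_mx 0 1%:M = 1%:M.
  apply/matrixP => i j; rewrite !mxE big_split_ord /= [X in X + _]big1 ?add0r => [|l _]; last first.
    by rewrite col_mxEu !mxE mulr0.
  rewrite (bigD1 j) //= col_mxEd [X in _ + X]big1 ?addr0 => [|l /negbTE lj]; last first.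
    by rewrite col_mxEd !mxE lj mulr0.
  rewrite !mxE eqxx mulr1 /g fcoefB /fvar (inj_eq (@munit_inj _)) (inj_eq (@rshift_inj _ _)).
  rewrite fcomp_unit // big1 ?subr0 => [|l _]; first by rewrite eq_sym; case: eqP.
  by rewrite /zvar /fvar (inj_eq (@munit_inj _)) eq_rlshift mulr0.
have jf0z (w : 'cV_p) : jac f0 *m col_mx w 0 = 0.
  apply/matrixP => i j; rewrite !mxE ord1.
  have Kf : K (f0 i) by rewrite KE; apply: ideal_generator.
  rewrite -[RHS](lin_zero (f0 i) (pK1 _ Kf) w).
  by apply: eq_bigr => l _; rewrite mxE.
pose B := jac f0 *m col_mx 0 1%:M.
(* The z-derivatives of [f0] vanish at 0, so the rank p of its Jacobian is carried by the block [B]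
   of w-derivatives. *)
have Bu : B \in unitmx.
  have jf0 : jac f0 = row_mx 0 B.
    have -> : jac f0 = jac f0 *m row_mx (col_mx 1%:M 0) (col_mx 0 1%:M).
      by rewrite -block_mxEh -scalar_mx_block mulmx1.
    rewrite mul_mx_row; congr row_mx; apply/matrixP => i j.
    transitivity ((jac f0 *m col_mx (delta_mx j ord0 : 'cV_p) 0) i ord0); last by rewrite jf0z !mxE.
    rewrite mxE [RHS]mxE; apply: eq_bigr => l _; congr (_ * _).
    by rewrite !mxE; case: fintype.split => l'; rewrite !mxE ?eqxx ?andbT.
  rewrite -row_full_unit /row_full -[X in _ == X]f0r jf0.
  by rewrite rank_row_0mx.
(* Both [f0] and [g] vanish on the graph of k and have invertible w-derivative, so each ideal
   contains the other. *)
have KgE : K = ideal g.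
  rewrite KE; apply/seteqP; split; apply: ideal_sub => j.
    by apply: (graph_ideal gc kc jg1 (unitmx1 _ _) gk0 f0k).
  exact: (graph_ideal f0c kc erefl Bu f0k gk0).
have ka1 : mcomp k a1 = mcomp E (pullback a1).
  by rewrite /k mcompA // al1a1 mcomp_idr.
have ka2 : mcomp k a2 = mcomp E (pullback a2).
  have En2c : centered (mcomp E (pullback a2)) by apply: mcomp_centered.
  apply: funext => j; have Kg : K (g j) by rewrite KgE; apply: ideal_generator.
  have := pK2 _ Kg; rewrite {1}e2 gk // => /eqP.
  by rewrite subr_eq0 => /eqP ->.
have kv := graph_convergent a1c a2c a1u a2u ka1 ka2 spanA.
exists g; split=> //; first by move=> j; apply: fconvergent_sub_graph.
split=> //; apply/eqP; rewrite eqn_leq rank_leq_row /=.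
by rewrite -{1}(mxrank1 R[i] p) -jg1 mxrankM_maxl.
Qed.

End Main.
End Attached.

(** * Coefficients of product quadrics *)

Section QuadricData.
Variables (R : realType) (e h s : nat).
Variables (ge : 'I_e -> R) (gh : 'I_h -> R) (gs : 'I_s -> R[i]).

Lemma quadric_partnerK : involutive (@quadric_partner e h s).
Proof.
have mL T p q (a : 'I_p -> T) (b : 'I_q -> T) j : mpair a b (lshift q j) = a j.
  by rewrite /mpair (unsplitK (inl j)).
have mR T p q (a : 'I_p -> T) (b : 'I_q -> T) j : mpair a b (rshift p j) = b j.
  by rewrite /mpair (unsplitK (inr j)).
move=> j; rewrite /quadric_partner -[j]splitK; case: (fintype.split j) => a /=.
  by rewrite !mL.
rewrite -[a]splitK; case: (fintype.split a) => b /=.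
  by rewrite !(mL, mR).
by rewrite !(mL, mR).
Qed.

Lemma quadric_coef_neq0 : quadric_parameters ge gh gs ->
  forall j, quadric_coef ge gh gs j != 0.
Proof.
case=> geP ghP gsP j; rewrite /quadric_coef /mpair.
have half : 0 < 2^-1 :> R by rewrite invr_gt0.
case: fintype.split => [a|a]; case: fintype.split => b.
- have /andP[g0 _] := geP b.
  by rewrite eq_complex /= eqxx andbT lt0r_neq0.
- by rewrite eq_complex /= eqxx andbT lt0r_neq0 // (lt_trans half).
- have [g1 _] := gsP b.
  by rewrite eq_complex /= negb_and lt0r_neq0 // (lt_trans half).
(* If 1 - conj gamma vanished, gamma would be 1, against Im gamma > 0. *)
- have [_ g2] := gsP b; rewrite subr_eq0; apply/eqP => /(congr1 (@Num.conj_op R[i])).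
  by rewrite conjCK rmorph1 => g1; move: g2; rewrite -g1 /= ltxx.
Qed.

End QuadricData.

Theorem theorem1p12 (R : realType) (e h s : nat)
  (ge : 'I_e -> R) (gh : 'I_h -> R) (gs : 'I_s -> R[i])
  (E : fpsmap R (qdim e h s + qdim e h s) (qdim e h s))
  (tau : 'I_(qdim e h s) ->
    fpsmap R (qdim e h s + qdim e h s) (qdim e h s + qdim e h s))
  (mu : 'I_(qdim e h s) -> R[i]) :
  quadric_parameters ge gh gs ->
  third_order_perturbation ge gh gs E ->
  max_deck E ->
  deck_generators E tau ->
  eigenvalues (sigma tau) mu ->
  nonresonant mu ->
  e = 0%N ->
  bruno mu ->
  forall K : set (fps R (qdim e h s + qdim e h s)),
    attached E K -> convergent_submanifold (qdim e h s) K.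
Proof.
move=> par [Ev EQ] maxE gen eig nonres _ br K attK.
have quadE j Q : (mdeg Q <= 2)%N ->
    E j Q = quad (quadric_coef ge gh gs) (@quadric_partner e h s) j Q.
  by move=> Q2; rewrite EQ // /quadric fpsexpE.
exact: (attached_convergent (quadric_coef_neq0 par) (can_inj (@quadric_partnerK e h s))
  quadE Ev maxE gen eig nonres br).
Qed.
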